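(* Let $B$ be a unital $C^*$-algebra and let $S\subset B$ be an operator system such that $B=C^*(S)$. Then there exists a projection $\mathfrak{d}\in B^{**}$ with the property that a state $\phi$ on $B$ is $\mathcal{D}(S,B)$-maximal if and only if $\phi(\mathfrak{d})=1$ (where $\phi$ is extended to $B^{**}$ by weak-$*$ continuity).
   Context: An operator system $S\subset B$ is a unital self-adjoint linear subspace; $C^*(S)$ is the $C^*$-algebra it generates. $\mathcal{E}(B)$ denotes the state space of $B$. A representation of a state $\phi$ on $B$ is a triple $(\pi,H,\xi)$ consisting of a unital $*$-representation $\pi:B\to B(H)$ and a unit vector $\xi\in H$ (not necessarily cyclic) with $\phi(b)=\langle \pi(b)\xi,\xi\rangle$ for all $b\in B$. Dilation order: $\mathcal{D}(S,B)\subset \mathcal{E}(B)\times\mathcal{E}(B)$ is the set of pairs of states $(\phi,\psi)$ for which there are representations $(\pi,H,\xi)$ of $\phi$ and $(\sigma,K,\eta)$ of $\psi$, and an isometry $V:H\to K$ with $V\xi=\eta$, such that $\pi(a)=V^*\sigma(a)V$ for all $a\in S$. This is a partial order on $\mathcal{E}(B)$. A state $\phi$ is $\mathcal{D}(S,B)$-maximal if $(\phi,\psi)\in\mathcal{D}(S,B)$ implies $\psi=\phi$. $B^{**}$ denotes the bidual of $B$, which is a von Neumann algebra. *)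

(* Defs.v *)
From HB Require Import structures.
From mathcomp Require Import all_boot all_order all_algebra.
From mathcomp Require Import sesquilinear complex.
From mathcomp Require Import boolp classical_sets functions reals.
From mathcomp Require Import topology normedtype.
Set Implicit Arguments.
Unset Strict Implicit.
Unset Printing Implicit Defensive.
Import Order.TTheory GRing.Theory Num.Theory.
Import numFieldNormedType.Exports.
Local Open Scope classical_set_scope.
Local Open Scope ring_scope.

Section BoundedOperators.
Context {R : realType} (V W : normedModType R[i]).

Definition blin_pred : {pred V -> W} :=
  fun f => `[< linear f /\ continuous f >].

(* Bounded operators V -> W, normed below by the operator norm onorm. *)
Record blin := Blin { blin_fun :> V -> W; _ : blin_fun \in blin_pred }.

HB.instance Definition _ := [isSub for blin_fun].
HB.instance Definition _ := [Choice of blin by <:].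

Lemma bounded_blin_pred (f : V -> W) (M : R[i]) : linear f ->
  (forall x, `|f x| <= M * `|x|) -> f \in blin_pred.
Proof.
move=> lf hM.
pose F : {linear V -> W} := HB.pack f (GRing.isLinear.Build _ _ _ _ f lf).
apply/asboolP; split=> //.
apply/(linear_bounded_continuous F)/bounded_funP => r.
exists (`|M| * r) => x xr.
apply: (le_trans (hM x)); apply: (@le_trans _ _ (`|M| * `|x|)); last first.
  by rewrite ler_wpM2l.
have : 0 <= M * `|x| by apply: le_trans (hM x).
by move=> h0; rewrite -[leLHS](ger0_norm h0) normrM normr_id.
Qed.

Lemma blin_predP (f : V -> W) : f \in blin_pred <->
  linear f /\ exists2 M : R[i], 0 <= M & forall x, `|f x| <= M * `|x|.
Proof.
split=> [/asboolP[lf cf]|[lf [M _ hM]]]; last exact: bounded_blin_pred hM.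
split=> //.
pose F : {linear V -> W} := HB.pack f (GRing.isLinear.Build _ _ _ _ f lf).
have /linear_boundedP/pinfty_ex_gt0[M M0 hM] :=
  (linear_bounded_continuous F).2 cf.
by exists M => //; exact: ltW.
Qed.

Lemma blin_pred_submod : GRing.submod_closed blin_pred.
Proof.
split=> [|a f g /blin_predP[lf [M M0 hM]] /blin_predP[lg [N N0 hN]]].
  apply: (@bounded_blin_pred _ 0) => [? ? ?|x].
    by rewrite scaler0 addr0.
  by rewrite normr0 mul0r.
apply: (@bounded_blin_pred _ (`|a| * M + N)) => [z x y|x] /=.
  rewrite !fctE lf lg !scalerDr !scalerA (mulrC z a).
  by rewrite -!addrA; congr (_ + _); rewrite addrCA.
rewrite !fctE (le_trans (ler_normD _ _))// mulrDl lerD// normrZ -mulrA.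
by rewrite ler_wpM2l.
Qed.

HB.instance Definition _ :=
  GRing.isSubmodClosed.Build R[i] (V -> W) blin_pred
   (GRing.submod_closed_semi blin_pred_submod).
HB.instance Definition _ := [SubChoice_isSubLmodule of blin by <:].

Lemma blin_linear (f : blin) : linear f.
Proof. by case: f => f /= /asboolP[]. Qed.

HB.instance Definition _ (f : blin) :=
  GRing.isLinear.Build R[i] V W *:%R (blin_fun f) (blin_linear f).

Lemma blin_continuous (f : blin) : continuous f.
Proof. by case: f => f /= /asboolP[]. Qed.

Lemma blinP (f g : blin) : f =1 g -> f = g.
Proof. by move=> fg; apply/val_inj/funext. Qed.

Lemma blinD (f g : blin) x : (f + g) x = f x + g x. Proof. by []. Qed.
Lemma blinZ (a : R[i]) (f : blin) x : (a *: f) x = a *: f x. Proof. by []. Qed.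

(* Norms of normed modules over R[i] take their values in R[i]; the supremum
   is taken over the corresponding reals. *)
Definition onorm (f : blin) : R[i] :=
  real_complex R (sup [set complex.Re `|f x| | x in [set x | `|x| <= 1]]).

Let lecRe (a b : R[i]) : a <= b -> complex.Re a <= complex.Re b.
Proof. by rewrite lecE => /andP[]. Qed.

Let normRe (U : normedModType R[i]) (x : U) :
  `|x| = real_complex R (complex.Re `|x|).
Proof. by rewrite RRe_real// normr_real. Qed.

Lemma le_onorm (f : blin) x : `|f x| <= onorm f * `|x|.
Proof.
have [lf [M M0 hM]] := (blin_predP f).1 (valP f).
have ub y : `|y| <= 1 -> `|f y| <= onorm f.
  move=> y1; rewrite normRe /onorm lecR; apply: ub_le_sup; last by exists y.
  exists (complex.Re M) => _ [z z1 <-]; apply: lecRe.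
  by apply: (le_trans (hM z)); rewrite ler_piMr.
have [->|x0] := eqVneq x 0; first by rewrite linear0 !normr0 mulr0.
have nx0 : 0 < `|x| by rewrite normr_gt0.
have := ub (`|x|^-1 *: x).
rewrite linearZ/= !normrZ normfV normr_id mulVf ?normr_eq0// => /(_ (lexx _)).
by rewrite ler_pdivrMl// mulrC.
Qed.

Lemma onorm_le (f : blin) (M : R[i]) : 0 <= M ->
  (forall x, `|f x| <= M * `|x|) -> onorm f <= M.
Proof.
move=> M0 hM; have Mr : M = real_complex R (complex.Re M).
  by rewrite RRe_real// ger0_real.
rewrite Mr /onorm lecR; apply: ge_sup.
  by exists (complex.Re `|f 0|), 0 => //=; rewrite normr0.
move=> _ [x x1 <-]; apply: lecRe.
by apply: (le_trans (hM x)); rewrite ler_piMr.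
Qed.

Lemma onorm_ge0 (f : blin) : 0 <= onorm f.
Proof.
rewrite /onorm (_ : 0 = real_complex R 0)// lecR.
have [lf [M M0 hM]] := (blin_predP f).1 (valP f).
apply: ub_le_sup; last by exists 0; rewrite /= ?linear0 normr0.
exists (complex.Re M) => _ [z z1 <-]; apply: lecRe.
by apply: (le_trans (hM z)); rewrite ler_piMr.
Qed.

Lemma onormD (f g : blin) : onorm (f + g) <= onorm f + onorm g.
Proof.
apply: onorm_le => [|x]; first by rewrite addr_ge0 ?onorm_ge0.
by rewrite blinD mulrDl (le_trans (ler_normD _ _))// lerD ?le_onorm.
Qed.

Lemma onormZ (a : R[i]) (f : blin) : onorm (a *: f) = `|a| * onorm f.
Proof.
have le b (g : blin) : onorm (b *: g) <= `|b| * onorm g.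
  apply: onorm_le => [|x]; first by rewrite mulr_ge0 ?onorm_ge0.
  by rewrite blinZ normrZ -mulrA ler_wpM2l ?le_onorm.
apply/eqP; rewrite eq_le le/=; have [->|a0] := eqVneq a 0.
  by rewrite normr0 mul0r onorm_ge0.
have := le a^-1 (a *: f); rewrite scalerA mulVf// scale1r normfV.
by rewrite -ler_pdivrMl ?invrK// invr_gt0 normr_gt0.
Qed.

Lemma onorm0_eq0 (f : blin) : onorm f = 0 -> f = 0.
Proof.
move=> f0; apply: blinP => x; apply/eqP; rewrite -normr_le0.
by rewrite (le_trans (le_onorm f x))// f0 mul0r.
Qed.

HB.instance Definition _ :=
  Lmodule_isNormed.Build R[i] blin onormD onormZ onorm0_eq0.

Lemma blin_normE (f : blin) : `|f| = onorm f. Proof. by []. Qed.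

Definition mkblin (f : V -> W) (lf : linear f) (M : R[i])
    (hM : forall x, `|f x| <= M * `|x|) : blin :=
  Blin (bounded_blin_pred lf hM).

End BoundedOperators.
Arguments mkblin {R V W f} lf {M} hM.

(* Complex scalars are R[i] with R : realType. *)
Definition dual {R : realType} (V : normedModType R[i]) : normedModType R[i] :=
  blin V R[i]^o.

Definition bidual {R : realType} (V : normedModType R[i]) := dual (dual V).

Section Bidual.
Context {R : realType} (V : normedModType R[i]).

Let canon_linear (v : V) : linear (fun f : dual V => f v : R[i]^o).
Proof. by []. Qed.

Let canon_bound (v : V) (f : dual V) : `|f v : R[i]^o| <= `|v| * `|f|.
Proof. by rewrite mulrC; exact: le_onorm. Qed.

Definition canon (v : V) : bidual V := mkblin (canon_linear v) (canon_bound v).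

(* The bidual with the weak-* topology (pointwise convergence on the dual). *)
Definition wstar : Type :=
  initial_topology
    (fun F : bidual V => blin_fun F : {ptws dual V -> R[i]^o}).
HB.instance Definition _ := Topological.on wstar.

(* The weak-* continuous extension of phi to the bidual: by the lemmas below,
   evaluation at phi is linear, weak-* continuous and extends phi along canon,
   and it is the only such map. *)
Definition normal_ext (phi : dual V) (F : bidual V) : R[i] := F phi.

Lemma normal_ext_canon phi v : normal_ext phi (canon v) = phi v.
Proof. by []. Qed.

Lemma normal_ext_linear phi : linear (normal_ext phi : bidual V -> R[i]^o).
Proof. by []. Qed.

Let ev (F : wstar) : {ptws dual V -> R[i]^o} :=
  blin_fun (F : bidual V).

Lemma normal_ext_continuous (phi : dual V) :
  continuous (normal_ext phi : wstar -> R[i]^o).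
Proof.
move=> F; apply: (@cvg_comp _ _ _ ev
  (fun g : {ptws dual V -> R[i]^o} => g phi) _ (nbhs (ev F)) _).
  exact: initial_continuous.
exact: ((@pointwise_cvgP (dual V) R[i]^o (nbhs (ev F)) (ev F) _).1 _ phi).
Qed.

Lemma cvg_wstar (T : Type) (N : set_system T) (h : T -> wstar) (F : wstar) :
  Filter N ->
  (forall f, (fun t => normal_ext f (h t) : R[i]^o) @ N
     --> (normal_ext f F : R[i]^o)) ->
  h @ N --> F.
Proof.
move=> NF hF A; rewrite nbhsE => -[C [[D oD <-] C0] CA].
have cv : (ev \o h) @ N --> ev F by apply/pointwise_cvgP.
have ND : N (h @^-1` (ev @^-1` D)) by apply: cv; exact: open_nbhs_nbhs.
by apply: filterS ND => t; exact: CA.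
Qed.

Let ker_span (s : seq (dual V)) (L : bidual V -> R[i]^o) :
  linear L ->
  (forall F : bidual V, {in s, forall f, F f = 0} -> L F = 0) ->
  exists f : dual V, forall F : bidual V, L F = F f.
Proof.
elim: s L => [|f s ih] L lL kL.
  by exists 0 => F; rewrite linear0; apply: kL.
have [[G Gs Gf]|nG] := pselect
    (exists2 G : bidual V, {in s, forall g, G g = 0} & G f != 0).
  have lL' : linear (fun F : bidual V => L F - L G / G f * F f : R[i]^o).
    move=> z F1 F2; rewrite lL scalerBr addrACA -opprD; congr (_ - _).
    by rewrite mulrDr /= mulrCA.
  have [F Fs|g hg] := ih _ lL'.
    have := kL (F - (F f / G f) *: G).
    have -> : F - (F f / G f) *: G = (- (F f / G f)) *: G + F.
      by rewrite scaleNr addrC.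
    rewrite lL -[_ *: L G]/(_ * _) => h.
    rewrite -[RHS]h; last first.
      move=> g; rewrite inE => /orP[/eqP->|gs].
        by rewrite -[LHS]/(- (F f / G f) * G f + F f) mulNr divfK// addNr.
      rewrite -[LHS]/(- (F f / G f) * G g + F g) (Gs _ gs) mulr0 add0r.
      exact: Fs.
    by rewrite addrC mulNr mulrAC [F f / _ * _]mulrC mulrA.
  exists (g + (L G / G f) *: f) => F.
  by rewrite linearD linearZ/= -hg subrK.
apply: ih => // F Fs; apply: kL => g; rewrite inE => /orP[/eqP->|].
  by apply/eqP; apply: contrapT => /negP Ff; apply: nG; exists F.
exact: Fs.
Qed.

Lemma normal_ext_uniq (phi : dual V) (L : bidual V -> R[i]^o) :
  linear L -> continuous (L : wstar -> R[i]^o) ->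
  (forall v, L (canon v) = phi v) -> L = normal_ext phi.
Proof.
move=> lL cL Lphi.
suff [f hf] : exists f : dual V, forall F, L F = F f.
  have -> : phi = f by apply: blinP => v; rewrite -Lphi hf.
  exact/funext.
pose N : set_system wstar := [set A : set wstar | exists s : seq (dual V),
  [set F : bidual V | {in s, forall f, F f = 0}] `<=` A].
have NF : Filter N.
  split; first by exists [::].
    move=> A C [s sA] [t tC]; exists (s ++ t) => F hF; split.
      by apply: sA => f fs; apply: hF; rewrite mem_cat fs.
    by apply: tC => f fs; apply: hF; rewrite mem_cat fs orbT.
  by move=> A C sAC [s sA]; exists s; exact: subset_trans sAC.
have N0 : N --> nbhs (0 : wstar).
  apply: (@cvg_wstar _ N id) => f A /nbhs_singleton A0; exists [:: f] => F hF.
  by change (A (F f)); rewrite (hF f (mem_head _ _)).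
have /cvgrPdist_lt/(_ 1 ltr01)[s hs] := cvg_trans (cvg_app L N0) (cL 0).
have L0 : L 0 = 0.
  by have := lL (-1) 0 0; rewrite scaler0 addr0 scaleN1r addNr.
apply: (@ker_span s) => // F Fs; apply/eqP/negP => /negP LF.
have /hs/= : {in s, forall f, ((L F)^-1 *: F + 0) f = 0}.
  by move=> f fs; rewrite addr0 blinZ Fs// scaler0.
by rewrite lL L0 addr0 sub0r normrN -[_ *: _]/(_ * _) mulVf// normr1 ltxx.
Qed.

End Bidual.

(* Unital C*-algebras, the zero algebra being allowed.  A plain record is used
   since Hierarchy-Builder admits no common substructure of the semirings and
   the normed modules other than the numDomainType branch. *)
Record cstarAlgType (R : realType) := CStarAlg {
  calg_sort : completeNormedModType R[i];
  calg_one : calg_sort;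
  calg_mul : calg_sort -> calg_sort -> calg_sort;
  calg_star : calg_sort -> calg_sort;
  calg_mulA : associative calg_mul;
  calg_mul1l : left_id calg_one calg_mul;
  calg_mul1r : right_id calg_one calg_mul;
  calg_mulDl : left_distributive calg_mul +%R;
  calg_mulDr : right_distributive calg_mul +%R;
  calg_scaleAl : forall (z : R[i]) a b,
    z *: calg_mul a b = calg_mul (z *: a) b;
  calg_scaleAr : forall (z : R[i]) a b,
    z *: calg_mul a b = calg_mul a (z *: b);
  calg_starK : involutive calg_star;
  calg_starM : forall a b,
    calg_star (calg_mul a b) = calg_mul (calg_star b) (calg_star a);
  calg_starP : forall (z : R[i]) a b,
    calg_star (z *: a + b) = z^* *: calg_star a + calg_star b;
  calg_normM : forall a b, `|calg_mul a b| <= `|a| * `|b|;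
  calg_normS : forall a, `|calg_mul (calg_star a) a| = `|a| ^+ 2
}.

Definition carrier {R : realType} (B : cstarAlgType R) : Type := calg_sort B.
Coercion carrier : cstarAlgType >-> Sortclass.

HB.instance Definition _ (R : realType) (B : cstarAlgType R) :=
  CompleteNormedModule.on (carrier B).
HB.instance Definition _ (R : realType) (B : cstarAlgType R) :=
  GRing.Zmodule_isPzRing.Build (carrier B) (@calg_mulA R B)
    (@calg_mul1l R B) (@calg_mul1r R B) (@calg_mulDl R B) (@calg_mulDr R B).

Section CStarTheory.
Context {R : realType} {B : cstarAlgType R}.
Implicit Types (a b : B) (z : R[i]).

Definition star : B -> B := @calg_star R B.

Lemma scaleAl z a b : z *: (a * b) = (z *: a) * b.
Proof. exact: calg_scaleAl. Qed.
Lemma scaleAr z a b : z *: (a * b) = a * (z *: b).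
Proof. exact: calg_scaleAr. Qed.
Lemma starK : involutive star.
Proof. exact: calg_starK. Qed.
Lemma starM a b : star (a * b) = star b * star a.
Proof. exact: calg_starM. Qed.
Lemma starP z a b : star (z *: a + b) = z^* *: star a + star b.
Proof. exact: calg_starP. Qed.
Lemma cstar_normM a b : `|a * b| <= `|a| * `|b|.
Proof. exact: calg_normM. Qed.
Lemma cstar_norm a : `|star a * a| = `|a| ^+ 2.
Proof. exact: calg_normS. Qed.

Lemma norm_star a : `|star a| = `|a|.
Proof.
have le b : `|b| <= `|star b|.
  have [->|b0] := eqVneq b 0; first by rewrite normr0.
  have nb : 0 < `|b| by rewrite normr_gt0.
  by rewrite -(ler_pM2r nb) -expr2 -cstar_norm cstar_normM.
by apply/eqP; rewrite eq_le le andbT -{2}(starK a) le.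
Qed.

End CStarTheory.

Section Arens.
Context {R : realType} {B : cstarAlgType R}.
Implicit Types (f g : dual B) (F G : bidual B) (a b : B).

Let act_linear f a : linear (fun b => f (a * b)).
Proof. by move=> z x y; rewrite mulrDr -scaleAr linearP. Qed.

Let act_bound f a b : `|f (a * b) : R[i]^o| <= `|f| * `|a| * `|b|.
Proof.
apply: le_trans (le_onorm f _) _.
by rewrite -mulrA ler_wpM2l ?onorm_ge0// cstar_normM.
Qed.

(* (f . a)(b) = f (a b) *)
Definition dual_act f a : dual B := mkblin (act_linear f a) (act_bound f a).

Let norm_act f a : `|dual_act f a| <= `|f| * `|a|.
Proof. by apply: onorm_le => [|?]; [rewrite ?mulr_ge0|exact: act_bound]. Qed.

Let left_linear G f : linear (fun a => G (dual_act f a)).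
Proof.
move=> z x y; rewrite -linearP; congr (G _); apply: blinP => b /=.
by rewrite mulrDl -scaleAl linearP.
Qed.

Let left_bound G f a : `|G (dual_act f a) : R[i]^o| <= `|G| * `|f| * `|a|.
Proof.
apply: le_trans (le_onorm G _) _.
by rewrite -mulrA ler_wpM2l ?onorm_ge0// norm_act.
Qed.

(* (G . f)(a) = G (f . a) *)
Definition arens_act G f : dual B := mkblin (left_linear G f) (left_bound G f).

Let mul_linear F G : linear (fun f => F (arens_act G f)).
Proof.
move=> z f g; rewrite -[RHS](blin_linear F); congr (F _); apply: blinP => a.
by rewrite -[RHS](blin_linear G); congr (G _); apply: blinP.
Qed.

Let mul_bound F G f : `|F (arens_act G f) : R[i]^o| <= `|F| * `|G| * `|f|.
Proof.
apply: le_trans (le_onorm F _) _; rewrite -mulrA ler_wpM2l ?onorm_ge0//.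
by apply: onorm_le => [|?]; [rewrite ?mulr_ge0|exact: left_bound].
Qed.

(* The (first) Arens product, the product of the von Neumann algebra B**: it
   extends the product of B, it is weak-* continuous in its left argument, and
   in its right argument when the left one lies in B. *)
Definition bidual_mul F G : bidual B := mkblin (mul_linear F G) (mul_bound F G).

Let dstar_linear f : linear (fun a => (f (star a))^* : R[i]^o).
Proof. by move=> z x y; rewrite starP linearP/= rmorphD rmorphM/= conjCK. Qed.

Let dstar_bound f a : `|(f (star a))^* : R[i]^o| <= `|f| * `|a|.
Proof. by rewrite norm_conjC -(norm_star a); exact: le_onorm. Qed.

(* f^*(a) = conj (f (a^* )) *)
Definition dual_star f : dual B := mkblin (dstar_linear f) (dstar_bound f).

Let bstar_linear F : linear (fun f => (F (dual_star f))^* : R[i]^o).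
Proof.
move=> z f g; rewrite -[RHS]/(z * _ + _) -[in RHS](conjCK z) -rmorphM -rmorphD.
congr (_^*); rewrite -[RHS]/(_ *: F _ + F _) -linearP; congr (F _).
by apply: blinP => a /=; rewrite rmorphD rmorphM.
Qed.

Let bstar_bound F f : `|(F (dual_star f))^* : R[i]^o| <= `|F| * `|f|.
Proof.
rewrite norm_conjC; apply: le_trans (le_onorm F _) _.
by rewrite ler_wpM2l ?onorm_ge0//; apply: onorm_le => [|?];
  [rewrite ?mulr_ge0|exact: dstar_bound].
Qed.

(* F^*(f) = conj (F (f^* )), the weak-* continuous extension of star. *)
Definition bidual_star F : bidual B := mkblin (bstar_linear F) (bstar_bound F).

Lemma bidual_mul_canon a b :
  bidual_mul (canon a) (canon b) = canon (a * b : B).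
Proof. by apply: blinP. Qed.

Lemma bidual_star_canon a : bidual_star (canon a) = canon (star a : B).
Proof. by apply: blinP => f /=; rewrite conjCK. Qed.

Let cont_wstar (h : bidual B -> bidual B) :
  (forall f, exists g, forall F, h F f = F g) ->
  continuous (h : wstar B -> wstar B).
Proof.
move=> hg F; apply: (cvg_wstar (nbhs_filter (F : wstar B))) => f.
have [g hfg] := hg f.
rewrite /normal_ext hfg (_ : (fun F => h F f) = normal_ext g).
  exact: normal_ext_continuous.
exact/funext.
Qed.

Lemma bidual_mul_continuousl G :
  continuous ((fun F => bidual_mul F G) : wstar B -> wstar B).
Proof. by apply: cont_wstar => f; exists (arens_act G f). Qed.

Lemma bidual_mul_continuousr a :
  continuous (bidual_mul (canon a) : wstar B -> wstar B).
Proof. by apply: cont_wstar => f; exists (dual_act f a). Qed.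

Definition bidual_projection F := bidual_mul F F = F /\ bidual_star F = F.

End Arens.

(* The inner product is linear in its first argument. *)
HB.mixin Record NormedModule_isHilbert (R : realType) H
    of NormedModule R[i] H := {
  inner : {dot H for Num.conj};
  inner_norm : forall x : H, inner x x = `|x| ^+ 2
}.

#[short(type="hilbertType")]
HB.structure Definition Hilbert (R : realType) :=
  {H of NormedModule_isHilbert R H & CompleteNormedModule R[i] H}.

Section Dilation.
Context {R : realType} {B : cstarAlgType R}.

Definition operator_system (S : set B) : Prop :=
  [/\ S 1, forall (z : R[i]) a b, S a -> S b -> S (z *: a + b)
    & forall a, S a -> S (star a)].

Definition cstar_subalgebra (A : set B) : Prop :=
  [/\ operator_system A, forall a b, A a -> A b -> A (a * b) & closed A].

Definition cstar_generated (S : set B) : set B := smallest cstar_subalgebra S.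

(* In R[i], 0 <= z says that z is a nonnegative real. *)
Definition state (phi : dual B) : Prop :=
  phi 1 = 1 :> R[i] /\ forall a : B, 0 <= phi (star a * a) :> R[i].

Definition adjoint {H K : hilbertType R} (T : blin H K) (T' : blin K H) :=
  forall x y, inner (T x) y = inner x (T' y).

Record star_representation (H : hilbertType R) := StarRepresentation {
  rep :> {linear B -> blin H H};
  rep1 : forall x, rep 1 x = x;
  repM : forall a b x, rep (a * b) x = rep a (rep b x);
  rep_star : forall a, adjoint (rep a) (rep (star a))
}.

Definition represents {H : hilbertType R} (phi : dual B)
    (pi : star_representation H) (xi : H) : Prop :=
  `|xi| = 1 /\ forall b, phi b = inner (pi b xi) xi.

Definition isometry {H K : hilbertType R} (V : blin H K) : Prop :=
  forall x, `|V x| = `|x|.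

(* Vs is the adjoint V^* of V. *)
Definition dilation_order (S : set B) (phi psi : dual B) : Prop :=
  [/\ state phi, state psi &
    exists (H K : hilbertType R)
      (pi : star_representation H) (xi : H)
      (sigma : star_representation K) (eta : K)
      (V : blin H K) (Vs : blin K H),
      [/\ represents phi pi xi, represents psi sigma eta,
        isometry V /\ V xi = eta, adjoint V Vs
      & forall a, S a -> forall x, pi a x = Vs (sigma a (V x))]].

Definition dilation_maximal (S : set B) (phi : dual B) : Prop :=
  forall psi, dilation_order S phi psi -> psi = phi.

End Dilation.

(* Main.v *)
(* A vector [xi] of a representation [pi] is called maximal if [sigma b (V xi) = V (pi b xi)]
   for every [b] and every dilation [(sigma, V)] of the restriction of [pi] to [S].
   If a state is maximal then so is its GNS vector: [V^*] preserves the norm of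
   [sigma b (V xi)], first for [b] in [S], then for products.  The maximal vectors form a
   closed subspace [M(pi)], invariant under the unitaries commuting with [pi] and
   additive under direct sums.  Therefore [<P xi, eta>], with [P] the projection onto
   [M(pi)], depends only on the functional [<pi(.) xi, eta>]; its value at that
   functional defines [d].

   That every bounded functional [f] is a vector functional follows from the
   Mazur-Orlicz form of the Hahn-Banach theorem, which yields a state [phi] with
   [|f b|^2 <= |f|^2 phi (b^* b)], the GNS construction and Riesz' theorem.
   Positivity of [b^* b] is obtained from the function
   [numsup x = inf_t (|t + x| - t)] and square roots, without spectral theory. *)

Require Import Defs.
From HB Require Import structures.
From mathcomp Require Import all_boot all_order all_algebra.
From mathcomp Require Import sesquilinear complex ring lra.
From mathcomp Require Import boolp classical_sets functions reals.
From mathcomp Require Import topology normedtype sequences.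
Set Implicit Arguments.
Unset Strict Implicit.
Unset Printing Implicit Defensive.
Import Order.TTheory GRing.Theory Num.Theory.
Import numFieldNormedType.Exports.
Local Open Scope classical_set_scope.
Local Open Scope ring_scope.

Local Notation "x %:C" := (real_complex _ x) (at level 1, format "x %:C") : ring_scope.
Local Notation Re := complex.Re.
Local Notation Im := complex.Im.

(** * Real scaling, norms and limits *)

(** An element of B** is a functional on the dual, so [d] is built value by value, without a
    universal representation; the price is to show that the value does not depend on the
    representation chosen for [f]. Two choices for the same [f] are compared in their direct sum,
    where their difference represents [0], so everything reduces to [maximal_value0]; the same
    direct sum makes [d] linear. The obstacle there is that [P xi] might leave the closed cyclic
    subspace of [xi]. The reflection that fixes this subspace and negates its complement commutes
    with [pi], hence preserves M(pi), which excludes this. [d] is idempotent because [P xi] is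
    already maximal, and self-adjoint because [P] is. For the converse half of the equivalence,
    [d phi = 1] makes |P xi| = |xi| in every representation of [phi], so that [xi] is maximal there
    and every dilation has the same vector state. *)

Definition rscale {R : realType} {V : lmodType R[i]} (r : R) (x : V) : V :=
  real_complex R r *: x.

Local Notation "r *:: x" := (rscale r x) (at level 40).

Section RealScale.
Context {R : realType} {V : lmodType R[i]}.
Implicit Types (x y : V) (r s : R).

Lemma rscaleE r x : r *:: x = r%:C *: x. Proof. by []. Qed.

Lemma rscaleA r s x : r *:: (s *:: x) = (r * s) *:: x.
Proof. by rewrite /rscale scalerA -rmorphM. Qed.

Lemma rscaleDl r s x : (r + s) *:: x = r *:: x + s *:: x.
Proof. by rewrite /rscale rmorphD scalerDl. Qed.

Lemma rscaleDr r x y : r *:: (x + y) = r *:: x + r *:: y.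
Proof. exact: scalerDr. Qed.

Lemma rscaleBr r x y : r *:: (x - y) = r *:: x - r *:: y.
Proof. exact: scalerBr. Qed.

Lemma rscaleNl r x : (- r) *:: x = - (r *:: x).
Proof. by rewrite /rscale rmorphN scaleNr. Qed.

Lemma rscaleNr r x : r *:: (- x) = - (r *:: x).
Proof. exact: scalerN. Qed.

Lemma rscale1 x : 1 *:: x = x.
Proof. exact: scale1r. Qed.

Lemma rscale0 x : 0 *:: x = 0.
Proof. exact: scale0r. Qed.

Lemma rscaler0 r : r *:: (0 : V) = 0.
Proof. exact: scaler0. Qed.

Lemma rscaleVK r x : r != 0 -> r^-1 *:: (r *:: x) = x.
Proof. by move=> r0; rewrite rscaleA mulVf// rscale1. Qed.

Lemma rscaleKV r x : r != 0 -> r *:: (r^-1 *:: x) = x.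
Proof. by move=> r0; rewrite rscaleA mulfV// rscale1. Qed.

Lemma rscaleC (z : R[i]) r x : z *: (r *:: x) = r *:: (z *: x).
Proof. by rewrite /rscale !scalerA mulrC. Qed.

Lemma rscale_half x : 2^-1 *:: (x + x) = x.
Proof.
by rewrite rscaleDr -rscaleDl (_ : 2^-1 + 2^-1 = 1 :> R) ?rscale1//; field.
Qed.

End RealScale.

Section RealNorm.
Context {R : realType}.
Implicit Types (z : R[i]) (r : R).

Lemma le_Re z z' : z <= z' -> Re z <= Re z'.
Proof. by rewrite lecE => /andP[]. Qed.

Lemma Re_normE z : `|z| = (Re `|z|)%:C.
Proof. by rewrite RRe_real// normr_real. Qed.

Lemma Re_le_norm z : Re z <= Re `|z|.
Proof.
have := normc_ge_Re z; rewrite (Re_normE z) lecR; apply: le_trans.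
exact: ler_norm.
Qed.

Lemma normr_real_complex r : `|r%:C| = `|r|%:C.
Proof. by rewrite normc_def/= expr0n addr0 sqrtr_sqr. Qed.

Lemma ReD z z' : Re (z + z') = Re z + Re z'.
Proof. exact: raddfD. Qed.

Lemma ReN z : Re (- z) = - Re z.
Proof. exact: raddfN. Qed.

Lemma ReB z z' : Re (z - z') = Re z - Re z'.
Proof. by rewrite ReD ReN. Qed.

Lemma ReZ r z : Re (r%:C * z) = r * Re z.
Proof. by case: z => a b; rewrite /= mul0r subr0. Qed.

Lemma Re_conjc z : Re z^* = Re z.
Proof. by case: z. Qed.

Lemma ger0_Re z : 0 <= z -> z = (Re z)%:C.
Proof. by move=> z0; rewrite RRe_real// ger0_real. Qed.

Lemma conj_realc r : (r%:C)^* = r%:C :> R[i].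
Proof. exact: conjc_real. Qed.

Lemma conj_eq_Re z : z^* = z -> z = (Re z)%:C.
Proof. by move=> h; apply/esym/RRe_real/CrealP. Qed.

Lemma ltr0c r : (0 < r%:C) = (0 < r).
Proof. by rewrite -ltcR. Qed.

Lemma invS_small r : 0 < r -> exists N, forall n, (N <= n)%N -> n.+1%:R^-1 < r.
Proof.
move=> r0; exists (Num.truncn r^-1) => n hn.
rewrite invf_plt ?posrE//; apply: lt_le_trans (truncnS_gt _) _.
by rewrite ler_nat.
Qed.

Context {V : normedModType R[i]}.
Implicit Types (x y : V).

Definition rnorm x : R := Re `|x|.

Lemma rnormE x : `|x| = (rnorm x)%:C.
Proof. by rewrite RRe_real// normr_real. Qed.

Lemma rnorm_ge0 x : 0 <= rnorm x.
Proof. by rewrite -ler0c -rnormE. Qed.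

Lemma rnorm0 : rnorm 0 = 0.
Proof. by rewrite /rnorm normr0. Qed.

Lemma rnorm_eq0 x : rnorm x = 0 -> x = 0.
Proof. by move=> h; apply/eqP; rewrite -normr_eq0 rnormE h. Qed.

Lemma rnormN x : rnorm (- x) = rnorm x.
Proof. by rewrite /rnorm normrN. Qed.

Lemma rnorm_distC x y : rnorm (x - y) = rnorm (y - x).
Proof. by rewrite -rnormN opprB. Qed.

Lemma rnormD x y : rnorm (x + y) <= rnorm x + rnorm y.
Proof. by rewrite -lecR -rnormE rmorphD/= -!rnormE ler_normD. Qed.

Lemma rnormB x y : rnorm (x - y) <= rnorm x + rnorm y.
Proof. by rewrite -(rnormN y) rnormD. Qed.

Lemma rnorm_dist y x (z : V) : rnorm (x - z) <= rnorm (x - y) + rnorm (y - z).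
Proof. by rewrite -[x - z](subrKA y) rnormD. Qed.

Lemma rnormZc z x : rnorm (z *: x) = Re `|z| * rnorm x.
Proof. by apply: complexI; rewrite -rnormE normrZ rmorphM/= -rnormE -Re_normE. Qed.

Lemma rnormZ r x : rnorm (r *:: x) = `|r| * rnorm x.
Proof. by rewrite rnormZc normr_real_complex. Qed.

Lemma rnorm_lt r x : (`|x| < r%:C) = (rnorm x < r).
Proof. by rewrite rnormE ltcR. Qed.

(** Stated with real [e], since the norm of [V] takes values in [R[i]]; [rcvgP] ties it to filter
    convergence, and [closed_rcvg] and [rcvg_closed] make closedness sequential. *)
Definition rcvg (u : nat -> V) (l : V) : Prop :=
  forall e : R, 0 < e -> exists N, forall n, (N <= n)%N -> rnorm (u n - l) < e.

Definition rcauchy (u : nat -> V) : Prop :=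
  forall e : R, 0 < e -> exists N, forall n m, (N <= n)%N -> (N <= m)%N ->
    rnorm (u n - u m) < e.

Lemma eq_rcvg u v l : u =1 v -> rcvg u l -> rcvg v l.
Proof. by move=> /funext ->. Qed.

Lemma rcvgP u l : rcvg u l <-> u @ \oo --> l.
Proof.
split=> [h|/cvgrPdist_lt h e e0].
  apply/cvgrPdist_lt => e e0.
  have [N hN] : exists N, forall n, (N <= n)%N -> rnorm (u n - l) < Re e.
    by apply: h; rewrite -ltr0c -(ger0_Re (ltW e0)).
  exists N => // n /= /hN; rewrite distrC (ger0_Re (ltW e0)).
  by rewrite rnorm_lt.
have [|N _ hN] := h e%:C; first by rewrite ltr0c.
by exists N => n /hN /=; rewrite distrC rnorm_lt.
Qed.

Lemma closed_rcvg (A : set V) u l : closed A ->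
  (forall n, A (u n)) -> rcvg u l -> A l.
Proof.
move=> cA uA /rcvgP ul; apply: (@closed_cvg _ _ \oo _ u A cA _ l ul).
exact: nearW.
Qed.

Lemma rcvg_closed (A : set V) :
  (forall u l, (forall n, A (u n)) -> rcvg u l -> A l) -> closed A.
Proof.
move=> h x /= cx.
have /choice[u hu] n : exists y, A y /\ rnorm (y - x) < n.+1%:R^-1.
  have /cx[y [Ay]] : nbhs x (ball x (n.+1%:R^-1)%:C).
    by apply: nbhsx_ballx; rewrite ltr0c invr_gt0.
  by rewrite -ball_normE /= distrC rnorm_lt => xy; exists y.
apply: (h u) => [n|e e0]; first by case: (hu n).
have [N hN] := invS_small e0; exists N => n /hN; apply: lt_trans.
by case: (hu n).
Qed.

Lemma rcvg_unique u l l' : rcvg u l -> rcvg u l' -> l = l'.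
Proof.
move=> h h'; apply/eqP; rewrite -subr_eq0; apply/eqP/rnorm_eq0/eqP.
rewrite eq_le rnorm_ge0 andbT; apply/ler_addgt0Pr => e e0; rewrite add0r.
have e2 : 0 < e / 2 by rewrite divr_gt0.
have [N hN] := h _ e2; have [M hM] := h' _ e2.
have := hN _ (leq_maxl N M); have := hM _ (leq_maxr N M).
move=> p q; apply: (le_trans (rnorm_dist (u (maxn N M)) _ _)).
by rewrite [leRHS]splitr lerD// ltW// rnorm_distC.
Qed.

End RealNorm.

Section Complete.
Context {R : realType} {V : completeNormedModType R[i]}.

Lemma rcauchy_cvg (u : nat -> V) : rcauchy u -> exists l, rcvg u l.
Proof.
move=> cu; have /cauchy_cvgP/cvg_ex[l ul] : cauchy (u @ \oo).
  apply: cauchy_exP => e e0.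
  have [|N hN] := cu (Re e); first by rewrite -ltr0c -(ger0_Re (ltW e0)).
  exists (u N), N => // n /= Nn.
  by rewrite -ball_normE /= (ger0_Re (ltW e0)) rnorm_lt; apply: hN.
by exists l; apply/rcvgP.
Qed.

End Complete.

(** * Banach's fixed point theorem *)

Section FixedPoint.
Context {R : realType}.

Lemma expr_small (q D e : R) : 0 <= q < 1 -> 0 < e ->
  exists N, forall n, (N <= n)%N -> q ^+ n * D < e.
Proof.
move=> /andP[q0 q1] e0; pose D' := `|D| + 1.
have D0 : 0 < D' by rewrite ltr_wpDl.
have /cvgrPdist_lt/(_ (e / D') (divr_gt0 e0 D0))[N _ hN] :
  (fun n => q ^+ n) @ \oo --> (0 : R^o) by apply: cvg_expr; rewrite ger0_norm.
exists N => n /hN /=; rewrite sub0r normrN ger0_norm ?exprn_ge0// ltr_pdivlMr//.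
apply: le_lt_trans; rewrite ler_wpM2l ?exprn_ge0// ltW// ltr_pwDr//.
exact: ler_norm.
Qed.

(** The invariant closed set [U] carries side conditions to the fixed point, such as
    self-adjointness in [sqrt_one_sub]. *)
Lemma contraction_fixed_point (V : completeNormedModType R[i]) (U : set V)
    (T : V -> V) (q : R) : 0 <= q < 1 -> closed U -> U !=set0 ->
  (forall x, U x -> U (T x)) ->
  (forall x y, U x -> U y -> rnorm (T x - T y) <= q * rnorm (x - y)) ->
  exists2 p, U p & T p = p.
Proof.
move=> q01 cU [x0 Ux0] UT cT; have /andP[q0 q1] := q01.
pose u n := iter n T x0.
have Uu n : U (u n) by elim: n => //= n; apply: UT.
(* [c] solves c = q c + |u 1 - u 0|, so it bounds the distance of every iterate from [u 0]. *)
pose c := rnorm (u 1%N - u 0%N) / (1 - q).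
have q1' : 0 < 1 - q by rewrite subr_gt0.
have bnd k : rnorm (u k - u 0%N) <= c.
  elim: k => [|k ih]; first by rewrite subrr rnorm0 divr_ge0 ?rnorm_ge0// ltW.
  apply: le_trans (rnorm_dist (u 1%N) _ _) _.
  apply: (@le_trans _ _ (q * c + (1 - q) * c)); last by rewrite -mulrDl addrC subrK mul1r.
  rewrite lerD//; last by rewrite /c mulrCA mulfV ?mulr1// gt_eqF.
  by apply: le_trans (cT _ _ (Uu k) (Uu 0%N)) _; rewrite ler_wpM2l.
have dist n k : rnorm (u (n + k)%N - u n) <= q ^+ n * c.
  elim: n => [|n ih]; first by rewrite expr0 mul1r; apply: bnd.
  rewrite addSn exprS -mulrA; apply: le_trans (cT _ _ (Uu _) (Uu _)) _.
  by rewrite ler_wpM2l.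
have [l ul] : exists l, rcvg u l.
  apply: rcauchy_cvg => e e0; have [N hN] := expr_small c q01 (divr_gt0 e0 (ltr0n _ 2)).
  exists N => n m Nn Nm; rewrite (splitr e).
  apply: le_lt_trans (rnorm_dist (u N) _ _) _.
  rewrite ltrD//; last rewrite rnorm_distC.
    by rewrite -(subnKC Nn); apply: le_lt_trans (dist _ _) _; apply: hN.
  by rewrite -(subnKC Nm); apply: le_lt_trans (dist _ _) _; apply: hN.
have Ul : U l by apply: closed_rcvg ul.
exists l => //; apply: (@rcvg_unique _ _ (fun n => u n.+1)) => e e0.
  have [N hN] := ul _ e0; exists N => n /hN; apply: le_lt_trans.
  by apply: le_trans (cT _ _ (Uu _) Ul) _; rewrite ler_piMl ?rnorm_ge0// ltW.
by have [N hN] := ul _ e0; exists N => n Nn; apply: hN; apply: leqW.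
Qed.

End FixedPoint.

(** * Positivity in C*-algebras *)

Section CStarElementary.
Context {R : realType} {B : cstarAlgType R}.
Implicit Types (a b c d x y z : B) (r s t : R).

Lemma starD a b : star (a + b) = star a + star b.
Proof. by have := starP 1 a b; rewrite !scale1r rmorph1 scale1r. Qed.

Lemma star0 : star (0 : B) = 0.
Proof. by apply: (@addIr _ (star 0)); rewrite add0r -starD addr0. Qed.

Lemma starZ (l : R[i]) a : star (l *: a) = l^* *: star a.
Proof. by have := starP l a 0; rewrite !addr0 star0 addr0. Qed.

Lemma starZr r a : star (r *:: a) = r *:: star a.
Proof. by rewrite /rscale starZ; congr (_ *: _); rewrite conj_realc. Qed.

Lemma starN a : star (- a) = - star a.
Proof. by rewrite -scaleN1r starZ rmorphN1 scaleN1r. Qed.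

Lemma starB a b : star (a - b) = star a - star b.
Proof. by rewrite starD starN. Qed.

Lemma star1 : star (1 : B) = 1.
Proof. by rewrite -[LHS]mulr1 -{2}(starK 1) -starM mulr1 starK. Qed.

Lemma rnormM a b : rnorm (a * b) <= rnorm a * rnorm b.
Proof. by rewrite -lecR -rnormE rmorphM/= -!rnormE cstar_normM. Qed.

Lemma rnorm_star a : rnorm (star a) = rnorm a.
Proof. by rewrite /rnorm norm_star. Qed.

Lemma rnorm_sq a : rnorm (star a * a) = rnorm a ^+ 2.
Proof. by apply: complexI; rewrite -rnormE cstar_norm rnormE -rmorphXn. Qed.

Definition selfadj a := star a = a.

Lemma selfadj1 : selfadj 1. Proof. exact: star1. Qed.

Lemma selfadjD a b : selfadj a -> selfadj b -> selfadj (a + b).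
Proof. by rewrite /selfadj starD => -> ->. Qed.

Lemma selfadjN a : selfadj a -> selfadj (- a).
Proof. by rewrite /selfadj starN => ->. Qed.

Lemma selfadjZ r a : selfadj a -> selfadj (r *:: a).
Proof. by rewrite /selfadj starZr => ->. Qed.

Lemma selfadjM a b : selfadj a -> selfadj b -> GRing.comm a b -> selfadj (a * b).
Proof. by rewrite /selfadj starM => -> ->. Qed.

Lemma selfadj_sqr a : selfadj a -> selfadj (a * a).
Proof. by move=> sa; apply: selfadjM. Qed.

Lemma selfadj_starM a : selfadj (star a * a).
Proof. by rewrite /selfadj starM starK. Qed.

Lemma selfadjX a n : selfadj a -> selfadj (a ^+ n).
Proof.
move=> sa; elim: n => [|n ih]; first exact: selfadj1.
by rewrite exprS; apply: selfadjM => //; apply: commrX.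
Qed.

Lemma commrZ (l : R[i]) a b : GRing.comm a b -> GRing.comm a (l *: b).
Proof. by rewrite /GRing.comm -scaleAr -scaleAl => ->. Qed.

Lemma commr_rscale r a b : GRing.comm a b -> GRing.comm a (r *:: b).
Proof. exact: commrZ. Qed.

Lemma rscaleAl r a b : r *:: (a * b) = (r *:: a) * b.
Proof. exact: scaleAl. Qed.

Lemma rscaleAr r a b : r *:: (a * b) = a * (r *:: b).
Proof. exact: scaleAr. Qed.

Lemma rnorm_selfadj_sqr a : selfadj a -> rnorm (a * a) = rnorm a ^+ 2.
Proof. by move=> sa; rewrite -rnorm_sq sa. Qed.

Lemma rnorm_selfadjX a k : selfadj a -> rnorm (a ^+ (2 ^ k)) = rnorm a ^+ (2 ^ k).
Proof.
move=> sa; elim: k => [|k ih]; first by rewrite !expr1.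
rewrite expnS mul2n -addnn !exprD -ih -expr2.
by rewrite rnorm_selfadj_sqr//; apply: selfadjX.
Qed.

Lemma rnormX_le a n : rnorm (a ^+ n.+1) <= rnorm a ^+ n.+1.
Proof.
elim: n => [|n ih]; first by rewrite !expr1.
rewrite exprS [leRHS]exprS; apply: le_trans (rnormM _ _) _.
by rewrite ler_wpM2l ?rnorm_ge0.
Qed.

Lemma rcvg_mull c (u : nat -> B) l : rcvg u l -> rcvg (fun n => c * u n) (c * l).
Proof.
move=> ul e e0; have c1 : 0 < rnorm c + 1 by rewrite ltr_wpDl ?rnorm_ge0.
have [N hN] := ul _ (divr_gt0 e0 c1); exists N => n /hN.
rewrite -mulrBr ltr_pdivlMr// => /(le_lt_trans _); apply.
by apply: le_trans (rnormM _ _) _; rewrite mulrC ler_wpM2l ?rnorm_ge0// lerDl.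
Qed.

Lemma rcvg_star (u : nat -> B) l : rcvg u l -> rcvg (fun n => star (u n)) (star l).
Proof.
move=> ul e e0; have [N hN] := ul _ e0; exists N => n /hN.
by rewrite -starB rnorm_star.
Qed.

Lemma rcvg_mulr c (u : nat -> B) l : rcvg u l -> rcvg (fun n => u n * c) (l * c).
Proof.
move=> ul; have := rcvg_star (rcvg_mull (star c) (rcvg_star ul)).
by rewrite starM !starK; apply: eq_rcvg => n; rewrite starM !starK.
Qed.

Lemma rnorm_rcvg_le (u : nat -> B) l r :
  (forall n, rnorm (u n) <= r) -> rcvg u l -> rnorm l <= r.
Proof.
move=> ur ul; apply/ler_addgt0Pr => e e0; have [N hN] := ul _ e0.
rewrite -[l](subrK (u N)) addrC; apply: le_trans (rnormD _ _) _.
by rewrite lerD// ltW// rnorm_distC; apply: hN.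
Qed.

(* [v = 1 - y], where [y] is a fixed point of the contraction [y |-> (z + y^2) / 2]. *)
Lemma sqrt_one_sub z : selfadj z -> rnorm z < 1 -> exists v,
  [/\ selfadj v, v * v = 1 - z & forall x, GRing.comm x z -> GRing.comm x v].
Proof.
move=> sz z1; pose q := rnorm z.
have q0 : 0 <= q by apply: rnorm_ge0.
(* These conditions are closed, so the fixed point inherits them; the radius [q] gives [T] the
   Lipschitz constant (q + q) / 2 = q. *)
pose U : set B := [set y | [/\ selfadj y, rnorm y <= q
  & forall x, GRing.comm x z -> GRing.comm x y]].
pose T y := 2^-1 *:: (z + y * y).
have h2 : `|2^-1 : R| = 2^-1 by rewrite ger0_norm// invr_ge0.
have [||||y y0|y [sy yq cy] Ty] := @contraction_fixed_point R _ U T q.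
- by rewrite q0.
- apply: rcvg_closed => u l Uu ul; split.
  + apply: (@rcvg_unique _ _ u) => //.
    by apply: eq_rcvg (rcvg_star ul) => n; case: (Uu n).
  + by apply: (@rnorm_rcvg_le u) => // n; case: (Uu n).
  + move=> x xz; apply: (@rcvg_unique _ _ (fun n => x * u n)).
      exact: rcvg_mull.
    by apply: eq_rcvg (rcvg_mulr x ul) => n; case: (Uu n) => _ _ /(_ x xz).
- exists 0; split; [exact: star0|by rewrite rnorm0|by move=> x _; apply: commr0].
- move=> y [sy yq cy]; split.
  + by apply/selfadjZ/selfadjD => //; apply: selfadj_sqr.
  + rewrite rnormZ h2 ler_pdivrMl//.
    apply: le_trans (rnormD _ _) _; rewrite mulr2n [leRHS]mulrDl mul1r lerD//.
    apply: le_trans (rnormM _ _) _; apply: le_trans (ler_pM _ _ yq yq) _;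
      rewrite ?rnorm_ge0//.
    by rewrite ler_piMl// ltW.
  + move=> x xz; apply/commr_rscale/commrD => //.
    by apply: commrM; apply: cy.
- move=> [sx xq _] [sy yq _]; rewrite -rscaleBr rnormZ h2 ler_pdivrMl//.
  have -> : z + y * y - (z + y0 * y0) = y * (y - y0) + (y - y0) * y0.
    by rewrite mulrBr mulrBl addrA subrK opprD addrACA subrr add0r.
  apply: le_trans (rnormD _ _) _; rewrite mulr2n [leRHS]mulrDl mul1r lerD//.
    by apply: le_trans (rnormM _ _) _; rewrite ler_wpM2r ?rnorm_ge0.
  by apply: le_trans (rnormM _ _) _; rewrite mulrC ler_wpM2r ?rnorm_ge0.
have yy : y + y = z + y * y.
  by rewrite -{1 2}Ty /T -rscaleDr rscale_half.
exists (1 - y); split.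
- by apply/selfadjD/selfadjN => //; apply: selfadj1.
- have -> : z = y + y - y * y by rewrite yy addrK.
  by rewrite mulrBl mul1r mulrBr mulr1 !opprB addrACA [RHS]addrA opprD.
- by move=> x /cy xy; apply/commrD/commrN => //; apply: commr1.
Qed.

(** The Neumann series in fixed-point form: [w = 1 + z * w] gives a right inverse, [w' = 1 + w' * z]
    a left one, and the two agree. *)
Lemma inv_one_sub z : rnorm z < 1 -> exists w, w * (1 - z) = 1 /\ (1 - z) * w = 1.
Proof.
move=> z1; have q01 : 0 <= rnorm z < 1 by rewrite rnorm_ge0.
have [|||x y _ _|w _ hw] := @contraction_fixed_point R _ (@setT B)
  (fun w : B => 1 + z * w) _ q01 => //.
- by exists 0.
- rewrite opprD addrACA subrr add0r -mulrBr; exact: rnormM.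
have [|||x y _ _|w' _ hw'] := @contraction_fixed_point R _ (@setT B)
  (fun w : B => 1 + w * z) _ q01 => //.
- by exists 0.
- rewrite opprD addrACA subrr add0r -mulrBl mulrC; exact: rnormM.
have h : (1 - z) * w = 1 by rewrite mulrBl mul1r -{1}hw addrK.
have h' : w' * (1 - z) = 1 by rewrite mulrBr mulr1 -{1}hw' addrK.
have ww' : w = w' by rewrite -[LHS]mul1r -[X in X * _]h' -mulrA h mulr1.
by exists w; rewrite {1}ww'.
Qed.

End CStarElementary.

(** * Numerical range and the positive cone *)

Section NumericalRange.
Context {R : realType} {B : cstarAlgType R}.
Hypothesis one_neq0 : (1 : B) != 0.
Implicit Types (a b c d x y z : B) (r s t : R).

Local Notation "r %:B" := (r *:: (1 : B)) (at level 1, format "r %:B").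

Lemma rnorm1 : rnorm (1 : B) = 1.
Proof.
have := rnorm_selfadj_sqr (@selfadj1 R B); rewrite mulr1 => /eqP.
rewrite -subr_eq0 expr2 -{1}[rnorm _]mulr1 -mulrBr mulf_eq0 => /orP[/eqP/rnorm_eq0 h|].
  by move: one_neq0; rewrite h eqxx.
by rewrite subr_eq0 eq_sym => /eqP.
Qed.

Lemma rnorm_cst r : rnorm r%:B = `|r|.
Proof. by rewrite rnormZ rnorm1 mulr1. Qed.

Lemma cstD r s : (r + s)%:B = r%:B + s%:B.
Proof. exact: rscaleDl. Qed.

Lemma cstN r : (- r)%:B = - r%:B.
Proof. exact: rscaleNl. Qed.

Lemma cst_mull r x : r%:B * x = r *:: x.
Proof. by rewrite -rscaleAl mul1r. Qed.

Lemma cst_mulr r x : x * r%:B = r *:: x.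
Proof. by rewrite -rscaleAr mulr1. Qed.

Lemma selfadj_cst r : selfadj r%:B.
Proof. exact/selfadjZ/selfadj1. Qed.

Lemma comm_cst r x : GRing.comm x r%:B.
Proof. exact/commr_rscale/commr1. Qed.

(* The supremum of the real parts of the numerical range of [x]. *)
Definition numsup x : R := inf [set rnorm (t%:B + x) - t | t in [set t | 0 <= t]].

Let numsup_lbound x t : 0 <= t -> - rnorm x <= rnorm (t%:B + x) - t.
Proof.
move=> t0; have := rnormB (t%:B + x) x; rewrite addrK rnorm_cst ger0_norm//; lra.
Qed.

Let numsup_has_inf x : has_inf [set rnorm (t%:B + x) - t | t in [set t | 0 <= t]].
Proof.
split; first by exists (rnorm (0%:B + x) - 0), 0 => //=.
by exists (- rnorm x) => _ [t t0 <-]; apply: numsup_lbound.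
Qed.

Lemma numsup_le t x : 0 <= t -> numsup x <= rnorm (t%:B + x) - t.
Proof.
by move=> t0; apply: ge_inf; [case: (numsup_has_inf x)|exists t].
Qed.

Lemma le_numsup x r : (forall t, 0 <= t -> r <= rnorm (t%:B + x) - t) -> r <= numsup x.
Proof.
move=> h; apply: lb_le_inf; first by case: (numsup_has_inf x).
by move=> _ [t t0 <-]; apply: h.
Qed.

Lemma numsup_lt x r : numsup x < r -> exists2 t, 0 <= t & rnorm (t%:B + x) < t + r.
Proof.
move=> xr; have e0 : 0 < r - numsup x by rewrite subr_gt0.
have [_ [t t0 <-]] := inf_adherent e0 (numsup_has_inf x).
by rewrite -/(numsup x) => h; exists t => //; lra.
Qed.

Lemma numsup_le_norm x : numsup x <= rnorm x.
Proof. by have := numsup_le x (lexx 0); rewrite subr0 rscale0 add0r. Qed.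

Lemma numsup_ge_norm x : - rnorm x <= numsup x.
Proof. exact/le_numsup/numsup_lbound. Qed.

Lemma numsupD x y : numsup (x + y) <= numsup x + numsup y.
Proof.
apply/ler_addgt0Pr => e e0.
have [t t0 ht] : exists2 t, 0 <= t & rnorm (t%:B + x) < t + (numsup x + e / 2).
  by apply: numsup_lt; lra.
have [s s0 hs] : exists2 s, 0 <= s & rnorm (s%:B + y) < s + (numsup y + e / 2).
  by apply: numsup_lt; lra.
have := numsup_le (x + y) (addr_ge0 t0 s0); rewrite cstD addrACA.
have := rnormD (t%:B + x) (s%:B + y); lra.
Qed.

Lemma numsup0 : numsup 0 = 0.
Proof.
apply/eqP; rewrite eq_le; have := numsup_le_norm 0; have := numsup_ge_norm 0.
by rewrite rnorm0 oppr0 => -> ->.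
Qed.

Lemma numsupZ r x : 0 <= r -> numsup (r *:: x) = r * numsup x.
Proof.
have le s y : 0 < s -> numsup (s *:: y) <= s * numsup y.
  move=> s0; rewrite -ler_pdivrMl//; apply: le_numsup => t t0.
  rewrite ler_pdivrMl//; apply: le_trans (numsup_le _ (mulr_ge0 (ltW s0) t0)) _.
  by rewrite -rscaleA -rscaleDr rnormZ gtr0_norm// mulrBr.
rewrite le_eqVlt => /predU1P[<-|r0]; first by rewrite rscale0 mul0r numsup0.
apply/eqP; rewrite eq_le le//=.
have := le r^-1 (r *:: x); rewrite invr_gt0 => /(_ r0).
rewrite rscaleVK ?gt_eqF// => h.
by rewrite -ler_pdivlMl.
Qed.

Lemma numsup_cst r x : numsup (r%:B + x) = r + numsup x.
Proof.
have le s y : numsup (s%:B + y) <= s + numsup y.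
  apply/ler_addgt0Pr => e e0.
  have [t t0 ht] : exists2 t, 0 <= t & rnorm (t%:B + y) < t + (numsup y + e).
    by apply: numsup_lt; lra.
  have := rnormD (`|s|)%:B (t%:B + y); rewrite rnorm_cst normr_id => h.
  have s0 : 0 <= `|s| + t - s by have := ler_norm s; lra.
  have := numsup_le (s%:B + y) s0.
  rewrite addrA -cstD subrK cstD -addrA; lra.
apply/eqP; rewrite eq_le le/=.
have := le (- r) (r%:B + x); rewrite addrA -cstD addNr rscale0 add0r; lra.
Qed.

Lemma numsup_lipschitz x y : numsup x <= numsup y + rnorm (x - y).
Proof.
rewrite -{1}(subrK y x) addrC; apply: le_trans (numsupD _ _) _.
by rewrite lerD2l numsup_le_norm.
Qed.

(** Only the real part of the numerical range is tested, so skew-adjoint elements qualify as well;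
    where self-adjointness matters it is assumed separately. *)
Definition positive x := numsup (- x) <= 0.

Lemma positiveD x y : positive x -> positive y -> positive (x + y).
Proof.
move=> x0 y0; rewrite /positive opprD; apply: le_trans (numsupD _ _) _.
by rewrite -[0]addr0 lerD.
Qed.

Lemma positiveZ r x : 0 <= r -> positive x -> positive (r *:: x).
Proof.
by move=> r0 x0; rewrite /positive -rscaleNr numsupZ// mulr_ge0_le0.
Qed.

Lemma positive_cst r x : positive (r%:B + x) = (numsup (- x) <= r).
Proof. by rewrite /positive opprD -cstN numsup_cst addrC subr_le0. Qed.

(** The bounded perturbation [z] may vary with [e]. This is the form in which a product of square
    roots of shifted elements is passed to the limit in [positiveM]. *)
Lemma positive_closed x K :
  (forall e, 0 < e <= 1 -> exists2 z, rnorm z <= K & positive (x + e *:: z)) ->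
  positive x.
Proof.
move=> h; have K0 : 0 <= K.
  have [|z zK _] := h 1; first by rewrite ltr01 lexx.
  exact: le_trans (rnorm_ge0 _) zK.
have bnd e : 0 < e <= 1 -> numsup (- x) <= e * K.
  move=> e01; have [z zK xz] := h e e01; have /andP[e0 _] := e01.
  apply: le_trans (numsup_lipschitz _ (- (x + e *:: z))) _.
  rewrite opprK addKr rnormZ gtr0_norm//; apply: ler_wnDl => //.
  by rewrite ler_wpM2l// ltW.
rewrite /positive leNgt; apply/negP => n0; set n := numsup _ in bnd n0.
(* For e <= n / (K + 1) with n > 0, the bound n <= e K is impossible. *)
have e01 : 0 < Num.min 1 (n / (K + 1)) <= 1.
  by rewrite ge_min lexx andbT lt_min ltr01 divr_gt0 ?ltr_wpDl.
have := bnd _ e01; have : Num.min 1 (n / (K + 1)) <= n / (K + 1).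
  by rewrite ge_min lexx orbT.
rewrite ler_pdivlMr ?ltr_wpDl//; move: e01 => /andP[]; set m := Num.min _ _.
move=> m0 _ h1 h2; nra.
Qed.

Lemma star_mul_addi a b : selfadj a -> selfadj b -> GRing.comm a b ->
  star (a + 'i *: b) * (a + 'i *: b) = a * a + b * b.
Proof.
move=> sa sb ab; have ii : 'i * 'i = -1 :> R[i] by rewrite -expr2 sqrCi.
rewrite starD starZ sa sb conjCi scaleNr mulrDr !mulrBl -!scaleAl -!scaleAr.
by rewrite scalerA ii scaleN1r opprK ab addrA subrK.
Qed.

(** Stands in for monotonicity of the norm on positive elements: [a] is the real part of
    [u = a + 'i *: b], hence |a| <= |u|, and |u|^2 is the norm of a^2 + b^2. *)
Lemma rnorm_sqr_addl a b : selfadj a -> selfadj b -> GRing.comm a b ->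
  rnorm a ^+ 2 <= rnorm (a * a + b * b).
Proof.
move=> sa sb ab; rewrite -star_mul_addi// rnorm_sq ler_pXn2r ?nnegrE ?rnorm_ge0//.
set u := a + 'i *: b.
have -> : a = 2^-1 *:: (u + star u).
  by rewrite /u starD starZ sa sb conjCi scaleNr addrACA subrr addr0 rscale_half.
rewrite rnormZ ger0_norm ?invr_ge0// ler_pdivrMl//.
by apply: le_trans (rnormD _ _) _; rewrite rnorm_star mulr2n mulrDl mul1r.
Qed.

(* For [h = c^2 / T] and [e^2 = 2 h], [(1 - h)^2 + e^2 = 1 + h^2], which bounds
   the norm of [1 - h] by [1 + O(T^-2)]. *)
Lemma positive_sqr c : selfadj c -> positive (c * c).
Proof.
move=> sc; apply/ler_addgt0Pr => e e0; rewrite add0r.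
pose K := rnorm (c * c) ^+ 2.
have K0 : 0 <= K by rewrite exprn_ge0 ?rnorm_ge0.
have sel := selfadj_sqr sc.
have bnd s : 0 < s -> rnorm (1 - s *:: (c * c)) <= 1 + s ^+ 2 * K.
  move=> s0; pose h := s *:: (c * c); pose e' := (Num.sqrt (s + s)) *:: c.
  have sh : selfadj h by apply: selfadjZ.
  have ee : e' * e' = h + h.
    rewrite -rscaleAl -rscaleAr rscaleA -expr2 sqr_sqrtr ?addr_ge0 ?ltW//.
    by rewrite rscaleDl.
  have cc : GRing.comm c h by apply/commr_rscale/commrM.
  have ch : GRing.comm (1 - h) e'.
    by apply/commr_rscale/commr_sym/commrD; [apply: commr1|apply: commrN].
  have s1 : selfadj (1 - h) by apply/selfadjD/selfadjN => //; apply: selfadj1.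
  have := rnorm_sqr_addl s1 (selfadjZ _ sc) ch; rewrite ee -/h.
  have -> : (1 - h) * (1 - h) + (h + h) = 1 + h * h.
    by rewrite mulrBl mul1r mulrBr mulr1 opprB (addrACA 1 (- h)) -opprD subrK.
  have : rnorm (1 + h * h) <= 1 + s ^+ 2 * K.
    apply: le_trans (rnormD _ _) _; rewrite rnorm1 lerD2l rnorm_selfadj_sqr//.
    by rewrite rnormZ gtr0_norm// exprMn.
  have := rnorm_ge0 (1 - h); have : 0 <= s ^+ 2 * K by rewrite mulr_ge0// sqr_ge0.
  set n := rnorm _; set k := _ * K; nra.
(* With [t = s^-1] in the infimum, the bound becomes [numsup (- (c * c)) <= s * K]; this choice of
   [s] makes it at most [e]. *)
have e1 : 0 < e / (K + 1) by rewrite divr_gt0// ltr_wpDl.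
have := bnd _ e1; set s := e / _ => h.
have ss : s^-1 * s = 1 by rewrite mulVf// gt_eqF.
have si : 0 <= s^-1 by rewrite invr_ge0 ltW.
apply: le_trans (numsup_le _ si) _.
have -> : s^-1%:B - c * c = s^-1 *:: (1 - s *:: (c * c)).
  by rewrite rscaleBr rscaleVK// gt_eqF.
rewrite rnormZ ger0_norm//.
have : s^-1 * rnorm (1 - s *:: (c * c)) <= s^-1 * (1 + s ^+ 2 * K) by rewrite ler_wpM2l.
have -> : s^-1 * (1 + s ^+ 2 * K) = s^-1 + s * K.
  have s0 : s != 0 by rewrite gt_eqF.
  by clear -s0; clearbody s K; field.
suff : s * K <= e by lra.
by rewrite /s mulrAC ler_pdivrMr ?ltr_wpDl//; apply: ler_wpM2l; lra.
Qed.

End NumericalRange.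

(** * Square roots and the positivity of [star c * c] *)

Section Kaplansky.
Context {R : realType} {B : cstarAlgType R}.
Hypothesis one_neq0 : (1 : B) != 0.
Implicit Types (a b c d x y z : B) (r s t : R).

Local Notation "r %:B" := (r *:: (1 : B)) (at level 1, format "r %:B").

(** [positive a] yields [t] with |t - a| < t + e, hence a + e = (t + e)(1 - z) with |z| < 1, and
    [sqrt_one_sub] applies. The shift by [e] makes the norm bound strict. *)
Lemma positive_sqrt a e : selfadj a -> positive a -> 0 < e -> exists v,
  [/\ selfadj v, v * v = a + e%:B & forall x, GRing.comm x a -> GRing.comm x v].
Proof.
move=> sa a0 e0; have [t t0 ht] := numsup_lt one_neq0 (le_lt_trans a0 e0).
have T0 : 0 < t + e by rewrite ltr_wpDl.
have Tn := gt_eqF T0.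
pose z := (t + e)^-1 *:: (t%:B - a).
have sz : selfadj z by apply/selfadjZ/selfadjD/selfadjN => //; apply: selfadj_cst.
have z1 : rnorm z < 1.
  by rewrite rnormZ gtr0_norm ?invr_gt0// ltr_pdivrMl// mulr1.
have [v [sv vv cv]] := sqrt_one_sub sz z1.
exists (Num.sqrt (t + e) *:: v); split.
- exact: selfadjZ.
- rewrite -rscaleAl -rscaleAr rscaleA -expr2 sqr_sqrtr ?ltW// vv rscaleBr.
  by rewrite rscaleKV ?Tn// opprB addrCA rscaleDl addrAC subrr add0r.
- move=> x xa; apply/commr_rscale/cv/commr_rscale/commrD; first exact: comm_cst.
  exact: commrN.
Qed.

(** x y + e (x + y + e) = (x + e)(y + e) = (u v)^2 for commuting roots [u] of x + e and [v] of y +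
    e; then e tends to 0. *)
Lemma positiveM x y : selfadj x -> selfadj y -> GRing.comm x y ->
  positive x -> positive y -> positive (x * y).
Proof.
move=> sx sy xy x0 y0.
apply: (@positive_closed _ _ one_neq0 _ (rnorm (x + y) + 1)) => e /andP[e0 e1].
exists (x + y + e%:B).
  apply: le_trans (rnormD _ _) _.
  by rewrite lerD2l rnorm_cst// gtr0_norm.
have [u [su uu cu]] := positive_sqrt sx x0 e0.
have [v [sv vv cv]] := positive_sqrt sy y0 e0.
have uv : GRing.comm u v by apply/cv/commr_sym/cu/commr_sym.
have -> : x * y + e *:: (x + y + e%:B) = (u * v) * (u * v).
  rewrite mulrA -(mulrA u v u) -uv mulrA uu -mulrA vv mulrDl !mulrDr.
  by rewrite cst_mulr !cst_mull !rscaleDr -!addrA.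
by apply: positive_sqr => //; apply: selfadjM.
Qed.

(** With commuting v^2 = a + e/3 and u^2 = m - a + e/3, [rnorm_sqr_addl] gives |v|^2 <= |v^2 + u^2|
    = m + 2e/3, and |a| exceeds |v^2| by at most e/3. *)
Lemma rnorm_positive a : selfadj a -> positive a -> rnorm a = numsup a.
Proof.
move=> sa a0; apply/eqP; rewrite eq_le numsup_le_norm// andbT.
set m := numsup a.
have m0 : 0 <= m.
  have := numsupD one_neq0 a (- a); rewrite subrr numsup0//.
  by move: a0; rewrite /positive -/m; lra.
have ma : positive (m%:B - a) by rewrite positive_cst// opprK.
have sma : selfadj (m%:B - a).
  by apply/selfadjD/selfadjN => //; apply: selfadj_cst.
apply/ler_addgt0Pr => e e0; have e3 : 0 < e / 3 by rewrite divr_gt0.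
have [u [su uu cu]] := positive_sqrt sma ma e3.
have [v [sv vv cv]] := positive_sqrt sa a0 e3.
have uv : GRing.comm v u.
  apply/cu/commrD; first exact/comm_cst.
  by apply/commrN/commr_sym/cv.
have := rnorm_sqr_addl sv su uv.
rewrite -rnorm_selfadj_sqr// uu vv addrACA [_ + (m%:B - a)]addrC subrK.
rewrite -!cstD rnorm_cst// ger0_norm; last by lra.
have := rnormB (a + (e / 3)%:B) (e / 3)%:B.
rewrite addrK rnorm_cst// gtr0_norm//; lra.
Qed.

Lemma rnorm_shift K x : selfadj x -> rnorm x <= K -> rnorm (K%:B + x) = K + numsup x.
Proof.
move=> sx xK; rewrite rnorm_positive ?numsup_cst//.
  by apply: selfadjD => //; apply: selfadj_cst.
by rewrite positive_cst//; apply: le_trans (numsup_le_norm _ _) _; rewrite ?rnormN.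
Qed.

(* With [a = d^* d], [b = d d^*] and [K = |d|^2], [b (K + b)^n = d (K + a)^n d^*];
   the norms of both sides grow like [(K + numsup b)^n] and [(K + numsup a)^n]. *)
Lemma numsup_mulC d e : 0 <= e -> numsup (star d * d) <= e -> numsup (d * star d) <= e.
Proof.
move=> e0; set a := star d * d; set b := d * star d => ae.
rewrite leNgt; apply/negP => be; set m := numsup b in be.
have m0 : 0 < m := le_lt_trans e0 be.
pose K := rnorm d ^+ 2.
have aK : rnorm a = K by rewrite rnorm_sq.
have bK : rnorm b = K by rewrite /K -(rnorm_star d) -rnorm_sq starK.
have sa : selfadj a := selfadj_starM d.
have sb : selfadj b by rewrite /b -{1}(starK d); apply: selfadj_starM.
have K0 : 0 < K by apply: lt_le_trans m0 _; rewrite -bK numsup_le_norm.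
pose y := K%:B + b; pose x := K%:B + a.
have sy : selfadj y by apply: selfadjD => //; apply: selfadj_cst.
have ny : rnorm y = K + m by rewrite rnorm_shift// bK.
have nx : rnorm x <= K + e by rewrite rnorm_shift// ?aK// lerD2l.
have dx n : y ^+ n * d = d * x ^+ n.
  elim: n => [|n ih]; first by rewrite !expr0 mul1r mulr1.
  rewrite exprSr -mulrA exprSr [RHS]mulrA -ih -[RHS]mulrA; congr (_ * _).
  by rewrite mulrDl mulrDr cst_mull cst_mulr mulrA.
(* At powers of two the C*-identity gives the exact norm of the power of [y]. Splitting off one
   factor y = K + b leaves the exponent 2^k - 1, and the term K |y^n| absorbs the summand K of K +
   m. *)
have bnd k : m * (K + m) ^+ (2 ^ k).-1 <= K * (K + e) ^+ (2 ^ k).-1.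
  have := rnorm_selfadjX k sy; case: (2 ^ k)%N (expn_gt0 2 k) => // n _.
  rewrite -pred_Sn ny => nyn.
  have nyn' : rnorm (y ^+ n) <= (K + m) ^+ n.
    case: n {nyn} => [|n]; first by rewrite !expr0 rnorm1.
    by rewrite -ny; apply: rnormX_le.
  have nxn : rnorm (x ^+ n) <= (K + e) ^+ n.
    case: n {nyn nyn'} => [|n]; first by rewrite !expr0 rnorm1.
    apply: le_trans (rnormX_le _ _) _.
    by rewrite lerXn2r// nnegrE ?rnorm_ge0// addr_ge0// ltW.
  have e1 : y ^+ n.+1 = K *:: y ^+ n + b * y ^+ n by rewrite exprS mulrDl cst_mull.
  have e2 : b * y ^+ n = (d * x ^+ n) * star d.
    rewrite -dx -mulrA; have : GRing.comm b (y ^+ n).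
      by apply/commrX/commrD => //; apply: comm_cst.
    by [].
  have := rnormD (K *:: y ^+ n) (b * y ^+ n); rewrite -e1 nyn e2 rnormZ gtr0_norm//.
  have : rnorm (d * x ^+ n * star d) <= K * (K + e) ^+ n.
    apply: le_trans (rnormM _ _) _; rewrite rnorm_star.
    apply: (@le_trans _ _ (rnorm d * rnorm (x ^+ n) * rnorm d)).
      by rewrite ler_wpM2r ?rnorm_ge0// rnormM.
    by rewrite mulrAC -expr2 ler_wpM2l// ltW.
  rewrite exprS mulrDl; set Y := rnorm (y ^+ n) in nyn' *; set Z := rnorm _.
  have : K * Y <= K * (K + m) ^+ n by rewrite ler_wpM2l// ltW.
  lra.
have Km : 0 < K + m by rewrite addr_gt0.
pose q := (K + e) / (K + m).
have q01 : 0 <= q < 1.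
  by rewrite /q ltr_pdivrMr// mul1r ltrD2l be andbT divr_ge0// ?addr_ge0// ltW.
have [N hN] := expr_small K q01 m0.
have Nle : (N <= (2 ^ N).-1)%N by rewrite -ltnS prednK ?expn_gt0// ltn_expl.
have := hN _ Nle; rewrite ltNge => /negP; apply.
rewrite /q expr_div_n mulrAC ler_pdivlMr ?exprn_gt0// [leRHS]mulrC.
exact: bnd.
Qed.

(** Strict negativity gives [t] with |t - r| < t, so r / t is 1 - z with |z| < 1. *)
Lemma numsup_lt0_inv (r : B) : selfadj r -> numsup (- r) < 0 -> exists w,
  [/\ selfadj w, r * w = 1 & forall x, GRing.comm x r -> GRing.comm x w].
Proof.
move=> sr r0; have [t t0 ht] := numsup_lt one_neq0 r0; rewrite addr0 in ht.
have T0 : 0 < t := le_lt_trans (rnorm_ge0 _) ht.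
have Tn := gt_eqF T0.
pose z := t^-1 *:: (t%:B - r).
have z1 : rnorm z < 1.
  by rewrite rnormZ gtr0_norm ?invr_gt0// ltr_pdivrMl// mulr1.
have z1E : 1 - z = t^-1 *:: r.
  by rewrite /z rscaleBr rscaleVK ?Tn// opprB addrCA subrr addr0.
have [w [w1 w2]] := inv_one_sub z1; rewrite z1E in w1 w2.
pose u := t^-1 *:: w.
have ru : r * u = 1 by rewrite -rscaleAr rscaleAl.
have ur : u * r = 1 by rewrite -rscaleAl rscaleAr.
exists u; split => //.
  have h : star u * r = 1 by rewrite -{1}sr -starM ru star1.
  by rewrite /selfadj -[LHS]mulr1 -ru mulrA h mul1r.
move=> x xr; rewrite /GRing.comm -[LHS]mul1r -{1}ur.
by rewrite -mulrA (mulrA r) -xr -mulrA ru mulr1.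
Qed.

(** Up to sign [e] and [f] are twice the real and imaginary parts of [d], and e^2 + f^2 is twice the
    anticommutator. *)
Lemma positive_anticommutator d : positive (d * star d + star d * d).
Proof.
pose e := d + star d; pose f := 'i *: (d - star d).
have se : selfadj e by rewrite /selfadj starD starK addrC.
have sf : selfadj f.
  by rewrite /selfadj starZ starB starK conjCi scaleNr -scalerN opprB.
have ii : 'i * 'i = -1 :> R[i] by rewrite -expr2 sqrCi.
have ff : f * f = - ((d - star d) * (d - star d)).
  by rewrite /f -scaleAl -scaleAr scalerA ii scaleN1r.
have := positiveD one_neq0 (positive_sqr one_neq0 se) (positive_sqr one_neq0 sf).
have -> : e * e + f * f = 2 *:: (d * star d + star d * d).
  rewrite ff /e; set u := star d.
  have -> : (d + u) * (d + u) = (d * d + u * u) + (d * u + u * d).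
    by rewrite mulrDl !mulrDr addrA [LHS](ACl ((1*4)*(2*3))).
  have -> : (d - u) * (d - u) = (d * d + u * u) - (d * u + u * d).
    by rewrite mulrBl !mulrBr opprB addrA [LHS](ACl ((1*3)*(2*4))) opprD.
  by rewrite opprB addrC addrA subrK -[2]/(1 + 1) rscaleDl rscale1.
have h2 : 0 <= 2^-1 :> R by rewrite invr_ge0.
by move=> /(positiveZ one_neq0 h2); rewrite rscaleVK// pnatr_eq0.
Qed.

(* If the numerical range of [a = c^* c] had infimum [-1], then [d = c (2 + a)^-1]
   would satisfy [d^* d = a (2 + a)^-2 <= 1/8], so [d d^* <= 1/8] and, as
   [d^* d + d d^* >= 0], [d^* d >= -1/8]; but [t (2 + t)^-2] is [-1] at [t = -1]. *)
Lemma numsup_star_mul_neq1 c : numsup (- (star c * c)) != 1.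
Proof.
apply/eqP; set a := star c * c => a1.
have sa : selfadj a := selfadj_starM c.
pose r := 2%:B + a.
have sr : selfadj r by apply: selfadjD => //; apply: selfadj_cst.
have [|w [sw rw cw]] := numsup_lt0_inv sr.
  by rewrite opprD -cstN numsup_cst// a1; lra.
have car : GRing.comm a r by apply: commrD => //; apply: comm_cst.
have caw := cw _ car; have crw : GRing.comm r w by apply: cw.
pose d := c * w.
have dd : star d * d = a * (w * w).
  by rewrite /d starM sw mulrA -(mulrA w) -/a -caw -mulrA.
(* (2 + a)^2 = 8 a + (2 - a)^2; multiplied by [w * w], this writes 1 as 8 [star d * d] plus a
   square, which is the source of the bound 1/8. *)
pose q := 2%:B - a.
have sq : selfadj q by apply/selfadjD/selfadjN => //; apply: selfadj_cst.
have cqw : GRing.comm q w.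
  apply/commr_sym/commrB; first exact: comm_cst.
  exact: commr_sym.
have rrE : r * r = 4%:B + 4 *:: a + a * a.
  rewrite mulrDl !mulrDr !cst_mull cst_mulr !rscaleA -addrA (addrA (2 *:: a)).
  by rewrite -rscaleDl !addrA; congr (_ *:: _ + _ *:: _ + _); ring.
have qqE : q * q = 4%:B - 4 *:: a + a * a.
  rewrite mulrBl !mulrBr !cst_mull cst_mulr !rscaleA opprB addrA addrAC.
  rewrite -(addrA (_ - _)) [_ + a * a]addrC -!addrA; congr (_ *:: _ + _).
    by ring.
  by rewrite addrCA addrC -opprD -rscaleDl; congr (- (_ *:: _) + _); ring.
have rr : r * r = 8 *:: a + q * q.
  rewrite rrE qqE !addrA [8 *:: a + _]addrC -!addrA; congr (_ + _).
  by rewrite addrA -rscaleNl -rscaleDl; congr (_ *:: _ + _); ring.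
have rrww : r * r * (w * w) = 1 by rewrite -mulrA (mulrA r w) rw mul1r rw.
have id1 : 8 *:: (star d * d) + (q * w) * (q * w) = 1.
  have -> : q * w * (q * w) = q * q * (w * w).
    by rewrite -mulrA (mulrA w) -cqw !mulrA.
  by rewrite dd rscaleAl -mulrDl -rr.
have le1 : numsup (star d * d) <= 8^-1.
  have h : numsup (- (q * w * (q * w))) <= 0.
    by apply: positive_sqr => //; apply: selfadjM.
  have := numsupZ one_neq0 (star d * d) (ler0n R 8).
  have -> : 8%:R *:: (star d * d) = 1%:B - q * w * (q * w).
    by rewrite rscale1 -id1 addrK.
  by rewrite numsup_cst//; lra.
have e80 : 0 <= 8^-1 :> R by rewrite invr_ge0.
have le2 : numsup (d * star d) <= 8^-1 by apply: numsup_mulC.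
have pos1 : positive (8^-1%:B + a * (w * w)).
  rewrite positive_cst// -dd.
  have := numsupD one_neq0 (- (d * star d + star d * d)) (d * star d).
  have := positive_anticommutator d; rewrite /positive.
  by rewrite opprD [- _ - _]addrC subrK; lra.
have cww x : GRing.comm x w -> GRing.comm x (w * w) by move=> ?; apply: commrM.
have pos2 : positive ((8^-1%:B + a * (w * w)) * (r * r)).
  apply: positiveM => //.
  - apply: selfadjD; first exact: selfadj_cst.
    by apply: selfadjM; [|apply: selfadj_sqr|apply: cww].
  - exact: selfadj_sqr.
  - apply: commr_sym; apply: commrD; first exact: comm_cst.
    have cra : GRing.comm (r * r) a by apply/commr_sym/commrM.
    have crw2 : GRing.comm (r * r) w by apply/commr_sym/commrM; apply: commr_sym.
    by apply: commrM => //; apply: cww.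
  - exact: positive_sqr.
have pos3 : positive (r * r + 8 *:: a).
  have := positiveZ one_neq0 (ler0n R 8) pos2.
  rewrite mulrDl cst_mull rscaleDr rscaleKV ?pnatr_eq0//.
  have crr : GRing.comm (w * w) (r * r).
    by apply/commrM; apply/commr_sym/cww.
  by rewrite -[a * _ * _]mulrA crr rrww mulr1.
(* Adding (1 + a)(n - a) >= 0 to a^2 + 12 a + 4 >= 0 cancels the square. For the affine element (n +
   4) + (n + 11) a, positivity and [a1] give n + 11 <= n + 4. *)
pose n := rnorm a.
have pos4 : positive ((1%:B + a) * (n%:B - a)).
  apply: positiveM => //.
  - by apply: selfadjD => //; apply: selfadj_cst.
  - by apply/selfadjD/selfadjN => //; apply: selfadj_cst.
  - apply/commrB; first exact: comm_cst.
    by apply/commr_sym/commrD => //; apply: comm_cst.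
  - by rewrite positive_cst// a1.
  - by rewrite positive_cst// opprK numsup_le_norm.
have := positiveD one_neq0 pos3 pos4.
have -> : r * r + 8 *:: a + (1%:B + a) * (n%:B - a) = (n + 4)%:B + (n + 11) *:: a.
  have -> : (1%:B + a) * (n%:B - a) = n%:B + (n - 1) *:: a - a * a.
    rewrite mulrDl !mulrBr !cst_mull cst_mulr rscaleA mul1r !addrA rscale1.
    by rewrite rscaleDl rscaleNl rscale1 addrA (addrAC _ (- a)).
  rewrite rrE !addrA [LHS](ACl (((5*1)*(6*2*4))*(3*7))) /= subrr addr0 -!rscaleDl.
  by congr (_ *:: _ + _ *:: _); ring.
rewrite positive_cst// -rscaleNr numsupZ// ?a1; last by rewrite addr_ge0 ?rnorm_ge0.
lra.
Qed.

(** Rescaling [c] turns a positive value of [numsup (- (star c * c))] into 1, the excluded one. *)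
Lemma positive_star_mul c : positive (star c * c).
Proof.
rewrite /positive leNgt; apply/negP => m0; set m := numsup _ in m0.
apply/negP: (numsup_star_mul_neq1 (Num.sqrt m^-1 *:: c)); rewrite negbK.
have mi : 0 <= m^-1 by rewrite invr_ge0 ltW.
rewrite starZr -rscaleAl -rscaleAr rscaleA -expr2 sqr_sqrtr//.
by rewrite -rscaleNr numsupZ// mulVf// gt_eqF.
Qed.

Lemma numsup_iselfadj x : selfadj x -> numsup ('i *: x) <= 0.
Proof.
move=> sx; rewrite leNgt; apply/negP => m0; set m := numsup _ in m0.
(* (t + m)^2 <= |t + 'i x|^2 = |t^2 + x^2| <= t^2 + K would give 2 t m <= K, while t m = K + 1. *)
pose K := rnorm x ^+ 2; pose t := (K + 1) / m.
have K0 : 0 <= K by rewrite exprn_ge0 ?rnorm_ge0.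
have t0 : 0 < t by rewrite divr_gt0// ltr_wpDl.
have := numsup_le one_neq0 ('i *: x) (ltW t0); rewrite -/m.
have := rnorm_sq (t%:B + 'i *: x).
rewrite star_mul_addi//; [|exact: selfadj_cst|exact/commr_sym/comm_cst].
rewrite cst_mull rscaleA => h.
have : rnorm ((t * t)%:B + x * x) <= t * t + K.
  apply: le_trans (rnormD _ _) _.
  by rewrite rnorm_cst// rnorm_selfadj_sqr// ger0_norm// mulr_ge0// ltW.
have tm : t * m = K + 1 by rewrite divfK// gt_eqF.
rewrite h; set n := rnorm _; have : 0 <= n by apply: rnorm_ge0.
clearbody n t m; nra.
Qed.

End Kaplansky.

(** * Domination of bounded functionals by states *)

Section HahnBanach.
Context {R : realType} {V : lmodType R[i]}.
Implicit Types (p q : V -> R) (x y : V) (r s : R).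

Definition sublinear p :=
  (forall x y, p (x + y) <= p x + p y) /\ (forall r x, 0 <= r -> p (r *:: x) = r * p x).

Lemma sublinear0 p : sublinear p -> p 0 = 0.
Proof. by case=> _ /(_ 0 0 (lexx 0)); rewrite rscale0 mul0r. Qed.

Lemma sublinearN p x : sublinear p -> - p (- x) <= p x.
Proof.
move=> hp; have := hp.1 x (- x); rewrite subrr (sublinear0 hp); lra.
Qed.

Definition rcone (G : set (V * R)) :=
  [/\ G (0, 0), forall g h, G g -> G h -> G (g.1 + h.1, g.2 + h.2)
    & forall r g, 0 <= r -> G g -> G (r *:: g.1, r * g.2)].

(** The infimum of p (x + g.1) - g.2 over [G] works: g = 0 shows q <= p, and x = - g.1 gives the
    last clause, so a linear functional below [q] satisfies all the constraints. A ray as [G] serves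
    in [hahn_banach], a general cone in [mazur_orlicz]. *)
Lemma sublinear_inf_cone p G : sublinear p -> rcone G ->
  (forall g, G g -> g.2 <= p g.1) ->
  exists q, [/\ sublinear q, forall x, q x <= p x & forall g, G g -> q (- g.1) <= - g.2].
Proof.
move=> hp [G0 GD GZ] Gp.
pose A x := [set p (x + g.1) - g.2 | g in G].
have Ainf x : has_inf (A x).
  split; first by exists (p (x + 0) - 0), (0, 0).
  exists (- p (- x)) => _ [g /Gp gp <-].
  have := hp.1 (x + g.1) (- x); rewrite addrAC subrr add0r; lra.
pose q x := inf (A x).
have qle x g : G g -> q x <= p (x + g.1) - g.2.
  by move=> Gg; apply: ge_inf; [case: (Ainf x)|exists g].
have leq x r : (forall g, G g -> r <= p (x + g.1) - g.2) -> r <= q x.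
  move=> h; apply: lb_le_inf; first by case: (Ainf x).
  by move=> _ [g Gg <-]; apply: h.
have qlt x e : 0 < e -> exists2 g, G g & p (x + g.1) - g.2 < q x + e.
  by move=> e0; have [_ [g Gg <-]] := inf_adherent e0 (Ainf x); exists g.
exists q; split.
- split=> [x y|r x].
    apply/ler_addgt0Pr => e e0; have e2 : 0 < e / 2 by rewrite divr_gt0.
    have [g Gg hg] := qlt x _ e2; have [h Gh hh] := qlt y _ e2.
    have := qle (x + y) _ (GD _ _ Gg Gh); rewrite /= addrACA.
    have := hp.1 (x + g.1) (y + h.1); lra.
  have le s y : 0 < s -> q (s *:: y) <= s * q y.
    move=> s0; rewrite -ler_pdivrMl//; apply: leq => g Gg; rewrite ler_pdivrMl//.
    have := qle (s *:: y) _ (GZ _ _ (ltW s0) Gg).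
    by rewrite /= -rscaleDr (hp.2 _ _ (ltW s0)) -mulrBr.
  rewrite le_eqVlt => /predU1P[<-|r0].
    rewrite rscale0 mul0r; apply/eqP; rewrite eq_le.
    have := qle 0 _ G0; rewrite /= addr0 subr0 (sublinear0 hp) => -> /=.
    by apply: leq => g /Gp; rewrite add0r subr_ge0.
  apply/eqP; rewrite eq_le le//=.
  have := le r^-1 (r *:: x); rewrite invr_gt0 => /(_ r0).
  by rewrite rscaleVK ?gt_eqF// => h; rewrite -ler_pdivlMl.
- by move=> x; have := qle x _ G0; rewrite /= addr0 subr0.
- by move=> g Gg; have := qle (- g.1) _ Gg; rewrite addNr (sublinear0 hp) sub0r.
Qed.

Definition rlinear p :=
  (forall x y, p (x + y) = p x + p y) /\ (forall r x, p (r *:: x) = r * p x).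

(* A sublinear functional that is minimal among those below [p] is linear. *)
Lemma hahn_banach p : sublinear p -> exists2 f, rlinear f & forall x, f x <= p x.
Proof.
move=> hp; pose T := {q : V -> R | sublinear q /\ forall x, q x <= p x}.
(* The order is reversed, so that the maximal element supplied by [Zorn] is pointwise minimal. *)
pose le (q q' : T) := `[< forall x, sval q' x <= sval q x >].
have [||||[m [sm mp]] min] := @Zorn T le.
- by move=> q; apply/asboolP.
- move=> q r s /asboolP qr /asboolP rs; apply/asboolP => x.
  exact: le_trans (rs x) (qr x).
- move=> [q hq] [r hr] /asboolP /= qr /asboolP /= rq.
  apply/eq_exist/funext => x; apply/eqP; rewrite eq_le rq qr//.
- move=> A totA; have [[a Aa]|nA] := pselect (A !=set0); last first.
    exists (exist _ p (conj hp (fun=> lexx _))) => s As.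
    by exfalso; apply: nA; exists s.
  pose S x := [set sval q x | q in A].
  have Sinf x : has_inf (S x).
    split; first by exists (sval a x), a.
    exists (- p (- x)) => _ [q Aq <-]; have [sq qp] := svalP q.
    by apply: le_trans (sublinearN _ sq); rewrite lerN2.
  pose m x := inf (S x).
  have mle x (q : T) : A q -> m x <= sval q x.
    by move=> Aq; apply: ge_inf; [case: (Sinf x)|exists q].
  have lem x r : (forall q : T, A q -> r <= sval q x) -> r <= m x.
    move=> h; apply: lb_le_inf; first by case: (Sinf x).
    by move=> _ [g Gg <-]; apply: h.
  have mlt x e : 0 < e -> exists2 q : T, A q & sval q x < m x + e.
    by move=> e0; have [_ [q Aq <-]] := inf_adherent e0 (Sinf x); exists q.
  have sm : sublinear m.
    split=> [x y|r x].
      apply/ler_addgt0Pr => e e0; have e2 : 0 < e / 2 by rewrite divr_gt0.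
      have [g Ag hg] := mlt x _ e2; have [h Ah hh] := mlt y _ e2.
      have [/asboolP gh|/asboolP hg'] := totA _ _ Ag Ah.
        have := mle (x + y) _ Ah; have := (svalP h).1.1 x y; have := gh x; lra.
      have := mle (x + y) _ Ag; have := (svalP g).1.1 x y; have := hg' y; lra.
    have le' s y : 0 < s -> m (s *:: y) <= s * m y.
      move=> s0; rewrite -ler_pdivrMl//; apply: lem => g Gg; rewrite ler_pdivrMl//.
      by have := mle (s *:: y) _ Gg; rewrite (svalP g).1.2// ltW.
    rewrite le_eqVlt => /predU1P[<-|r0].
      rewrite rscale0 mul0r; apply/eqP; rewrite eq_le.
      have := mle 0 _ Aa; rewrite (sublinear0 (svalP a).1) => -> /=.
      by apply: lem => g _; rewrite (sublinear0 (svalP g).1).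
    apply/eqP; rewrite eq_le le'//=.
    have := le' r^-1 (r *:: x); rewrite invr_gt0 => /(_ r0).
    by rewrite rscaleVK ?gt_eqF// => h; rewrite -ler_pdivlMl.
  have mp x : m x <= p x by apply: le_trans (mle x _ Aa) _; case: (svalP a).
  by exists (exist _ m (conj sm mp)) => q Aq; apply/asboolP => x; apply: mle.
(* Lowering [m] along the ray through (y, m y) must give back [m] by minimality, and the constraint
   of that ray is m (- y) <= - m y. *)
have mN y : m (- y) = - m y.
  have G : rcone [set g | exists2 s, 0 <= s & g = (s *:: y, s * m y)].
    split.
    - by exists 0; rewrite ?rscale0 ?mul0r.
    - move=> _ _ [s s0 ->] [t t0 ->]; exists (s + t); first by rewrite addr_ge0.
      by rewrite /= rscaleDl mulrDl.
    - move=> r _ r0 [s s0 ->]; exists (r * s); first by rewrite mulr_ge0.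
      by rewrite /= rscaleA mulrA.
  have [|q [sq qm hq]] := sublinear_inf_cone sm G.
    by move=> _ [s s0 ->] /=; rewrite sm.2.
  have qp x : q x <= p x := le_trans (qm x) (mp x).
  have [/= qE] := min (exist _ q (conj sq qp)) (introT (asboolP _) qm).
  have := hq (y, m y); rewrite qE => h; apply/eqP; rewrite eq_le.
  rewrite h; last by exists 1; rewrite ?rscale1 ?mul1r.
  by have := sublinearN y sm; lra.
exists m => //; split=> [x y|r x].
  apply/eqP; rewrite eq_le sm.1/=.
  by have := sm.1 (- x) (- y); rewrite -opprD !mN; lra.
have [r0|r0] := leP 0 r; first exact: sm.2.
by rewrite -[r]opprK rscaleNl mN sm.2 ?mulNr// oppr_ge0 ltW.
Qed.

Lemma mazur_orlicz p G : sublinear p -> rcone G ->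
  (forall g, G g -> g.2 <= p g.1) ->
  exists f, [/\ rlinear f, forall x, f x <= p x & forall g, G g -> g.2 <= f g.1].
Proof.
move=> hp hG Gp; have [q [sq qp qG]] := sublinear_inf_cone hp hG Gp.
have [f lf fq] := hahn_banach sq.
exists f; split=> // [x|g Gg]; first exact: le_trans (fq x) (qp x).
have := fq (- g.1); have := qG _ Gg.
have -> : - g.1 = (-1) *:: g.1 by rewrite rscaleNl rscale1.
by rewrite lf.2; lra.
Qed.

End HahnBanach.

Lemma dualZ (R : realType) (V : normedModType R[i]) (f : dual V) (z : R[i]) (x : V) :
  f (z *: x) = z * f x.
Proof. by rewrite linearZ. Qed.

Section DominatingState.
Context {R : realType} {B : cstarAlgType R}.
Hypothesis one_neq0 : (1 : B) != 0.
Implicit Types (a b c d x y z : B) (r s t : R).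

Lemma sublinear_numsup : sublinear (@numsup R B).
Proof. by split=> [x y|r x]; [exact: numsupD|exact: numsupZ]. Qed.

Lemma iscaleK x : 'i *: ('i *: x) = - x.
Proof. by rewrite scalerA -expr2 sqrCi scaleN1r. Qed.

Lemma scale_complexE (z : R[i]) x : z *: x = Re z *:: x + Im z *:: ('i *: x).
Proof.
rewrite {1}(complexE z) scalerDl; congr (_ + _).
by rewrite complexiE mulrC /rscale scalerA.
Qed.

(** The usual complexification g x - 'i g ('i x). The bound by [numsup] yields everything:
    boundedness, g 1 = 1 from the values at 1 and -1, reality on self-adjoint elements from
    [numsup_iselfadj], and positivity. *)
Lemma complexify_state (g : B -> R) : rlinear g -> (forall x, g x <= numsup x) ->
  exists2 phi : dual B, state phi & forall x, Re (phi x) = g x.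
Proof.
move=> [gD gZ] gn.
have gN x : g (- x) = - g x.
  by rewrite -[x in LHS]rscale1 -rscaleNl gZ mulN1r.
have gabs x : `|g x| <= rnorm x.
  rewrite ler_norml; apply/andP; split.
    by rewrite lerNl -gN -[leRHS]rnormN; apply: le_trans (gn _) (numsup_le_norm one_neq0 _).
  exact: le_trans (gn _) (numsup_le_norm one_neq0 _).
pose f x : R[i]^o := (g x)%:C - 'i * (g ('i *: x))%:C.
have fE x : f x = Complex (g x) (- g ('i *: x)).
  rewrite /f -complexiE; apply/eqP; rewrite eq_complex /=.
  by rewrite !(mul0r, mul1r, subr0, add0r, addr0, mulr0, oppr0, eqxx).
have flin : linear f.
  move=> z x y; rewrite !fE; apply/eqP; rewrite eq_complex /=.
  rewrite scalerDr !gD (scale_complexE z x) scalerDr !rscaleC iscaleK rscaleNr.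
  rewrite !gD !gN !gZ; case: z => u v /=; apply/andP; split; apply/eqP; ring.
have fbnd x : `|f x| <= 2%:C * `|x|.
  rewrite /f (rnormE x); apply: le_trans (ler_normB _ _) _.
  rewrite normrM normCi mul1r !normr_real_complex -rmorphD -rmorphM lecR.
  have := gabs ('i *: x); rewrite rnormZc normCi mul1r.
  by have := gabs x; lra.
pose phi : dual B := mkblin flin fbnd.
have phiE x : phi x = Complex (g x) (- g ('i *: x)) by rewrite -fE.
have isa x : selfadj x -> g ('i *: x) = 0.
  move=> sx; apply/eqP; rewrite eq_le.
  have := le_trans (gn _) (numsup_iselfadj one_neq0 sx).
  have := le_trans (gn _) (numsup_iselfadj one_neq0 (selfadjN sx)).
  by rewrite scalerN gN oppr_le0 => -> ->.
exists phi; last by move=> x; rewrite phiE.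
split=> [|a]; rewrite phiE isa; [|exact: selfadj1| |exact: selfadj_starM].
  suff -> : g 1 = 1 by rewrite oppr0.
  have := gn 1; have := gn (- 1); rewrite gN.
  have := numsup_cst one_neq0 1 0; have := numsup_cst one_neq0 (- 1) 0.
  rewrite !addr0 numsup0// rscaleNl rscale1; lra.
rewrite oppr0 lecE /= eqxx /=.
by have := gn (- (star a * a)); have := positive_star_mul one_neq0 a; rewrite /positive gN; lra.
Qed.

(* Applied to multiples of [b], the affine constraints [2 Re (f b) - 1 <= phi (b^* b)]
   amount to the quadratic one; they are compatible with [numsup] because
   [b |-> b^* b] is convex. *)
Lemma exists_dominating_state (f : dual B) : (forall b, rnorm (f b : R[i]^o) <= rnorm b) ->
  exists2 phi : dual B, state phi &
    forall b, rnorm (f b : R[i]^o) ^+ 2 <= Re (phi (star b * b)).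
Proof.
move=> fb.
pose G : set (B * R) := [set g | exists s b y, [/\ 0 <= s, positive y,
  g.1 = s *:: (star b * b) + y & g.2 = s * (2 * Re (f b) - 1)]].
have pos0 : positive (0 : B) by rewrite /positive oppr0 numsup0.
have fr r x : Re (f (r *:: x)) = r * Re (f x).
  by rewrite /rscale dualZ ReZ.
have hG : rcone G.
  split.
  - by exists 0, 0, 0; split=> //=; rewrite ?rscale0 ?addr0 ?mul0r.
  - move=> [_ _] [_ _] [s [b [y [/= s0 y0 -> ->]]]] [t [c [z [/= t0 z0 -> ->]]]].
    have [st|st] := eqVneq (s + t) 0.
      have [-> ->] : s = 0 /\ t = 0 by split; lra.
      exists 0, 0, (y + z); split=> //=; first exact: positiveD.
        by rewrite !rscale0 !add0r.
      by rewrite !mul0r addr0.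
    have st0 : 0 < s + t by rewrite lt_neqAle eq_sym st addr_ge0.
    pose u := (s + t)^-1.
    have u0 : 0 <= u by rewrite invr_ge0 ltW.
    have us : (s + t) * u = 1 by rewrite mulfV.
    (* For w the weighted mean of [b] and [c], s b* b + t c* c equals (s + t) w* w plus (s t / (s +
       t)) (b - c)* (b - c); this positive defect goes into the slack [y]. *)
    exists (s + t), (u *:: (s *:: b + t *:: c)),
      ((s * t * u) *:: (star (b - c) * (b - c)) + (y + z)); split=> /=.
    + exact: ltW.
    + apply: positiveD => //; last exact: positiveD.
      by apply: positiveZ => //; [rewrite !mulr_ge0|exact: positive_star_mul].
    + have -> : (s + t) *:: (star (u *:: (s *:: b + t *:: c)) * (u *:: (s *:: b + t *:: c))) =
          u *:: (star (s *:: b + t *:: c) * (s *:: b + t *:: c)).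
        by rewrite starZr -rscaleAl -rscaleAr !rscaleA us mul1r.
      rewrite addrACA [in RHS]addrA; congr (_ + _).
      have -> : star (b - c) * (b - c) =
          star b * b - star b * c + star c * c - star c * b.
        by rewrite starB mulrBl !mulrBr opprB addrA.
      rewrite starD !starZr mulrDl !mulrDr.
      rewrite -!rscaleAl -!rscaleAr !rscaleDr !rscaleNr !rscaleA !addrA -!rscaleNl.
      rewrite [RHS](ACl ((1*5)*(2*6)*(3*8)*(4*7))) /= -!rscaleDl.
      have -> : u * s * t + - (s * t * u) = 0 by ring.
      have -> : u * t * s + - (s * t * u) = 0 by ring.
      have -> : u * s * s + s * t * u = (s + t) * u * s by ring.
      have -> : u * t * t + s * t * u = (s + t) * u * t by ring.
      by rewrite us !mul1r !rscale0 !addr0.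
    + rewrite fr linearD ReD !fr; set A := Re _; set C := Re _.
      have -> : (s + t) * (2 * (u * (s * A + t * C)) - 1) =
          (s + t) * u * (2 * (s * A + t * C)) - (s + t) by ring.
      by rewrite us; ring.
  - move=> r [_ _] r0 [s [b [y [/= s0 y0 -> ->]]]].
    exists (r * s), b, (r *:: y); split=> /=; first exact: mulr_ge0.
    + exact: positiveZ.
    + by rewrite rscaleDr rscaleA.
    + by rewrite mulrA.
have [|g [lg gn gG]] := mazur_orlicz sublinear_numsup hG.
  move=> [_ _] [s [b [y [/= s0 y0 -> ->]]]].
  have := numsupD one_neq0 (s *:: (star b * b) + y) (- y).
  rewrite addrK numsupZ//; move: y0; rewrite /positive => y0.
  rewrite -rnorm_positive//; [|exact: selfadj_starM|exact: positive_star_mul].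
  rewrite rnorm_sq => h.
  (* 2 Re (f b) - 1 <= 2 |b| - 1 <= |b|^2, which is [numsup (star b * b)]. *)
  have : s * (2 * Re (f b) - 1) <= s * (rnorm b ^+ 2).
    rewrite ler_wpM2l//.
    have := le_trans (Re_le_norm (f b)) (fb b); have := sqr_ge0 (rnorm b - 1).
    by rewrite sqrrB mulr1 expr1n mulr_natl; lra.
  lra.
have [phi sphi phig] := complexify_state lg gn.
have key b : 2 * Re (f b) - 1 <= Re (phi (star b * b)).
  rewrite phig; apply: (gG (star b * b, 2 * Re (f b) - 1)).
  by exists 1, b, 0; split=> //=; rewrite ?rscale1 ?addr0 ?mul1r.
exists phi => // b; set P := Re _; set n := rnorm _.
(* At r conj(f b) b the value of [f] is the real number r n^2. Then r = 1/P gives n^2 <= P; if P =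
   0, then r = 1/n^2 is contradictory unless n = 0. *)
have key2 r : 2 * (r * n ^+ 2) - 1 <= r ^+ 2 * n ^+ 2 * P.
  have nn : (f b)^* * f b = (n ^+ 2)%:C by rewrite -normCKC [`|_|]rnormE rmorphXn.
  have := key (r *:: ((f b)^* *: b)).
  rewrite fr dualZ nn starZr starZ conjCK -rscaleAl -rscaleAr rscaleA.
  rewrite -scaleAl -scaleAr scalerA [f b * _]mulrC nn -expr2.
  by rewrite /rscale !dualZ !ReZ /= mulrA.
have P0 : 0 <= P.
  by have /le_Re := sphi.2 b.
have [P00|Pn] := eqVneq P 0.
  have [n0|nn] := eqVneq (n ^+ 2) 0; first by rewrite n0.
  by have := key2 (n ^+ 2)^-1; rewrite P00 mulr0 mulVf//; lra.
have Pp : 0 < P by rewrite lt_neqAle eq_sym Pn.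
have := key2 P^-1.
have -> : P^-1 ^+ 2 * n ^+ 2 * P = P^-1 * n ^+ 2 by field.
by move=> h; have : P^-1 * n ^+ 2 <= 1 by [lra]; rewrite ler_pdivrMl// mulr1.
Qed.

End DominatingState.

(** * Hilbert spaces *)

Section PsdForm.
Context {R : realType} {E : lmodType R[i]}.
Implicit Types (s : E -> E -> R[i]) (x y : E) (z : R[i]).

Definition psd_form s :=
  [/\ forall z x x' y, s (z *: x + x') y = z * s x y + s x' y,
      forall x y, s y x = (s x y)^* & forall x, 0 <= s x x].

Context {s : E -> E -> R[i]} (hs : psd_form s).

Lemma psdDl x x' y : s (x + x') y = s x y + s x' y.
Proof. by case: hs => h _ _; have := h 1 x x' y; rewrite scale1r mul1r. Qed.

Lemma psd0l y : s 0 y = 0.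
Proof. by apply: (@addrI _ (s 0 y)); rewrite -psdDl !addr0. Qed.

Lemma psdZl z x y : s (z *: x) y = z * s x y.
Proof. by case: hs => h _ _; have := h z x 0 y; rewrite psd0l !addr0. Qed.

Lemma psdC x y : s y x = (s x y)^*.
Proof. by case: hs. Qed.

Lemma psdNl x y : s (- x) y = - s x y.
Proof. by rewrite -scaleN1r psdZl mulN1r. Qed.

Lemma psdBl x x' y : s (x - x') y = s x y - s x' y.
Proof. by rewrite psdDl psdNl. Qed.

Lemma psdDr x y y' : s x (y + y') = s x y + s x y'.
Proof. by rewrite (psdC (y + y')) psdDl rmorphD/= -!psdC. Qed.

Lemma psdZr z x y : s x (z *: y) = z^* * s x y.
Proof. by rewrite (psdC (z *: y)) psdZl rmorphM/= -psdC. Qed.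

Lemma psdNr x y : s x (- y) = - s x y.
Proof. by rewrite -scaleN1r psdZr rmorphN1 mulN1r. Qed.

Lemma psdBr x y y' : s x (y - y') = s x y - s x y'.
Proof. by rewrite psdDr psdNr. Qed.

Lemma psd_ge0 x : 0 <= s x x.
Proof. by case: hs. Qed.

Definition sqn x : R := Re (s x x).

Lemma sqnE x : s x x = (sqn x)%:C.
Proof. exact/ger0_Re/psd_ge0. Qed.

Lemma sqn_ge0 x : 0 <= sqn x.
Proof. by rewrite -ler0c -sqnE psd_ge0. Qed.

Lemma sqnB x y : sqn (x - y) = sqn x - 2 * Re (s x y) + sqn y.
Proof.
rewrite /sqn psdBl !psdBr (psdC x y) !ReB Re_conjc; ring.
Qed.

Lemma sqnD x y : sqn (x + y) = sqn x + 2 * Re (s x y) + sqn y.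
Proof.
rewrite /sqn psdDl !psdDr (psdC x y) !ReD Re_conjc; ring.
Qed.

Lemma sqnZ z x : sqn (z *: x) = Re `|z| ^+ 2 * sqn x.
Proof.
apply: complexI; rewrite -sqnE psdZl psdZr mulrA -normCK sqnE rmorphM rmorphXn/=.
by rewrite -Re_normE.
Qed.

Lemma cauchy_schwarz x y : Re `|s x y| ^+ 2 <= sqn x * sqn y.
Proof.
set n := Re `|_|; have nE : s x y * (s x y)^* = (n ^+ 2)%:C.
  by rewrite -normCK Re_normE rmorphXn.
(* Positivity at x - r s(x, y) y. The best r is 1 / sqn y; as the form may be degenerate, sqn y = 0
   is treated apart, where a large r forces n = 0. *)
have key r : 2 * (r * n ^+ 2) <= sqn x + r ^+ 2 * n ^+ 2 * sqn y.
  have e1 : (r%:C * s x y)^* * s x y = (r * n ^+ 2)%:C.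
    by rewrite rmorphM/= -mulrA (mulrC (s x y)^*) nE conj_realc -rmorphM.
  have e2 : Re `|r%:C * s x y| = `|r| * n.
    by rewrite normrM (Re_normE (s x y)) normr_real_complex -rmorphM.
  have := sqn_ge0 (x - (r%:C * s x y) *: y); rewrite sqnB sqnZ psdZr e1 e2.
  by rewrite exprMn real_normK ?num_real// -/n/=; lra.
have [P0|Pn] := eqVneq (sqn y) 0.
  rewrite P0 mulr0; have [->//|nn] := eqVneq (n ^+ 2) 0.
  have := key ((sqn x + 1) / n ^+ 2); rewrite P0 mulr0 addr0 divfK//.
  by have := sqn_ge0 x; lra.
have Pp : 0 < sqn y by rewrite lt_neqAle eq_sym Pn sqn_ge0.
have := key (sqn y)^-1.
have -> : (sqn y)^-1 ^+ 2 * n ^+ 2 * sqn y = (sqn y)^-1 * n ^+ 2 by field.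
move=> h; rewrite mulrC -ler_pdivrMl//; lra.
Qed.

Definition seminorm x : R := Num.sqrt (sqn x).

Lemma seminorm_ge0 x : 0 <= seminorm x. Proof. exact: sqrtr_ge0. Qed.

Lemma sqr_seminorm x : seminorm x ^+ 2 = sqn x.
Proof. by rewrite sqr_sqrtr ?sqn_ge0. Qed.

Lemma psd_le_seminorm x y : Re `|s x y| <= seminorm x * seminorm y.
Proof.
rewrite -(@ler_pXn2r _ 2)// ?nnegrE ?mulr_ge0 ?seminorm_ge0//.
  by rewrite exprMn !sqr_seminorm cauchy_schwarz.
by rewrite -ler0c -Re_normE.
Qed.

Lemma seminormD x y : seminorm (x + y) <= seminorm x + seminorm y.
Proof.
rewrite -(@ler_pXn2r _ 2)// ?nnegrE ?addr_ge0 ?seminorm_ge0//.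
rewrite sqr_seminorm sqnD sqrrD !sqr_seminorm lerD2r lerD2l -[leRHS]mulr_natl.
rewrite ler_wpM2l//; apply: le_trans (Re_le_norm _) (psd_le_seminorm _ _).
Qed.

Lemma seminormZ z x : seminorm (z *: x) = Re `|z| * seminorm x.
Proof.
rewrite /seminorm sqnZ sqrtrM ?sqr_ge0// sqrtr_sqr ger0_norm//.
by rewrite -ler0c -Re_normE.
Qed.

End PsdForm.

(** An alias of [E] indexed by the proofs, so that the norm is inferred from the type even when [E]
    already carries another one; [hspace] adds completeness to the index in the same way. *)
Definition ipspace {R : realType} {E : lmodType R[i]} {s : E -> E -> R[i]}
  (hs : psd_form s) (hd : forall x, s x x = 0 -> x = 0) : Type := E.

Section InnerProductSpace.
Context {R : realType} {E : lmodType R[i]} {s : E -> E -> R[i]}.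
Context (hs : psd_form s) (hd : forall x, s x x = 0 -> x = 0).

Local Notation W := (ipspace hs hd).
HB.instance Definition _ := GRing.Lmodule.on W.

Let norm (x : W) : R[i] := (@seminorm R E s x)%:C.

Let ler_normD x y : norm (x + y) <= norm x + norm y.
Proof. by rewrite -rmorphD lecR; apply: seminormD. Qed.

Let normrZ z x : norm (z *: x) = `|z| * norm x.
Proof. by rewrite /norm (seminormZ hs) rmorphM/= -Re_normE. Qed.

Let norm_eq0 x : norm x = 0 -> x = 0.
Proof.
move=> h; apply: hd; rewrite (sqnE hs) -(sqr_seminorm hs).
by move/complexI : h => ->; rewrite expr0n.
Qed.

HB.instance Definition _ := Lmodule_isNormed.Build R[i] W ler_normD normrZ norm_eq0.

Lemma ipspace_rnorm (x : W) : rnorm x = @seminorm R E s x.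
Proof. by []. Qed.

End InnerProductSpace.

Definition hspace {R : realType} {E : lmodType R[i]} {s : E -> E -> R[i]}
  (hs : psd_form s) (hd : forall x, s x x = 0 -> x = 0)
  (hc : forall u : nat -> ipspace hs hd, rcauchy u -> exists l, rcvg u l) : Type :=
  ipspace hs hd.

Section HilbertSpace.
Context {R : realType} {E : lmodType R[i]} {s : E -> E -> R[i]}.
Context (hs : psd_form s) (hd : forall x, s x x = 0 -> x = 0).
Context (hc : forall u : nat -> ipspace hs hd, rcauchy u -> exists l, rcvg u l).

Local Notation W := (hspace hc).
HB.instance Definition _ := NormedModule.on W.

Let complete (F : set_system W) : ProperFilter F -> cauchy F -> cvg F.
Proof.
move=> PF /cauchyP cF.
(* The filter contains balls of radius 1/(n + 1); their centres form a Cauchy sequence, whose limit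
   is that of the filter. *)
have /choice[u hu] n : exists x : W, F (ball x (n.+1%:R^-1)%:C).
  by apply: cF; rewrite ltr0c invr_gt0.
have [l ul] : exists l, rcvg u l.
  apply: hc => e e0; have [N hN] := invS_small (divr_gt0 e0 (ltr0n _ 2)).
  exists N => n m Nn Nm; have [y []] := filter_ex (filterI (hu n) (hu m)).
  rewrite -!ball_normE /= !rnorm_lt => hn hm.
  apply: le_lt_trans (rnorm_dist y _ _) _; rewrite (splitr e) ltrD//.
    exact: lt_trans hn (hN _ Nn).
  by rewrite rnorm_distC; apply: lt_trans hm (hN _ Nm).
apply/cvg_ex; exists l; apply/fcvg_ballP => e e0.
have e0' : 0 < Re e / 2 by rewrite divr_gt0// -ltr0c -(ger0_Re (ltW e0)).
have [N hN] := invS_small e0'; have [M hM] := ul _ e0'.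
apply: filterS (hu (maxn N M)) => y; rewrite -!ball_normE /=.
rewrite (ger0_Re (ltW e0)) !rnorm_lt => h.
apply: le_lt_trans (rnorm_dist (u (maxn N M)) _ _) _; rewrite (splitr (Re e)) ltrD//.
  by rewrite rnorm_distC; apply: hM; apply: leq_maxr.
by apply: lt_trans h _; apply: hN; apply: leq_maxl.
Qed.

HB.instance Definition _ := Uniform_isComplete.Build W complete.

Let ip : W -> W -> R[i] := s.

Let ip_bilinear : bilinear_for *%R (Num.conj \; *%R) ip.
Proof.
split=> [y z x x'|y z x x'].
  by case: hs => h _ _; exact: h.
by rewrite /ip (psdDr hs) (psdZr hs).
Qed.

HB.instance Definition _ := bilinear_isBilinear.Build R[i] W W R[i] _ _ ip ip_bilinear.

Let ip_herm (x y : W) : ip x y = (-1) ^+ false * Num.conj (ip y x).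
Proof. by rewrite mul1r /ip (psdC hs). Qed.

HB.instance Definition _ := isHermitianSesquilinear.Build R[i] W false Num.conj ip ip_herm.

Let ip_dot (x : W) : x != 0 -> 0 < ip x x.
Proof.
move=> x0; rewrite lt_neqAle (psd_ge0 hs) andbT eq_sym.
by apply/eqP => /hd /eqP; apply/negP.
Qed.

HB.instance Definition _ := isDotProduct.Build R[i] W ip ip_dot.

Let ip_norm (x : W) : ip x x = `|x| ^+ 2.
Proof. by rewrite /ip (sqnE hs) -(sqr_seminorm hs) rmorphXn. Qed.

HB.instance Definition _ := NormedModule_isHilbert.Build R W ip_norm.

End HilbertSpace.

Section HilbertTheory.
Context {R : realType} {H : hilbertType R}.
Implicit Types (x y : H) (z : R[i]).

Lemma inner_psd : psd_form (fun x y : H => inner x y).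
Proof.
split=> [z x x' y|x y|x].
- by rewrite linearDl linearZl_LR.
- by rewrite hermC mul1r.
- by rewrite inner_norm exprn_ge0.
Qed.

Lemma innerDl x x' y : inner (x + x') y = inner x y + inner x' y.
Proof. exact: psdDl inner_psd x x' y. Qed.

Lemma innerZl z x y : inner (z *: x) y = z * inner x y.
Proof. exact: psdZl inner_psd z x y. Qed.

Lemma innerBl x x' y : inner (x - x') y = inner x y - inner x' y.
Proof. exact: psdBl inner_psd x x' y. Qed.

Lemma inner0l y : inner 0 y = 0.
Proof. exact: psd0l inner_psd y. Qed.

Lemma innerDr x y y' : inner x (y + y') = inner x y + inner x y'.
Proof. exact: psdDr inner_psd x y y'. Qed.

Lemma innerZr z x y : inner x (z *: y) = z^* * inner x y.
Proof. exact: psdZr inner_psd z x y. Qed.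

Lemma innerNr x y : inner x (- y) = - inner x y.
Proof. exact: psdNr inner_psd x y. Qed.

Lemma innerBr x y y' : inner x (y - y') = inner x y - inner x y'.
Proof. exact: psdBr inner_psd x y y'. Qed.

Lemma innerC x y : inner y x = (inner x y)^*.
Proof. exact: psdC inner_psd x y. Qed.

Lemma inner_rnorm x : inner x x = (rnorm x ^+ 2)%:C.
Proof. by rewrite inner_norm rnormE rmorphXn. Qed.

Lemma sqn_inner x : @sqn R H (fun x y : H => inner x y) x = rnorm x ^+ 2.
Proof. by rewrite /sqn inner_rnorm. Qed.

Lemma rnorm_inner x y : rnorm (inner x y : R[i]^o) <= rnorm x * rnorm y.
Proof.
have := psd_le_seminorm inner_psd x y.
by rewrite /seminorm !sqn_inner !sqrtr_sqr !(ger0_norm (rnorm_ge0 _)).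
Qed.

Lemma rcvg_innerl (u : nat -> H) l y : rcvg u l ->
  rcvg (fun n => inner (u n) y : R[i]^o) (inner l y).
Proof.
move=> ul e e0; have c1 : 0 < rnorm y + 1 by rewrite ltr_wpDl ?rnorm_ge0.
have [N hN] := ul _ (divr_gt0 e0 c1); exists N => n /hN.
rewrite ltr_pdivlMr// => /(le_lt_trans _); apply; rewrite -[_ - _]innerBl.
by apply: le_trans (rnorm_inner _ _) _; rewrite ler_wpM2l ?rnorm_ge0// lerDl.
Qed.

Lemma rnorm_sqrD x y : rnorm (x + y) ^+ 2 = rnorm x ^+ 2 + 2 * Re (inner x y) + rnorm y ^+ 2.
Proof. by have := sqnD inner_psd x y; rewrite !sqn_inner. Qed.

Lemma rnorm_sqrB x y : rnorm (x - y) ^+ 2 = rnorm x ^+ 2 - 2 * Re (inner x y) + rnorm y ^+ 2.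
Proof. by have := sqnB inner_psd x y; rewrite !sqn_inner. Qed.

End HilbertTheory.

(** * Riesz representation *)

Section Riesz.
Context {R : realType} {H : hilbertType R}.

Definition csubspace {V : lmodType R[i]} (D : set V) :=
  D 0 /\ forall (z : R[i]) x y, D x -> D y -> D (z *: x + y).

(* The graph [D] of a bounded functional on a subspace is represented by the
   minimizer of [|x|^2 - 2 Re c] over [(x, c)] in [D]. *)
Lemma riesz (D : set (H * R[i]^o)) (C : R) : csubspace D -> 0 <= C ->
  (forall p, D p -> rnorm p.2 <= C * rnorm p.1) ->
  exists eta : H, [/\ forall p, D p -> p.2 = inner p.1 eta, rnorm eta <= C
    & forall A : set H, closed A -> (forall p, D p -> A p.1) -> A eta].
Proof.
move=> [D0 Dlin] C0 Dbnd.
have DD p q : D p -> D q -> D (p + q) by move=> Dp Dq; rewrite -[p]scale1r; apply: Dlin.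
have DZ z p : D p -> D (z *: p) by move=> Dp; rewrite -[_ *: _]addr0; apply: Dlin.
pose J (p : H * R[i]^o) := rnorm p.1 ^+ 2 - 2 * Re p.2.
have Jinf : has_inf [set J p | p in D].
  split; first by exists (J 0), 0.
  (* J >= |x|^2 - 2 C |x| >= - C^2. *)
  exists (- C ^+ 2) => _ [p Dp <-]; rewrite /J.
  have := Dbnd _ Dp; have := Re_le_norm p.2; rewrite -/(rnorm (p.2 : R[i]^o)).
  have := sqr_ge0 (rnorm p.1 - C); rewrite sqrrB -mulr_natl; lra.
pose m := inf [set J p | p in D].
have mJ p : D p -> m <= J p by move=> Dp; apply: ge_inf; [case: Jinf|exists p].
have /choice[u hu] n : exists p, D p /\ J p < m + n.+1%:R^-1.
  have [|_ [p Dp <-] h] := @inf_adherent _ _ n.+1%:R^-1 _ Jinf.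
    by rewrite invr_gt0.
  by exists p.
(* Parallelogram law: the midpoint lies in [D], so [J] there is at least [m]. *)
have dist n k : rnorm ((u n).1 - (u k).1) ^+ 2 <= 2 * (n.+1%:R^-1 + k.+1%:R^-1).
  have [Dn hn] := hu n; have [Dk hk] := hu k.
  have := mJ _ (DZ (2^-1)%:C _ (DD _ _ Dn Dk)); move: hn hk; rewrite /J /=.
  rewrite -rscaleE rnormZ ger0_norm ?invr_ge0// exprMn.
  rewrite -[(2^-1)%:C *: _]/((2^-1)%:C * _) ReZ ReD.
  have := rnorm_sqrD (u n).1 (u k).1; have := rnorm_sqrB (u n).1 (u k).1.
  have -> : 2^-1 ^+ 2 = 4^-1 :> R by field.
  move: n.+1%:R^-1 k.+1%:R^-1 => r r'; lra.
have cu : rcauchy (fun n => (u n).1).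
  move=> e e0; have e4 : 0 < e ^+ 2 / 4 by rewrite divr_gt0 ?exprn_gt0.
  have [N hN] := invS_small e4.
  exists N => n k /hN hn /hN hk; rewrite -(@ltr_pXn2r _ 2)// ?nnegrE ?rnorm_ge0 ?ltW//.
  by have := dist n k; move: n.+1%:R^-1 k.+1%:R^-1 hn hk => r r'; lra.
have [eta ueta] := rcauchy_cvg cu.
have rerep y d : D (y, d) -> Re d = Re (inner eta y).
  move=> Dy; pose e := Re (inner eta y) - Re d.
  (* First variation at the infimum: [J] at p + t (y, d) is at least [m], in the limit along [u].
     Then t = - e / |y|^2 forces e = 0. *)
  have key t : 0 <= 2 * t * e + t ^+ 2 * rnorm y ^+ 2.
    apply/ler_addgt0Pr => d' d0.
    pose K := 1 + 2 * `|t|.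
    have K0 : 0 < K by rewrite ltr_pwDl// mulr_ge0.
    have [N hN] := invS_small (divr_gt0 d0 K0).
    have [M hM] := rcvg_innerl y ueta (divr_gt0 d0 K0).
    have := hN _ (leq_maxl N M); have := hM _ (leq_maxr N M).
    have := (hu (maxn N M)).2; have := mJ _ (DD _ _ (hu (maxn N M)).1 (DZ t%:C _ Dy)).
    set p := u _; set r := _.+1%:R^-1; rewrite /J /= rnorm_sqrD innerZr.
    rewrite -rscaleE rnormZ exprMn real_normK ?num_real//.
    rewrite -[t%:C *: _]/(t%:C * _) ReD ReZ.
    rewrite conj_realc ReZ => h1 h2 h3 h4.
    have h5 : `|Re (inner p.1 y) - Re (inner eta y)| < d' / K.
      apply: le_lt_trans h3; rewrite -ReB -lecR.
      by rewrite -Re_normE normc_ge_Re.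
    have h6 : t * (Re (inner p.1 y) - Re (inner eta y)) <= `|t| * (d' / K).
      apply: le_trans (ler_norm _) _; rewrite normrM ler_wpM2l// ltW//.
    have h7 : d' / K + 2 * (`|t| * (d' / K)) = d'.
      by rewrite /K; field; rewrite gt_eqF.
    rewrite /e; lra.
  have [y0|y0] := eqVneq (rnorm y) 0.
    have := key 1; have := key (-1); rewrite y0 /e; lra.
  have y2 : 0 < rnorm y ^+ 2 by rewrite exprn_gt0// lt_neqAle eq_sym y0 rnorm_ge0.
  have := key (- (e / rnorm y ^+ 2)).
  have -> : 2 * - (e / rnorm y ^+ 2) * e + (- (e / rnorm y ^+ 2)) ^+ 2 * rnorm y ^+ 2
      = - (e ^+ 2 / rnorm y ^+ 2) by field.
  rewrite oppr_ge0 pmulr_lle0 ?invr_gt0// => h.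
  have : e ^+ 2 == 0 by rewrite eq_le h sqr_ge0.
  by rewrite sqrf_eq0 subr_eq0 => /eqP.
have rep p : D p -> p.2 = inner p.1 eta.
  case: p => y d Dp /=; have h1 := rerep _ _ Dp.
  (* The real part at the multiple by 'i is the imaginary part up to sign. *)
  have := rerep _ _ (DZ 'i _ Dp); rewrite innerZr conjCi.
  rewrite (innerC eta y) in h1 *; rewrite -complexiE -[_ *: d]/(_ * d).
  move: h1; case: d {Dp} => a b; case: (inner eta y) => a' b' /= -> h.
  by congr (Complex _ _); lra.
exists eta; split => //; last first.
  by move=> A cA DA; apply: closed_rcvg ueta => // n; apply: DA; case: (hu n).
have [->|e0] := eqVneq (rnorm eta) 0; first by [].
have ep : 0 < rnorm eta by rewrite lt_neqAle eq_sym e0 rnorm_ge0.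
rewrite -(ler_pM2r ep) -expr2; apply/ler_addgt0Pr => d d0.
(* [eta] may fail to be a first coordinate of [D], so |eta|^2 <= C |eta| is tested on a nearby
   [p.1]; this costs at most r (C + |eta|) <= d. *)
have K0 : 0 < C + rnorm eta + 1 by rewrite ltr_wpDl// addr_ge0// ltW.
have [N /(_ N (leqnn N)) hN] := ueta _ (divr_gt0 d0 K0).
move: hN; set p := u N; set r := d / _ => hN.
have r0 : 0 <= r by rewrite divr_ge0// ltW.
have h1 : rnorm p.1 <= rnorm eta + r.
  by have := rnormD (p.1 - eta) eta; rewrite subrK; lra.
have h2 : Re (inner p.1 eta) <= C * rnorm p.1.
  rewrite -rep; last by case: (hu N).
  by apply: le_trans (Re_le_norm _) (Dbnd _ _); case: (hu N).
have h3 : Re (inner (eta - p.1) eta) <= r * rnorm eta.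
  apply: le_trans (Re_le_norm _) (le_trans (rnorm_inner _ _) _).
  by rewrite ler_wpM2r ?rnorm_ge0// rnorm_distC ltW.
have h4 : C * rnorm p.1 <= C * (rnorm eta + r) by rewrite ler_wpM2l.
have h5 : r * (C + rnorm eta + 1) = d by rewrite divfK// gt_eqF.
move: h3; rewrite innerBl ReB inner_rnorm /=; nra.
Qed.

End Riesz.

Section LimitAlgebra.
Context {R : realType} {V : normedModType R[i]}.
Implicit Types (u v : nat -> V) (l m : V).

Lemma rcvg_cst l : rcvg (fun=> l) l.
Proof. by move=> e e0; exists 0%N => n _; rewrite subrr rnorm0. Qed.

Lemma rcvgD u v l m : rcvg u l -> rcvg v m -> rcvg (fun n => u n + v n) (l + m).
Proof.
move=> ul vm e e0; have e2 : 0 < e / 2 by rewrite divr_gt0.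
have [N hN] := ul _ e2; have [M hM] := vm _ e2.
exists (maxn N M) => n; rewrite geq_max => /andP[/hN hn /hM hm].
by rewrite opprD addrACA (splitr e); apply: le_lt_trans (rnormD _ _) _; rewrite ltrD.
Qed.

Lemma rcvgZ (z : R[i]) u l : rcvg u l -> rcvg (fun n => z *: u n) (z *: l).
Proof.
move=> ul e e0; have z0 : 0 <= Re `|z| by rewrite -ler0c -Re_normE.
have c1 : 0 < Re `|z| + 1 by rewrite ltr_wpDl.
have [N hN] := ul _ (divr_gt0 e0 c1); exists N => n /hN.
rewrite -scalerBr rnormZc ltr_pdivlMr// => /(le_lt_trans _); apply.
by rewrite mulrC ler_wpM2l ?rnorm_ge0// lerDl.
Qed.

End LimitAlgebra.

Section ComplexLimits.
Context {R : realType}.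
Implicit Types (u : nat -> R[i]^o).

Lemma rcvg_conj u l : rcvg u l -> rcvg (fun n => (u n)^* : R[i]^o) (l^*).
Proof.
move=> ul e e0; have [N hN] := ul _ e0; exists N => n /hN.
by rewrite -rmorphB /rnorm norm_conjC.
Qed.

Lemma rcvg_Re_le u l (c : R) : (exists N, forall n, (N <= n)%N -> Re (u n) <= c) ->
  rcvg u l -> Re l <= c.
Proof.
move=> [M hM] ul; apply/ler_addgt0Pr => e e0; have [N hN] := ul _ e0.
have := hM _ (leq_maxr N M); have := hN _ (leq_maxl N M); set n := maxn N M.
have := Re_le_norm (l - u n); rewrite ReB -/(rnorm (l - u n : R[i]^o)) rnorm_distC; lra.
Qed.

Lemma complex_rcauchy_cvg u : rcauchy u -> exists l, rcvg u l.
Proof.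
have real (a : nat -> R) : (forall e, 0 < e -> exists N, forall n m, (N <= n)%N ->
    (N <= m)%N -> `|a n - a m| < e) ->
    exists l, forall e, 0 < e -> exists N, forall n, (N <= n)%N -> `|a n - l| < e.
  move=> ca; have /cauchy_cvgP/cvg_ex[l /cvgrPdist_lt al] : cauchy ((a : nat -> R^o) @ \oo).
    apply: cauchy_exP => e e0; have [N hN] := ca _ e0.
    exists (a N), N => // n /= Nn.
    by rewrite -ball_normE /=; apply: hN.
  exists l => e /al[N _ hN]; exists N => n /hN; rewrite distrC; exact.
move=> cu.
have Rle z : `|Re z| <= rnorm (z : R[i]^o).
  by rewrite -lecR -rnormE normc_ge_Re.
have Ile z : `|Im z| <= rnorm (z : R[i]^o).
  have := Rle ('i * z); rewrite /rnorm normrM normCi mul1r; apply: le_trans.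
  by case: z => a b; rewrite -complexiE /= mul0r mul1r sub0r normrN.
have [|a ha] := real (fun n => Re (u n)).
  move=> e e0; have [N hN] := cu _ e0; exists N => n m Nn Nm.
  by rewrite -ReB; apply: le_lt_trans (Rle _) (hN _ _ Nn Nm).
have [|b hb] := real (fun n => Im (u n)).
  move=> e e0; have [N hN] := cu _ e0; exists N => n m Nn Nm.
  have <- : Im (u n - u m) = Im (u n) - Im (u m) by rewrite raddfB.
  exact: le_lt_trans (Ile _) (hN _ _ Nn Nm).
exists (Complex a b) => e e0; have e2 : 0 < e / 2 by rewrite divr_gt0.
have [N hN] := ha _ e2; have [M hM] := hb _ e2.
exists (maxn N M) => n; rewrite geq_max => /andP[/hN hn /hM hm].
have -> : u n - Complex a b = (Re (u n) - a)%:C + 'i * (Im (u n) - b)%:C.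
  rewrite -complexiE; case: (u n) => c d; apply/eqP.
  by rewrite eq_complex /= !(mul0r, mul1r, addr0, add0r, subr0, mulr0) !eqxx.
apply: le_lt_trans (rnormD _ _) _; rewrite (splitr e) ltrD//.
  by rewrite /rnorm normr_real_complex.
by rewrite /rnorm normrM normCi mul1r normr_real_complex.
Qed.

End ComplexLimits.

(** * Completion for a semidefinite form *)

Section Completion.
Context {R : realType} {E : lmodType R[i]} {s : E -> E -> R[i]} (hs : psd_form s).
Implicit Types (x y : nat -> E) (g h : E -> R[i]^o).

Local Notation snorm := (@seminorm R E s).

Definition scauchy x := forall e : R, 0 < e -> exists N, forall n m,
  (N <= n)%N -> (N <= m)%N -> snorm (x n - x m) < e.

Definition snull x := forall e : R, 0 < e -> exists N, forall n, (N <= n)%N -> snorm (x n) < e.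

Lemma snorm0 : snorm 0 = 0.
Proof. by rewrite /seminorm /sqn (psd0l hs) sqrtr0. Qed.

Lemma scauchy_bounded x : scauchy x -> exists2 K, 0 < K & forall n, snorm (x n) <= K.
Proof.
move=> /(_ 1 ltr01)[N hN].
have [K hK] : exists K, forall n, (n <= N)%N -> snorm (x n) <= K.
  elim: N {hN} => [|N [K hK]].
    by exists (snorm (x 0%N)) => n; rewrite leqn0 => /eqP ->.
  exists (K + snorm (x N.+1)) => n; rewrite leq_eqVlt => /predU1P[->|/hK h].
    by rewrite lerDr; apply: le_trans (hK 0%N _) => //; exact: seminorm_ge0.
  by have := @seminorm_ge0 _ _ s (x N.+1); lra.
have K0 : 0 <= K by apply: le_trans (@seminorm_ge0 _ _ s _) (hK 0%N _).
exists (K + 1) => [|n]; first by lra.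
have [/hK|/ltnW Nn] := leqP n N; first by lra.
have := hN _ _ Nn (leqnn N); have := hK _ (leqnn N).
have := seminormD hs (x n - x N) (x N); rewrite subrK; lra.
Qed.

Lemma scauchyD (z : R[i]) x y : scauchy x -> scauchy y -> scauchy (fun n => z *: x n + y n).
Proof.
move=> cx cy e e0; have z0 : 0 <= Re `|z| by rewrite -ler0c -Re_normE.
have c1 : 0 < Re `|z| + 1 by rewrite ltr_wpDl.
have e2 : 0 < e / 2 by rewrite divr_gt0.
have [N hN] := cx _ (divr_gt0 e2 c1); have [M hM] := cy _ e2.
exists (maxn N M) => n m; rewrite !geq_max => /andP[Nn Mn] /andP[Nm Mm].
rewrite opprD addrACA -scalerBr; apply: le_lt_trans (seminormD hs _ _) _.
rewrite (splitr e) ltr_leD// ?(ltW (hM _ _ Mn Mm))// (seminormZ hs).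
have := hN _ _ Nn Nm; rewrite ltr_pdivlMr// => /(le_lt_trans _); apply.
by rewrite mulrC ler_wpM2l ?seminorm_ge0// lerDl.
Qed.

Lemma scauchy_cst a : scauchy (fun=> a).
Proof. by move=> e e0; exists 0%N => n m _ _; rewrite subrr snorm0. Qed.

Lemma s_dist a a' b b' :
  rnorm (s a b - s a' b' : R[i]^o) <= snorm (a - a') * snorm b + snorm a' * snorm (b - b').
Proof.
have -> : s a b - s a' b' = s (a - a') b + s a' (b - b').
  by rewrite (psdBl hs) (psdBr hs) addrA subrK.
by apply: le_trans (rnormD _ _) _; rewrite lerD//; exact: psd_le_seminorm.
Qed.

Lemma scauchy_form x y : scauchy x -> scauchy y -> rcauchy (fun n => s (x n) (y n) : R[i]^o).
Proof.
move=> cx cy e e0.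
have [K K0 hK] := scauchy_bounded cx; have [L L0 hL] := scauchy_bounded cy.
have e2 : 0 < e / 2 by rewrite divr_gt0.
have [N hN] := cx _ (divr_gt0 e2 L0); have [M hM] := cy _ (divr_gt0 e2 K0).
exists (maxn N M) => n m; rewrite !geq_max => /andP[Nn Mn] /andP[Nm Mm].
apply: le_lt_trans (s_dist _ _ _ _) _; rewrite (splitr e) ltrD//.
  have := hN _ _ Nn Nm; rewrite ltr_pdivlMr// => /(le_lt_trans _); apply.
  by rewrite ler_wpM2l ?seminorm_ge0.
have := hM _ _ Mn Mm; rewrite ltr_pdivlMr// mulrC => /(le_lt_trans _); apply.
by rewrite ler_wpM2r ?seminorm_ge0.
Qed.

Definition represented_by g x :=
  scauchy x /\ forall a, rcvg (fun n => s (x n) a : R[i]^o) (g a).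

(** s(x n, x n) = s(x n, x n - x N) + s(x n, x N), small by the Cauchy property and then by weak
    nullity. Hence the function lim s(x n, .) determines [x] up to a null sequence and can replace
    its class in a quotient. *)
Lemma scauchy_weak_null x : scauchy x -> (forall a, rcvg (fun n => s (x n) a : R[i]^o) 0) ->
  snull x.
Proof.
move=> cx x0 e e0; have [K K0 hK] := scauchy_bounded cx.
have e2 : 0 < e ^+ 2 / 2 by rewrite divr_gt0 ?exprn_gt0.
have [N hN] := cx _ (divr_gt0 e2 K0); have [M hM] := x0 (x N) _ e2.
exists (maxn N M) => n; rewrite geq_max => /andP[Nn Mn].
rewrite -(@ltr_pXn2r _ 2)// ?nnegrE ?seminorm_ge0 ?ltW// (sqr_seminorm hs).
have -> : sqn (s := s) (x n) = Re (s (x n) (x n - x N)) + Re (s (x n) (x N)).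
  by rewrite (psdBr hs) ReB subrK.
have h1 : Re (s (x n) (x N)) < e ^+ 2 / 2.
  by apply: le_lt_trans (Re_le_norm _) _; have := hM _ Mn; rewrite subr0.
have h2 : Re (s (x n) (x n - x N)) <= e ^+ 2 / 2.
  apply: le_trans (Re_le_norm _) (le_trans (psd_le_seminorm hs _ _) _).
  have := ltW (hN _ _ Nn (leqnn N)); rewrite ler_pdivlMr// mulrC; apply: le_trans.
  by rewrite ler_wpM2r ?seminorm_ge0.
lra.
Qed.

Lemma represented_null g x x' : represented_by g x -> represented_by g x' ->
  snull (fun n => x n - x' n).
Proof.
move=> [cx gx] [cx' gx']; apply: scauchy_weak_null => [|a].
  have := scauchyD (-1) cx' cx; congr scauchy; apply/funext => n.
  by rewrite scaleN1r addrC.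
have := rcvgD (gx a) (rcvgZ (-1) (gx' a)); rewrite scaleN1r subrr.
by apply: eq_rcvg => n; rewrite scaleN1r -(psdBl hs).
Qed.

Definition compl_pred : {pred E -> R[i]^o} := fun g => `[< exists x, represented_by g x >].

Lemma compl_submod : GRing.submod_closed compl_pred.
Proof.
split=> [|z g h /asboolP[x [cx gx]] /asboolP[y [cy hy]]].
  apply/asboolP; exists (fun=> 0); split; first exact: scauchy_cst.
  by move=> a; apply: eq_rcvg (rcvg_cst 0) => n; rewrite (psd0l hs).
apply/asboolP; exists (fun n => z *: x n + y n); split; first exact: scauchyD.
move=> a; apply: eq_rcvg (rcvgD (rcvgZ z (gx a)) (hy a)) => n.
by rewrite (psdDl hs) (psdZl hs).
Qed.

End Completion.

(* The completion of [E] for [s] as a space of functions on [E]: a Cauchy sequence [x]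
   becomes the function [a |-> lim s (x n) a]. *)
Record compl {R : realType} {E : lmodType R[i]} {s : E -> E -> R[i]} (hs : psd_form s) :=
  Compl { compl_fun :> E -> R[i]^o; _ : compl_fun \in @compl_pred R E s }.

Section CompletionSpace.
Context {R : realType} {E : lmodType R[i]} {s : E -> E -> R[i]} (hs : psd_form s).

Local Notation snorm := (@seminorm R E s).

HB.instance Definition _ := [isSub for @compl_fun R E s hs].
HB.instance Definition _ := [Choice of compl hs by <:].
HB.instance Definition _ := GRing.isSubmodClosed.Build R[i] (E -> R[i]^o)
  (@compl_pred R E s) (GRing.submod_closed_semi (compl_submod hs)).
HB.instance Definition _ := [SubChoice_isSubLmodule of compl hs by <:].

Implicit Types (g h : compl hs) (x y : nat -> E).

Lemma complP g h : g =1 h -> g = h.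
Proof. by move=> gh; apply/val_inj/funext. Qed.

Lemma compl_predP (f : E -> R[i]^o) x : represented_by (s := s) f x -> f \in @compl_pred R E s.
Proof. by move=> fx; apply/asboolP; exists x. Qed.

Lemma compl_ex g : exists x, represented_by (s := s) g x.
Proof. by case: g => g /= /asboolP. Qed.

Let cseq g := sval (cid (compl_ex g)).
Let cseqP g : represented_by (s := s) g (cseq g) := svalP (cid (compl_ex g)).

Let ip_ex g h : exists c, rcvg (fun n => s (cseq g n) (cseq h n) : R[i]^o) c.
Proof. by apply/complex_rcauchy_cvg/(scauchy_form hs); [case: (cseqP g)|case: (cseqP h)]. Qed.

Definition compl_ip g h : R[i] := sval (cid (ip_ex g h)).

Lemma compl_ipP g h x y : represented_by (s := s) g x -> represented_by (s := s) h y ->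
  rcvg (fun n => s (x n) (y n) : R[i]^o) (compl_ip g h).
Proof.
move=> gx hy; have := svalP (cid (ip_ex g h)); rewrite -/(compl_ip g h) => lim.
have [K K0 hK] := scauchy_bounded hs (cseqP g).1.
have [L L0 hL] := scauchy_bounded hs hy.1.
have nx := represented_null hs gx (cseqP g); have ny := represented_null hs hy (cseqP h).
move=> e e0; have e4 : 0 < e / 4 by rewrite divr_gt0.
have [N hN] := nx _ (divr_gt0 e4 L0); have [M hM] := ny _ (divr_gt0 e4 K0).
have [P hP] := lim _ (divr_gt0 e0 (ltr0n _ 2)).
exists (maxn P (maxn N M)) => n; rewrite !geq_max => /and3P[Pn Nn Mn].
apply: le_lt_trans (rnorm_dist (s (cseq g n) (cseq h n) : R[i]^o) _ _) _.
rewrite (splitr e) ltrD ?hP//; apply: le_lt_trans (s_dist hs _ _ _ _) _.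
have h1 : snorm (x n - cseq g n) * snorm (y n) < e / 4.
  have := hN _ Nn; rewrite ltr_pdivlMr// => /(le_lt_trans _); apply.
  by rewrite ler_wpM2l ?seminorm_ge0.
have h2 : snorm (cseq g n) * snorm (y n - cseq h n) < e / 4.
  have := hM _ Mn; rewrite ltr_pdivlMr// mulrC => /(le_lt_trans _); apply.
  by rewrite ler_wpM2r ?seminorm_ge0.
lra.
Qed.

Lemma representedD (z : R[i]) g h x y : represented_by (s := s) g x ->
  represented_by (s := s) h y -> represented_by (s := s) (z *: g + h) (fun n => z *: x n + y n).
Proof.
move=> [cx gx] [cy hy]; split; first exact: scauchyD.
move=> a; apply: eq_rcvg (rcvgD (rcvgZ z (gx a)) (hy a)) => n.
by rewrite (psdDl hs) (psdZl hs).
Qed.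

Lemma compl_psd : psd_form compl_ip.
Proof.
split=> [z g g' h|g h|g].
- have gz := representedD z (cseqP g) (cseqP g').
  apply: rcvg_unique (compl_ipP gz (cseqP h)) _.
  have := rcvgD (rcvgZ z (compl_ipP (cseqP g) (cseqP h))) (compl_ipP (cseqP g') (cseqP h)).
  by apply: eq_rcvg => n; rewrite (psdDl hs) (psdZl hs).
- apply: rcvg_unique (compl_ipP (cseqP h) (cseqP g)) _.
  apply: eq_rcvg (rcvg_conj (compl_ipP (cseqP g) (cseqP h))) => n.
  by rewrite -(psdC hs).
- have lim := compl_ipP (cseqP g) (cseqP g).
  have re : (compl_ip g g)^* = compl_ip g g.
    apply: rcvg_unique (rcvg_conj lim) _; apply: eq_rcvg lim => n.
    by rewrite -(psdC hs).
  rewrite (conj_eq_Re re) ler0c -oppr_le0 -ReN.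
  have := rcvgZ (-1) lim; rewrite scaleN1r => limN.
  apply: (rcvg_Re_le _ limN); exists 0%N => n _.
  by rewrite scaleN1r ReN oppr_le0 -ler0c -(sqnE hs) psd_ge0.
Qed.

Lemma emb_represented (a : E) : represented_by (s := s) (s a) (fun=> a).
Proof. by split; [exact: scauchy_cst|move=> b; exact: rcvg_cst]. Qed.

Definition emb (a : E) : compl hs := Compl hs (compl_predP (emb_represented a)).

(** The reproducing property; with Cauchy-Schwarz it yields definiteness. *)
Lemma compl_ip_emb g a : compl_ip g (emb a) = g a.
Proof.
have := compl_ipP (cseqP g) (emb_represented a : represented_by (emb a) _).
by move=> /rcvg_unique; apply; case: (cseqP g) => _; apply.
Qed.

Lemma compl_definite g : compl_ip g g = 0 -> g = 0.
Proof.
move=> g0; apply: complP => a; apply: (@rnorm_eq0 _ R[i]^o); apply/eqP.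
have := cauchy_schwarz compl_psd g (emb a); rewrite compl_ip_emb.
rewrite [X in _ <= X * _](_ : _ = 0) ?mul0r; last by rewrite /sqn g0.
by move=> h; rewrite -sqrf_eq0 eq_le h sqr_ge0.
Qed.

Local Notation W := (ipspace compl_psd compl_definite).

Lemma rnorm_compl_le (g : W) x (c : R) : represented_by (s := s) (g : compl hs) x -> 0 <= c ->
  (exists N, forall n, (N <= n)%N -> snorm (x n) <= c) -> rnorm g <= c.
Proof.
move=> gx c0 [N hN]; rewrite -(@ler_pXn2r _ 2)// ?nnegrE ?rnorm_ge0//.
rewrite ipspace_rnorm (sqr_seminorm compl_psd).
apply: (rcvg_Re_le _ (compl_ipP gx gx)); exists N => n /hN h.
by rewrite -/(sqn (s := s) (x n)) -(sqr_seminorm hs) ler_pXn2r// nnegrE seminorm_ge0.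
Qed.

Lemma rnorm_emb a : rnorm (emb a : W) = snorm a.
Proof. by rewrite ipspace_rnorm /seminorm /sqn compl_ip_emb. Qed.

Lemma emb_dense (g : W) x : represented_by (s := s) (g : compl hs) x ->
  rcvg (fun n => emb (x n) : W) g.
Proof.
move=> gx e e0; have [N hN] := gx.1 _ (divr_gt0 e0 (ltr0n _ 2)).
exists N => n Nn; rewrite rnorm_distC; apply: (@le_lt_trans _ _ (e / 2)); last by lra.
apply: (@rnorm_compl_le _ (fun m => (-1) *: x n + x m)).
- have -> : g - emb (x n) = (-1) *: emb (x n) + g by rewrite scaleN1r addrC.
  exact: (@representedD (-1) (emb (x n)) g _ _ (emb_represented _) gx).
- by lra.
- exists N => m Nm; rewrite scaleN1r addrC ltW//; exact: hN.
Qed.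

Lemma compl_complete (u : nat -> W) : rcauchy u -> exists l, rcvg u l.
Proof.
move=> cu.
(* A diagonal choice by density: [a] is Cauchy in [E] and defines the limit of [u]. *)
have /choice[a ha] n : exists a : E, rnorm (u n - emb a) < n.+1%:R^-1.
  have [x ux] := compl_ex (u n); have [|N hN] := emb_dense ux (e := n.+1%:R^-1).
    by rewrite invr_gt0.
  by exists (x N); rewrite rnorm_distC; apply: hN.
have embB b c : emb (b - c) = (emb b : W) - emb c.
  by apply: complP => d; rewrite -[RHS]/(s b d - s c d) -(psdBl hs).
have ca : scauchy (s := s) a.
  move=> e e0; have e3 : 0 < e / 3 by rewrite divr_gt0.
  have [N hN] := cu _ e3; have [M hM] := invS_small e3.
  exists (maxn N M) => n m; rewrite !geq_max => /andP[Nn Mn] /andP[Nm Mm].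
  have t1 : rnorm (emb (a n) - u n : W) < e / 3.
    by rewrite rnorm_distC; apply: lt_trans (ha n) (hM _ Mn).
  have t2 : rnorm (u n - emb (a m) : W) < e / 3 + e / 3.
    apply: le_lt_trans (rnorm_dist (u m) _ _) _.
    by apply: ltrD; [exact: hN|apply: lt_trans (ha m) (hM _ Mm)].
  have -> : e = e / 3 + (e / 3 + e / 3) by field.
  rewrite -rnorm_emb embB; apply: le_lt_trans (rnorm_dist (u n) _ _) _.
  exact: ltrD.
have /choice[g hg] b : exists c, rcvg (fun n => s (a n) b : R[i]^o) c.
  exact/complex_rcauchy_cvg/(scauchy_form hs)/scauchy_cst.
have ga : represented_by (s := s) g a by [].
pose l : W := Compl hs (compl_predP ga); exists l => e e0.
have e2 : 0 < e / 2 by rewrite divr_gt0.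
have [N hN] := emb_dense (g := l) ga e2; have [M hM] := invS_small e2.
exists (maxn N M) => n; rewrite geq_max => /andP[Nn Mn].
rewrite (splitr e); apply: le_lt_trans (rnorm_dist (emb (a n) : W) _ _) _.
apply: ltrD; [exact: lt_trans (ha n) (hM _ Mn)|exact: hN].
Qed.

Definition completion : hilbertType R := hspace compl_complete.

End CompletionSpace.

(** * Representations *)

Section Blin.
Context {R : realType} {V W : normedModType R[i]}.

Lemma rnorm_bound (f : V -> W) (M : R) : (forall x, rnorm (f x) <= M * rnorm x) ->
  forall x, `|f x| <= M%:C * `|x|.
Proof. by move=> h x; rewrite !rnormE -rmorphM lecR. Qed.

Lemma blin_rnorm (f : blin V W) x : rnorm (f x) <= rnorm f * rnorm x.
Proof. by rewrite -lecR rmorphM/= -!rnormE; exact: le_onorm. Qed.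

Lemma rcvg_blin (f : blin V W) u l : rcvg u l -> rcvg (f \o u) (f l).
Proof.
move=> ul e e0; have c1 : 0 < rnorm f + 1 by rewrite ltr_wpDl ?rnorm_ge0.
have [N hN] := ul _ (divr_gt0 e0 c1); exists N => n /hN.
rewrite ltr_pdivlMr// => /(le_lt_trans _); apply; rewrite /= -linearB.
by apply: le_trans (blin_rnorm _ _) _; rewrite mulrC ler_wpM2l ?rnorm_ge0// lerDl.
Qed.

End Blin.

Section StarMulBound.
Context {R : realType} {B : cstarAlgType R}.

(* [K - b^* b] is a square for [K > |b|^2], so no positive form sees more of
   [b^* b] than [|b|^2]. *)
Lemma star_mul_complement (b : B) (K : R) : rnorm b ^+ 2 < K ->
  exists v : B, selfadj v /\ v * v = 1 - K^-1 *:: (star b * b).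
Proof.
move=> bK; have K0 : 0 < K := le_lt_trans (sqr_ge0 _) bK.
have [||v [sv vv _]] := @sqrt_one_sub R B (K^-1 *:: (star b * b)).
- exact/selfadjZ/selfadj_starM.
- by rewrite rnormZ gtr0_norm ?invr_gt0// rnorm_sq ltr_pdivrMl// mulr1.
by exists v.
Qed.

End StarMulBound.

Section Representation.
Context {R : realType} {B : cstarAlgType R} {H : hilbertType R}.
Context (pi : @star_representation R B H).

Lemma rep_inner a x y : inner (pi a x) y = inner x (pi (star a) y).
Proof. exact: rep_star. Qed.

(** 0 <= |pi v x|^2 = |x|^2 - |pi b x|^2 / K for the root [v] of [star_mul_complement], with K
    decreasing to |b|^2. *)
Lemma rep_contractive b x : rnorm (pi b x) <= rnorm b * rnorm x.
Proof.
rewrite -(@ler_pXn2r _ 2)// ?nnegrE ?mulr_ge0 ?rnorm_ge0// exprMn.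
apply/ler_addgt0Pr => e e0.
pose d := e / (rnorm x ^+ 2 + 1); pose K := rnorm b ^+ 2 + d.
have x1 : 0 < rnorm x ^+ 2 + 1 by rewrite ltr_wpDl ?sqr_ge0.
have d0 : 0 < d by rewrite divr_gt0.
have bK : rnorm b ^+ 2 < K by rewrite ltrDl.
have K0 : 0 < K := le_lt_trans (sqr_ge0 _) bK.
have [v [sv vv]] := star_mul_complement bK.
have h : (rnorm (pi v x) ^+ 2)%:C = (rnorm x ^+ 2 - K^-1 * rnorm (pi b x) ^+ 2)%:C.
  have piv (c : B) : pi (1 - K^-1 *:: c) x = x - (K^-1)%:C *: pi c x.
    by rewrite linearB /rscale linearZ -[LHS]/(pi 1 x - _ *: pi c x) rep1.
  rewrite -inner_rnorm rep_inner sv -repM vv piv innerBr innerZr repM inner_rnorm.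
  rewrite -rep_inner inner_rnorm rmorphB/=.
  by rewrite conj_realc -rmorphM.
move/complexI : h => h; have := sqr_ge0 (rnorm (pi v x)); rewrite h subr_ge0.
rewrite ler_pdivrMl// => /le_trans; apply; rewrite mulrDl lerD2l.
by rewrite /d mulrAC ler_pdivrMr//; apply: ler_wpM2l; [exact: ltW|rewrite lerDl].
Qed.

Lemma rcvg_rep (x : H) u (l : B) : rcvg u l -> rcvg (fun n => pi (u n) x) (pi l x).
Proof.
move=> ul e e0; have c1 : 0 < rnorm x + 1 by rewrite ltr_wpDl ?rnorm_ge0.
have [N hN] := ul _ (divr_gt0 e0 c1); exists N => n /hN.
rewrite ltr_pdivlMr// => /(le_lt_trans _); apply.
have -> : pi (u n) x - pi l x = pi (u n - l) x by rewrite linearB.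
by apply: le_trans (rep_contractive _ _) _; rewrite ler_wpM2l ?rnorm_ge0// lerDl.
Qed.

Lemma vector_functional_linear (x y : H) : linear (fun b => inner (pi b x) y : R[i]^o).
Proof.
move=> z a b; rewrite linearD linearZ/= -[X in inner X](_ : z *: pi a x + pi b x = _)//.
by rewrite innerDl innerZl.
Qed.

Lemma vector_functional_bound (x y : H) b :
  rnorm (inner (pi b x) y : R[i]^o) <= rnorm x * rnorm y * rnorm b.
Proof.
apply: le_trans (rnorm_inner _ _) _; rewrite mulrAC ler_wpM2r ?rnorm_ge0// mulrC.
exact: rep_contractive.
Qed.

Definition vector_functional (x y : H) : dual B :=
  mkblin (vector_functional_linear x y) (rnorm_bound (vector_functional_bound x y)).

Lemma vector_functional_state (x : H) : rnorm x = 1 -> state (vector_functional x x).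
Proof.
move=> x1; split=> [|a] /=; first by rewrite rep1 inner_rnorm x1 expr1n.
by rewrite repM rep_inner starK inner_rnorm ler0c sqr_ge0.
Qed.

End Representation.

(** * Direct sums of Hilbert spaces and of representations *)

Section DirectSum.
Context {R : realType}.

Definition sum_form (H K : hilbertType R) (p q : H * K) : R[i] :=
  inner p.1 q.1 + inner p.2 q.2.

Lemma sum_form_psd (H K : hilbertType R) : psd_form (@sum_form H K).
Proof.
split=> [z p p' q|p q|p]; rewrite /sum_form /=.
- by rewrite !innerDl !innerZl mulrDr addrACA.
- by rewrite rmorphD/= -!innerC.
- by rewrite !inner_rnorm -rmorphD ler0c addr_ge0 ?sqr_ge0.
Qed.

Lemma sum_form_definite (H K : hilbertType R) (p : H * K) : sum_form p p = 0 -> p = 0.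
Proof.
case: p => x y; rewrite /sum_form /= !inner_rnorm -rmorphD => /complexI /eqP.
rewrite paddr_eq0 ?sqr_ge0// !sqrf_eq0 => /andP[/eqP/rnorm_eq0 -> /eqP/rnorm_eq0 ->//].
Qed.

Section Complete.
Context (H K : hilbertType R).
Local Notation W := (ipspace (@sum_form_psd H K) (@sum_form_definite H K)).

Lemma rnorm_sum (p : W) :
  rnorm p ^+ 2 = rnorm (p : H * K)%type.1 ^+ 2 + rnorm (p : H * K)%type.2 ^+ 2.
Proof.
rewrite ipspace_rnorm (sqr_seminorm (@sum_form_psd H K)) /sqn /sum_form.
by rewrite !inner_rnorm.
Qed.

Lemma rnorm_sum_fst (p : W) : rnorm (p : H * K)%type.1 <= rnorm p.
Proof.
by rewrite -(@ler_pXn2r _ 2)// ?nnegrE ?rnorm_ge0// rnorm_sum lerDl sqr_ge0.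
Qed.

Lemma rnorm_sum_snd (p : W) : rnorm (p : H * K)%type.2 <= rnorm p.
Proof.
by rewrite -(@ler_pXn2r _ 2)// ?nnegrE ?rnorm_ge0// rnorm_sum lerDr sqr_ge0.
Qed.

Lemma rnorm_sum_le (p : W) : rnorm p <= rnorm (p : H * K)%type.1 + rnorm (p : H * K)%type.2.
Proof.
rewrite -(@ler_pXn2r _ 2)// ?nnegrE ?addr_ge0 ?rnorm_ge0// rnorm_sum sqrrD.
by rewrite lerD2r lerDl mulrn_wge0// mulr_ge0 ?rnorm_ge0.
Qed.

Lemma sum_complete (u : nat -> W) : rcauchy u -> exists l, rcvg u l.
Proof.
move=> cu.
have [x ux] : exists x, rcvg (fun n => (u n : H * K)%type.1) x.
  apply: rcauchy_cvg => e /cu[N hN]; exists N => n m Nn Nm.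
  exact: le_lt_trans (rnorm_sum_fst (u n - u m)) (hN _ _ Nn Nm).
have [y uy] : exists y, rcvg (fun n => (u n : H * K)%type.2) y.
  apply: rcauchy_cvg => e /cu[N hN]; exists N => n m Nn Nm.
  exact: le_lt_trans (rnorm_sum_snd (u n - u m)) (hN _ _ Nn Nm).
pose l : W := (x, y); exists l => e e0; have e2 : 0 < e / 2 by rewrite divr_gt0.
have [N hN] := ux _ e2; have [M hM] := uy _ e2.
exists (maxn N M) => n; rewrite geq_max => /andP[/hN hn /hM hm].
by apply: le_lt_trans (rnorm_sum_le _) _; rewrite (splitr e) ltrD.
Qed.

End Complete.

(** The alias replaces the maximum norm of the product by the norm of [sum_form]. *)
Definition dsum (H K : hilbertType R) : hilbertType R := hspace (@sum_complete H K).

Definition dpair {H K : hilbertType R} (x : H) (y : K) : dsum H K := (x, y).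
Definition dfst {H K : hilbertType R} (p : dsum H K) : H := (p : (H * K)%type).1.
Definition dsnd {H K : hilbertType R} (p : dsum H K) : K := (p : (H * K)%type).2.

Lemma dsumE {H K : hilbertType R} (p : dsum H K) : p = dpair (dfst p) (dsnd p).
Proof. by case: p. Qed.

Lemma inner_dsum {H K : hilbertType R} (p q : dsum H K) :
  inner p q = inner (dfst p) (dfst q) + inner (dsnd p) (dsnd q).
Proof. by []. Qed.

Lemma inner_dpair {H K : hilbertType R} (x x' : H) (y y' : K) :
  inner (dpair x y) (dpair x' y') = inner x x' + inner y y'.
Proof. by []. Qed.

Lemma dfst_linear (H K : hilbertType R) : linear (@dfst H K). Proof. by []. Qed.
Lemma dsnd_linear (H K : hilbertType R) : linear (@dsnd H K). Proof. by []. Qed.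

Lemma dfst_bound (H K : hilbertType R) (p : dsum H K) : rnorm (dfst p) <= 1 * rnorm p.
Proof. by rewrite mul1r; exact: rnorm_sum_fst. Qed.

Definition dproj (H K : hilbertType R) : blin (dsum H K) H :=
  mkblin (@dfst_linear H K) (rnorm_bound (@dfst_bound H K)).

Lemma dinj_linear (H K : hilbertType R) : linear (fun x : H => dpair x (0 : K)).
Proof.
move=> z x y; rewrite [RHS]dsumE; congr dpair.
by rewrite /dsnd /= scaler0 addr0.
Qed.

Lemma dinj_bound (H K : hilbertType R) (x : H) : rnorm (dpair x (0 : K)) <= 1 * rnorm x.
Proof. by rewrite mul1r; apply: le_trans (rnorm_sum_le _) _; rewrite /= rnorm0 addr0. Qed.

Definition dinj (H K : hilbertType R) : blin H (dsum H K) :=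
  mkblin (@dinj_linear H K) (rnorm_bound (@dinj_bound H K)).

Section Map.
Context {H K H' K' : hilbertType R}.

Definition dmap_fun (S : blin H H') (T : blin K K') (p : dsum H K) : dsum H' K' :=
  dpair (S (dfst p)) (T (dsnd p)).

Lemma dmap_linear S T : linear (dmap_fun S T).
Proof.
move=> z p q; rewrite [RHS]dsumE /dmap_fun; congr dpair.
  by rewrite [LHS]linearP.
by rewrite [LHS]linearP.
Qed.

Lemma dmap_bound S T p : rnorm (dmap_fun S T p) <= (rnorm S + rnorm T) * rnorm p.
Proof.
apply: le_trans (rnorm_sum_le _) _; rewrite mulrDl lerD//.
  apply: le_trans (blin_rnorm _ _) _; rewrite ler_wpM2l ?rnorm_ge0//.
  exact: rnorm_sum_fst.
apply: le_trans (blin_rnorm _ _) _; rewrite ler_wpM2l ?rnorm_ge0//.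
exact: rnorm_sum_snd.
Qed.

Definition dmap S T : blin (dsum H K) (dsum H' K') :=
  mkblin (dmap_linear S T) (rnorm_bound (dmap_bound S T)).

Lemma dmap_isometry S T : Defs.isometry S -> Defs.isometry T -> Defs.isometry (dmap S T).
Proof.
move=> iS iT p; rewrite !rnormE; congr (_ %:C); apply/eqP.
rewrite -(@eqrXn2 _ 2)// ?rnorm_ge0// !rnorm_sum /=.
by rewrite /rnorm iS iT.
Qed.

End Map.

Lemma dmap_adjoint (H K H' K' : hilbertType R) (S : blin H H') (T : blin K K') S' T' :
  adjoint S S' -> adjoint T T' -> adjoint (dmap S T) (dmap S' T').
Proof. by move=> aS aT p q; rewrite !inner_dsum /= aS aT. Qed.

Context {B : cstarAlgType R} {H K : hilbertType R}.
Context (pi : @star_representation R B H) (rho : @star_representation R B K).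

Definition dsum_rep_fun (b : B) : blin (dsum H K) (dsum H K) := dmap (pi b) (rho b).

Lemma dsum_rep_linear : linear dsum_rep_fun.
Proof.
move=> z a b; apply: blinP => p; rewrite [RHS]dsumE; congr dpair.
  by rewrite [pi _]linearP.
by rewrite [rho _]linearP.
Qed.

HB.instance Definition _ := GRing.isLinear.Build R[i] B (blin (dsum H K) (dsum H K)) *:%R
  dsum_rep_fun dsum_rep_linear.

Definition dsum_rep : @star_representation R B (dsum H K).
Proof.
refine (@StarRepresentation R B (dsum H K) dsum_rep_fun _ _ _).
- by move=> p; rewrite [RHS]dsumE; congr dpair; rewrite rep1.
- by move=> a b p; congr dpair; rewrite repM.
- by move=> a; apply: dmap_adjoint; apply: rep_star.
Defined.

Lemma dsum_repE b p : dsum_rep b p = dpair (pi b (dfst p)) (rho b (dsnd p)).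
Proof. by []. Qed.

End DirectSum.

(** * The GNS construction *)

Section GNS.
Context {R : realType} {B : cstarAlgType R} (phi : dual B) (sphi : state phi).

(** Positivity at a + z 1 makes z phi (star a) + conj(z) phi a real for every z; z = 1 compares the
    imaginary parts and z = 'i the real ones. *)
Lemma state_star a : phi (star a) = (phi a)^*.
Proof.
have phiD x y : phi (x + y) = phi x + phi y by rewrite linearD.
have key (z : R[i]) : z * phi (star a) + z^* * phi a = (z * phi (star a) + z^* * phi a)^*.
  have h : star (a + z *: (1 : B)) * (a + z *: (1 : B)) =
      star a * a + (z *: star a + z^* *: a) + (z^* * z) *: (1 : B).
    rewrite starD starZ star1 mulrDl !mulrDr -!scaleAr -!scaleAl !mulr1 mul1r.
    by rewrite scalerA (mulrC z) !addrA.
  set M := z * phi (star a) + z^* * phi a.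
  have e : phi (star (a + z *: (1 : B)) * (a + z *: (1 : B))) = phi (star a * a) + M + z^* * z.
    by rewrite h !phiD !dualZ sphi.1 mulr1.
  have := CrealP (ger0_real (sphi.2 (a + z *: (1 : B)))); rewrite e.
  clearbody M; rewrite !rmorphD /= (CrealP (ger0_real (sphi.2 a))) rmorphM /= conjCK.
  by rewrite (mulrC z) => /addIr/addrI.
have := key 1; have := key 'i; rewrite conjCi rmorph1 !mul1r -complexiE.
case: (phi (star a)) => u v; case: (phi a) => w t.
move=> /eqP; rewrite eq_complex /= => /andP[_ /eqP h1].
move=> /eqP; rewrite eq_complex /= => /andP[_ /eqP h2].
by congr (Complex _ _); lra.
Qed.

Definition gns_form (x y : B) : R[i] := phi (star y * x).

Lemma gns_psd : psd_form gns_form.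
Proof.
split=> [z x x' y|x y|x]; rewrite /gns_form.
- by rewrite mulrDr -scaleAr linearP.
- by rewrite -state_star starM starK.
- exact: sphi.2.
Qed.

Lemma gns_adj a x y : gns_form (a * x) y = gns_form x (star a * y).
Proof. by rewrite /gns_form starM starK mulrA. Qed.

(** The argument of [rep_contractive] at the level of the form, since the operators are constructed
    from this bound. *)
Lemma gns_mul_bound a x : @seminorm R B gns_form (a * x) <= rnorm a * @seminorm R B gns_form x.
Proof.
rewrite -(@ler_pXn2r _ 2)// ?nnegrE ?mulr_ge0 ?rnorm_ge0 ?seminorm_ge0//.
rewrite exprMn !(sqr_seminorm gns_psd); set N := sqn x.
have N0 : 0 <= N := sqn_ge0 gns_psd x.
apply/ler_addgt0Pr => e e0.
have N1 : 0 < N + 1 by rewrite ltr_wpDl.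
pose d := e / (N + 1); pose K := rnorm a ^+ 2 + d.
have d0 : 0 < d by rewrite divr_gt0.
have aK : rnorm a ^+ 2 < K by rewrite ltrDl.
have K0 : 0 < K := le_lt_trans (sqr_ge0 _) aK.
have [v [sv vv]] := star_mul_complement aK.
have : 0 <= @sqn R B gns_form (v * x) := sqn_ge0 gns_psd _.
have -> : @sqn R B gns_form (v * x) = N - K^-1 * @sqn R B gns_form (a * x).
  rewrite /N /sqn !gns_adj sv !mulrA vv mulrBl mul1r -rscaleAl.
  by rewrite (psdBr gns_psd) /rscale (psdZr gns_psd) conj_realc ReB ReZ.
rewrite subr_ge0 ler_pdivrMl// => /le_trans; apply; rewrite mulrDl lerD2l.
by rewrite /d mulrAC ler_pdivrMr//; apply: ler_wpM2l; [exact: ltW|rewrite lerDl].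
Qed.

Local Notation E := (compl gns_psd).
Local Notation H := (completion gns_psd).

Lemma gns_represented a (g : E) x : represented_by (s := gns_form) g x ->
  represented_by (s := gns_form) (fun y => g (star a * y)) (fun n => a * x n).
Proof.
move=> [cx gx]; split=> [e e0|y].
  have a1 : 0 < rnorm a + 1 by rewrite ltr_wpDl ?rnorm_ge0.
  have [N hN] := cx _ (divr_gt0 e0 a1); exists N => n m Nn Nm.
  have := hN _ _ Nn Nm; rewrite ltr_pdivlMr// -mulrBr => /(le_lt_trans _); apply.
  apply: le_trans (gns_mul_bound _ _) _; rewrite mulrC.
  by apply: ler_wpM2l; [exact: seminorm_ge0|rewrite lerDl].
by apply: eq_rcvg (gx (star a * y)) => n; rewrite gns_adj.
Qed.

Lemma gns_act_pred a (g : E) : (fun y => g (star a * y)) \in @compl_pred R B gns_form.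
Proof. by have [x /(gns_represented a)] := compl_ex g; exact: compl_predP. Qed.

(** [gns_adj] moves [a] to the argument, so left multiplication acts on functions without a choice
    of Cauchy sequence. *)
Definition gns_act a (g : E) : E := Compl gns_psd (gns_act_pred a g).

Lemma gns_act_linear a : linear (gns_act a : H -> H).
Proof. by move=> z g h; apply: complP => y. Qed.

Lemma gns_act_bound a (g : H) : rnorm (gns_act a g : H) <= rnorm a * rnorm g.
Proof.
have [x gx] := compl_ex (g : E).
have bnd e : 0 < e -> rnorm (gns_act a g : H) <= rnorm a * (rnorm g + e).
  move=> e0; apply: (rnorm_compl_le (gns_represented a gx : represented_by (gns_act a g) _)).
    by rewrite mulr_ge0 ?rnorm_ge0// addr_ge0 ?rnorm_ge0// ltW.
  have [N hN] := emb_dense gx e0; exists N => n Nn.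
  apply: le_trans (gns_mul_bound _ _) _; apply: ler_wpM2l; first exact: rnorm_ge0.
  rewrite -(rnorm_emb gns_psd) -[X in rnorm X](subrK (g : H)) addrC.
  by apply: le_trans (rnormD _ _) _; apply: lerD => //; apply/ltW/hN.
have a1 : 0 < rnorm a + 1 by rewrite ltr_wpDl ?rnorm_ge0.
apply/ler_addgt0Pr => e e0.
apply: le_trans (bnd _ (divr_gt0 e0 a1)) _; rewrite mulrDr; apply: lerD => //.
rewrite mulrCA; apply: ler_piMr; first exact: ltW.
by rewrite ler_pdivrMr// mul1r lerDl.
Qed.

Definition gns_op a : blin H H := mkblin (@gns_act_linear a) (rnorm_bound (@gns_act_bound a)).

Lemma gns_op_linear : linear gns_op.
Proof.
move=> z a b; apply: blinP => g; apply: complP => y.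
have [x [_ gx]] := compl_ex (g : E).
(* Elements of the completion are conjugate-linear functions, as limits of [gns_form (x n)]. *)
have gD c d : (g : E) (c + d) = (g : E) c + (g : E) d.
  apply: rcvg_unique (gx (c + d)) _; apply: eq_rcvg (rcvgD (gx c) (gx d)) => n.
  by rewrite (psdDr gns_psd).
have gZ w c : (g : E) (w *: c) = w^* * (g : E) c.
  apply: rcvg_unique (gx (w *: c)) _; apply: eq_rcvg (rcvgZ w^* (gx c)) => n.
  by rewrite (psdZr gns_psd).
rewrite -[LHS]/((g : E) (star (z *: a + b) * y)).
by rewrite starP mulrDl -scaleAl gD gZ conjCK.
Qed.

HB.instance Definition _ := GRing.isLinear.Build R[i] B (blin H H) *:%R gns_op gns_op_linear.

Definition gns : @star_representation R B H.
Proof.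
refine (@StarRepresentation R B H gns_op _ _ _).
- by move=> g; apply: complP => y; rewrite -[LHS]/((g : E) (star 1 * y)) star1 mul1r.
- move=> a b g; apply: complP => y.
  by rewrite -[LHS]/((g : E) (star (a * b) * y)) starM -mulrA.
- move=> a g h.
  have [x gx] := compl_ex (g : E); have [y hy] := compl_ex (h : E).
  have l1 := compl_ipP (gns_represented a gx : represented_by (gns_act a g) _) hy.
  have l2 := compl_ipP gx (gns_represented (star a) hy : represented_by (gns_act (star a) h) _).
  by apply: rcvg_unique l1 _; apply: eq_rcvg l2 => n; rewrite gns_adj.
Defined.

Definition gns_vector : H := emb gns_psd 1.

Lemma gns_emb b : gns b gns_vector = emb gns_psd b.
Proof.
apply: complP => y; rewrite -[LHS]/(gns_form 1 (star b * y)) -[RHS]/(gns_form b y).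
by rewrite -gns_adj mulr1.
Qed.

Lemma gns_represents : represents phi gns gns_vector.
Proof.
have inn b : phi b = inner (gns b gns_vector) gns_vector.
  rewrite gns_emb -[RHS]/(compl_ip _ _) compl_ip_emb.
  by rewrite -[RHS]/(phi (star 1 * b)) star1 mul1r.
split=> //; have := inn 1; rewrite rep1 inner_norm sphi.1 => /esym/eqP.
by rewrite sqrf_eq1 => /orP[/eqP//|/eqP h]; have := normr_ge0 gns_vector; rewrite h oppr_ge0 ler10.
Qed.

End GNS.

(** * Orthogonal decomposition and reflections *)

Section Projection.
Context {R : realType} {H : hilbertType R} {A : set H}.
Context (sA : csubspace A) (cA : closed A).
Implicit Types (x y : H).

Definition orthogonal_to (X : set H) x := forall y, X y -> inner x y = 0.

(** [riesz] for the functional <., x> restricted to [A]; its last clause places the representing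
    vector, the projection of [x], in [A]. *)
Lemma orthogonal_decomposition x : exists y z, [/\ A y, orthogonal_to A z & x = y + z].
Proof.
pose D : set (H * R[i]^o) := [set p | A p.1 /\ p.2 = inner p.1 x].
have [||p [_ ->]|y [yD _ yA]] := @riesz R H D (rnorm x).
- split=> [|z p q [Ap pE] [Aq qE]]; first by split; [exact: sA.1|rewrite inner0l].
  split; first exact: sA.2.
  by rewrite /= innerDl innerZl -pE -qE.
- exact: rnorm_ge0.
- by rewrite mulrC; exact: rnorm_inner.
exists y, (x - y); split=> [|a Aa|]; last by rewrite addrC subrK.
  by apply: yA => // p [].
have /yD /= ax : D (a, inner a x) by [].
by rewrite innerC innerBr ax subrr rmorph0.
Qed.

Lemma csubspaceB x y : A x -> A y -> A (x - y).
Proof. by move=> Ax Ay; rewrite addrC -scaleN1r; apply: sA.2. Qed.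

Lemma orthogonal_decomposition_uniq y z y' z' : A y -> A y' ->
  orthogonal_to A z -> orthogonal_to A z' -> y + z = y' + z' -> y = y' /\ z = z'.
Proof.
move=> Ay Ay' oz oz' e; have yy : y = y'.
  apply/eqP; rewrite -subr_eq0; apply/eqP/rnorm_eq0/eqP; rewrite -sqrf_eq0.
  have Ad := csubspaceB Ay Ay'.
  have e' : y - y' = z' - z.
    by apply/eqP; rewrite subr_eq addrAC eq_sym subr_eq eq_sym e addrC.
  apply/eqP/complexI; rewrite -inner_rnorm {1}e' innerBl oz// oz'// subrr//.
by split=> //; move: e; rewrite yy => /addrI.
Qed.

(** U = 1 - 2P rather than the projection P onto [A]: composed with the isometry of a dilation it is
    again an isometry, as [maximal_part_commutant] requires. *)
Lemma reflection : exists U : blin H H,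
  [/\ forall x, rnorm (U x) = rnorm x, adjoint U U,
      forall y z, A y -> orthogonal_to A z -> U (y + z) = z - y & forall x, U (U x) = x].
Proof.
have /choice[P hP] x : exists p : H * H, [/\ A p.1, orthogonal_to A p.2 & x = p.1 + p.2].
  by have [y [z h]] := orthogonal_decomposition x; exists (y, z).
pose f x := (P x).2 - (P x).1.
have fE y z : A y -> orthogonal_to A z -> f (y + z) = z - y.
  move=> Ay oz; have [Ap op e] := hP (y + z).
  by have [y1 z1] := orthogonal_decomposition_uniq Ay Ap oz op e; rewrite /f -y1 -z1.
have A0 : A 0 := sA.1.
have oD z x y : orthogonal_to A x -> orthogonal_to A y -> orthogonal_to A (z *: x + y).
  by move=> ox oy a Aa; rewrite innerDl innerZl ox// oy// mulr0 addr0.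
have lin : linear f.
  move=> z x y; have [Ax ox ex] := hP x; have [Ay oy ey] := hP y.
  have -> : z *: x + y = (z *: (P x).1 + (P y).1) + (z *: (P x).2 + (P y).2).
    by rewrite addrACA -scalerDr -ex -ey.
  rewrite fE; [|exact: sA.2|exact: oD].
  by rewrite /f scalerBr opprD addrACA.
have cross x : inner (P x).1 (P x).2 = 0.
  by have [Ax ox _] := hP x; rewrite innerC ox// rmorph0.
have iso x : rnorm (f x) = rnorm x.
  apply/eqP; rewrite -(@eqrXn2 _ 2)// ?rnorm_ge0//; have [Ax ox {2}->] := hP x.
  by rewrite rnorm_sqrB rnorm_sqrD ox// cross mulr0 subr0 addr0 addrC.
have bnd x : rnorm (f x) <= 1 * rnorm x by rewrite iso mul1r.
exists (mkblin lin (rnorm_bound bnd)); split=> //= [x y|x].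
  have gen x1 x2 y1 y2 : A x1 -> orthogonal_to A x2 -> A y1 -> orthogonal_to A y2 ->
      inner (x2 - x1) (y1 + y2) = inner (x1 + x2) (y2 - y1).
    move=> Ax ox Ay oy; have x1y2 : inner x1 y2 = 0 by rewrite innerC oy// rmorph0.
    rewrite innerBl !innerDr !innerDl !innerNr (ox y1)// x1y2.
    by rewrite !(add0r, addr0, subr0, sub0r, oppr0) addrC.
  have [Ax ox ex] := hP x; have [Ay oy ey] := hP y.
  by have := gen _ _ _ _ Ax ox Ay oy; rewrite -ex -ey.
have [Ax ox ex] := hP x.
have -> : f x = - (P x).1 + (P x).2 by rewrite addrC.
rewrite fE//; first by rewrite opprK [RHS]ex addrC.
by rewrite -scaleN1r -[_ *: _]addr0; apply: sA.2.
Qed.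

End Projection.

(** * The maximal part of a representation *)

Section Dilations.
Context {R : realType} {B : cstarAlgType R} (S : set B).

Definition dilation {H K : hilbertType R} (pi : @star_representation R B H)
    (sigma : @star_representation R B K) (V : blin H K) (Vs : blin K H) : Prop :=
  [/\ Defs.isometry V, adjoint V Vs & forall a, S a -> forall x, pi a x = Vs (sigma a (V x))].

(* The largest subrepresentation of [pi] whose restriction to [S] has the unique
   extension property. *)
Definition maximal_part {H : hilbertType R} (pi : @star_representation R B H) : set H :=
  [set x | forall (K : hilbertType R) (sigma : @star_representation R B K) V Vs,
    dilation pi sigma V Vs -> forall b, sigma b (V x) = V (pi b x)].

Section MaximalPart.
Context {H : hilbertType R} (pi : @star_representation R B H).

Lemma maximal_part_subspace : csubspace (maximal_part pi).
Proof.
split=> [K sigma V Vs _ b|z x y Mx My K sigma V Vs dil b]; first by rewrite !linear0.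
by rewrite !blin_linear (Mx _ _ _ _ dil) (My _ _ _ _ dil).
Qed.

Lemma maximal_part_closed : closed (maximal_part pi).
Proof.
apply: rcvg_closed => u l Mu ul K sigma V Vs dil b.
apply: rcvg_unique (rcvg_blin (sigma b) (rcvg_blin V ul)) _.
apply: eq_rcvg (rcvg_blin V (rcvg_blin (pi b) ul)) => n.
by rewrite /= (Mu n _ _ _ _ dil).
Qed.

(** If (sigma, V) dilates [pi], so does (sigma, V U), because U V^* sigma(a) V U = U pi(a) U = pi(a)
    for [a] in [S]; maximality of [x] is applied to this dilation. *)
Lemma maximal_part_commutant (U : blin H H) x :
  (forall x, rnorm (U x) = rnorm x) -> adjoint U U -> (forall x, U (U x) = x) ->
  (forall b x, U (pi b x) = pi b (U x)) ->
  maximal_part pi x -> maximal_part pi (U x).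
Proof.
move=> iU aU UU cU Mx K sigma V Vs [iV aV dV] b.
have VUb y : rnorm (V (U y)) <= 1 * rnorm y by rewrite mul1r /rnorm iV -/(rnorm (U y)) iU.
have VUl : linear (V \o U) by move=> z y y'; rewrite /= !linearP.
have UVb y : rnorm (U (Vs y)) <= rnorm Vs * rnorm y by rewrite iU; exact: blin_rnorm.
have UVl : linear (U \o Vs) by move=> z y y'; rewrite /= !linearP.
have dil : dilation pi sigma (mkblin VUl (rnorm_bound VUb)) (mkblin UVl (rnorm_bound UVb)).
  split=> [y|y z|a Sa y] /=; first by rewrite iV !rnormE iU.
    by rewrite aV aU.
  by rewrite -dV// -cU UU.
by have /= := Mx _ _ _ _ dil b; rewrite cU.
Qed.

End MaximalPart.
End Dilations.

Section SecondSummand.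
Context {R : realType} (H K : hilbertType R).

Lemma dsnd_bound (p : dsum H K) : rnorm (dsnd p) <= 1 * rnorm p.
Proof. by rewrite mul1r; exact: rnorm_sum_snd. Qed.

Definition dproj2 : blin (dsum H K) K := mkblin (@dsnd_linear R H K) (rnorm_bound dsnd_bound).

Lemma dinj2_linear : linear (fun y : K => dpair (0 : H) y).
Proof.
move=> z x y; rewrite [RHS]dsumE; congr dpair.
by rewrite /dfst /= scaler0 addr0.
Qed.

Lemma dinj2_bound (y : K) : rnorm (dpair (0 : H) y) <= 1 * rnorm y.
Proof. by rewrite mul1r; apply: le_trans (rnorm_sum_le _) _; rewrite /= rnorm0 add0r. Qed.

Definition dinj2 : blin K (dsum H K) := mkblin dinj2_linear (rnorm_bound dinj2_bound).

Lemma id_linear : linear (fun x : H => x). Proof. by []. Qed.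

Lemma id_bound (x : H) : rnorm x <= 1 * rnorm x. Proof. by rewrite mul1r. Qed.

Definition idblin : blin H H := mkblin id_linear (rnorm_bound id_bound).

Lemma rnorm_pair_r (y : K) : rnorm (dpair (0 : H) y) = rnorm y.
Proof.
apply/eqP; rewrite -(@eqrXn2 _ 2)// ?rnorm_ge0//.
by rewrite [rnorm (dpair _ _) ^+ 2]rnorm_sum /= rnorm0 expr0n add0r.
Qed.

Lemma rnorm_pair_l (x : H) : rnorm (dpair x (0 : K)) = rnorm x.
Proof.
apply/eqP; rewrite -(@eqrXn2 _ 2)// ?rnorm_ge0//.
by rewrite [rnorm (dpair _ _) ^+ 2]rnorm_sum /= rnorm0 expr0n addr0.
Qed.

End SecondSummand.

Section Composition.
Context {R : realType} {U V W : normedModType R[i]} (g : blin V W) (f : blin U V).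

Lemma comp_linear : linear (g \o f).
Proof. by move=> z x y; rewrite /= !blin_linear. Qed.

Lemma comp_bound x : rnorm ((g \o f) x) <= rnorm g * rnorm f * rnorm x.
Proof.
rewrite -mulrA; apply: le_trans (blin_rnorm _ _) _.
by apply: ler_wpM2l; [exact: rnorm_ge0|exact: blin_rnorm].
Qed.

Definition compblin : blin U W := mkblin comp_linear (rnorm_bound comp_bound).

End Composition.

Section MaximalPartSum.
Context {R : realType} {B : cstarAlgType R} (S : set B) {H H' : hilbertType R}.
Context (pi : @star_representation R B H) (rho : @star_representation R B H').
Implicit Types (x : H) (y : H').

(** Composing [V] with the two injections gives dilations of [pi] and of [rho]. *)
Lemma maximal_part_dsum x y : maximal_part S pi x -> maximal_part S rho y ->
  maximal_part S (dsum_rep pi rho) (dpair x y).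
Proof.
move=> Mx My K sigma V Vs [iV aV dV] b.
have dil1 : dilation S pi sigma (compblin V (dinj H H')) (compblin (dproj H H') Vs).
  split=> [z|z w|a Sa z] /=.
  - by rewrite iV !rnormE rnorm_pair_l.
  - by rewrite aV inner_dsum /= inner0l addr0.
  - by rewrite -dV//= /dsum_rep_fun /dmap_fun /dfst.
have dil2 : dilation S rho sigma (compblin V (dinj2 H H')) (compblin (dproj2 H H') Vs).
  split=> [z|z w|a Sa z] /=.
  - by rewrite iV !rnormE rnorm_pair_r.
  - by rewrite aV inner_dsum /= inner0l add0r.
  - by rewrite -dV.
have Vsplit (z : H) (w : H') : V (dpair z w) = 1 *: V (dpair z 0) + V (dpair 0 w).
  rewrite -[RHS](blin_linear V 1); congr (V _).
  by rewrite scale1r [RHS]dsumE; congr dpair; rewrite /dfst /dsnd /= ?addr0 ?add0r.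
rewrite (Vsplit x y) [LHS](blin_linear (sigma b) 1).
rewrite [RHS](Vsplit (pi b x) (rho b y)).
by congr (_ *: _ + _); [exact: Mx dil1 b|exact: My dil2 b].
Qed.

(** A dilation of [pi] becomes one of the sum by adding the identity of [rho]; likewise for
    [maximal_part_snd]. *)
Lemma maximal_part_fst p : maximal_part S (dsum_rep pi rho) p -> maximal_part S pi (dfst p).
Proof.
move=> Mp K sigma V Vs [iV aV dV] b.
have dil : dilation S (dsum_rep pi rho) (dsum_rep sigma rho)
    (dmap V (idblin H')) (dmap Vs (idblin H')).
  split; first exact: dmap_isometry.
    exact: dmap_adjoint.
  by move=> a Sa z; rewrite !dsum_repE; congr dpair; apply: dV.
by have /(congr1 (@dfst R K H')) := Mp _ _ _ _ dil b.
Qed.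

Lemma maximal_part_snd p : maximal_part S (dsum_rep pi rho) p -> maximal_part S rho (dsnd p).
Proof.
move=> Mp K sigma V Vs [iV aV dV] b.
have dil : dilation S (dsum_rep pi rho) (dsum_rep pi sigma)
    (dmap (idblin H) V) (dmap (idblin H) Vs).
  split; first exact: dmap_isometry.
    exact: dmap_adjoint.
  by move=> a Sa z; rewrite !dsum_repE; congr dpair; apply: dV.
by have /(congr1 (@dsnd R H K)) := Mp _ _ _ _ dil b.
Qed.

End MaximalPartSum.

(** * The value of the projection at a functional *)

Section MaximalValue.
Context {R : realType} {B : cstarAlgType R} (S : set B).
Implicit Types (f g : dual B) (m n : R[i]).

(* [m] is the value of the projection onto the maximal part at the functional [f],
   computed in some representation where [f] is a vector functional. *)
Definition maximal_value f m := exists (H : hilbertType R) (pi : @star_representation R B H)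
  (x1 x2 y : H), [/\ maximal_part S pi x1, orthogonal_to (maximal_part S pi) x2,
    forall b, f b = inner (pi b (x1 + x2)) y & m = inner x1 y].

(** Functionals from unrelated representations are added in the direct sum. The second vector stays
    orthogonal because maximal vectors of the sum have maximal coordinates. *)
Lemma maximal_value_linear (z : R[i]) f g m n : maximal_value f m -> maximal_value g n ->
  maximal_value (z *: f + g) (z * m + n).
Proof.
move=> [H [pi [x1 [x2 [y [M1 o2 fE ->]]]]]] [K [rho [x1' [x2' [y' [M1' o2' gE ->]]]]]].
have [M0 Mlin] := maximal_part_subspace S pi.
exists (dsum H K), (dsum_rep pi rho), (dpair (z *: x1) x1'), (dpair (z *: x2) x2'), (dpair y y').
split.
- apply: maximal_part_dsum => //.
  by rewrite -[z *: x1]addr0; apply: Mlin.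
- move=> p Mp; have Mp1 := maximal_part_fst Mp; have Mp2 := maximal_part_snd Mp.
  rewrite (dsumE p) inner_dpair innerZl (o2 _ Mp1) (o2' _ Mp2).
  by rewrite mulr0 addr0.
- move=> b.
  have pE : pi b (z *: x1 + z *: x2) = z *: pi b (x1 + x2) by rewrite -scalerDr linearZ.
  have vE : dsum_rep pi rho b (dpair (z *: x1) x1' + dpair (z *: x2) x2') =
      dpair (z *: pi b (x1 + x2)) (rho b (x1' + x2')) by rewrite -pE.
  by rewrite vE inner_dpair innerZl -fE -gE.
- by rewrite inner_dpair innerZl.
Qed.

(* The reflection [U] commutes with [pi], hence preserves the maximal part and its
   complement; it fixes [x1 + x2], so it fixes [x1], and [x1] is orthogonal to [y]. *)
Lemma maximal_value0 m : maximal_value 0 m -> m = 0.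
Proof.
move=> [H [pi [x1 [x2 [y [M1 o2 fE ->]]]]]].
(* The orthogonal complement of the cyclic subspace of x1 + x2; it contains [y], since the
   functional is 0. *)
pose A : set H := [set z | forall b, inner (pi b (x1 + x2)) z = 0].
have sA : csubspace A.
  split=> [b|w z z' Az Az' b]; first by rewrite innerC inner0l rmorph0.
  by rewrite innerDr innerZr Az Az' mulr0 addr0.
have cA : closed A.
  apply: rcvg_closed => u l Au ul b; rewrite innerC.
  suff -> : inner l (pi b (x1 + x2)) = 0 by rewrite rmorph0.
  apply: (rcvg_unique (rcvg_innerl _ ul)).
  by apply: eq_rcvg (rcvg_cst 0) => n; rewrite innerC Au rmorph0.
have piA c z : A z -> A (pi c z).
  by move=> Az b; rewrite -[c]starK -rep_inner -repM.
have pioA c z : orthogonal_to A z -> orthogonal_to A (pi c z).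
  by move=> oz w Aw; rewrite rep_inner; apply/oz/piA.
have [U [iU aU UE UU]] := reflection sA cA.
have U_o z : orthogonal_to A z -> U z = z.
  by move=> oz; have := UE _ _ sA.1 oz; rewrite add0r subr0.
have cU b z : U (pi b z) = pi b (U z).
  have [z1 [z2 [Az oz ->]]] := orthogonal_decomposition sA cA z.
  rewrite UE//; have -> : pi b (z1 + z2) = pi b z1 + pi b z2 by rewrite linearD.
  rewrite UE; [|exact: piA|exact: pioA].
  by rewrite linearB.
have Ux : U (x1 + x2) = x1 + x2.
  by apply: U_o => z /(_ 1); rewrite rep1.
have MU z : maximal_part S pi z -> maximal_part S pi (U z) by apply: maximal_part_commutant.
have oU : orthogonal_to (maximal_part S pi) (U x2).
  by move=> z Mz; rewrite aU; apply/o2/MU.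
have [x1U _] : U x1 = x1 /\ U x2 = x2.
  apply: (orthogonal_decomposition_uniq (maximal_part_subspace S pi)) => //.
    exact: MU.
  by rewrite -Ux linearD.
have [z1 [z2 [Az oz x1E]]] := orthogonal_decomposition sA cA x1.
(* [U] negates the component of [x1] in [A], yet fixes [x1]. *)
have z10 : z1 = 0.
  have e : z1 + z2 = - z1 + z2 by rewrite -x1E -[LHS]x1U x1E UE// addrC.
  have Nz : A (- z1) by rewrite -scaleN1r -[_ *: _]addr0; apply: sA.2 => //; exact: sA.1.
  have [zN _] := orthogonal_decomposition_uniq sA Az Nz oz oz e.
  by rewrite -(rscale_half z1) {1}zN addNr rscaler0.
by rewrite x1E z10 add0r; apply: oz => b; rewrite -fE.
Qed.

Lemma maximal_value_uniq f m n : maximal_value f m -> maximal_value f n -> m = n.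
Proof.
move=> fm fn; have := maximal_value_linear (-1) fn fm.
rewrite scaleN1r addNr => /maximal_value0/eqP.
by rewrite mulN1r addrC subr_eq0 => /eqP.
Qed.

Hypothesis one_neq0 : (1 : B) != 0.

Lemma dominating_state f : exists2 phi : dual B, state phi &
  forall b, rnorm (f b : R[i]^o) ^+ 2 <= rnorm f ^+ 2 * Re (phi (star b * b)).
Proof.
have fb b : rnorm (f b : R[i]^o) <= rnorm f * rnorm b by exact: blin_rnorm.
have [c0|c0] := eqVneq (rnorm f) 0.
  have [|phi sphi _] := @exists_dominating_state R B one_neq0 f.
    by move=> b; apply: le_trans (fb b) _; rewrite c0 mul0r rnorm_ge0.
  exists phi => // b; rewrite c0 expr0n mul0r.
  have : rnorm (f b : R[i]^o) == 0.
    by rewrite eq_le rnorm_ge0 andbT; apply: le_trans (fb b) _; rewrite c0 mul0r.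
  by move=> /eqP ->; rewrite expr0n.
have cp : 0 < rnorm f by rewrite lt_neqAle eq_sym c0 rnorm_ge0.
have gE b : rnorm (((rnorm f)^-1 *:: f) b : R[i]^o) = (rnorm f)^-1 * rnorm (f b : R[i]^o).
  rewrite -[(rnorm f)^-1 in RHS]gtr0_norm ?invr_gt0//.
  exact: (rnormZ (V := R[i]^o)).
have [|phi sphi hphi] := @exists_dominating_state R B one_neq0 ((rnorm f)^-1 *:: f).
  by move=> b; rewrite gE ler_pdivrMl.
exists phi => // b; have := hphi b; rewrite gE exprMn exprVn ler_pdivrMl//.
by rewrite exprn_gt0.
Qed.

Lemma maximal_value_total f : exists2 m, maximal_value f m & rnorm (m : R[i]^o) <= rnorm f.
Proof.
have [phi sphi hphi] := dominating_state f.
pose pi := gns sphi; pose x := gns_vector sphi.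
have [x1 phiE] := gns_represents sphi.
have nx : rnorm x = 1 by rewrite /rnorm x1.
(* Domination reads |f b| <= |f| |pi b x|, so [f b] depends only on [pi b x], and this graph
   satisfies the bound in [riesz]. *)
pose D : set (completion (gns_psd sphi) * R[i]^o) := [set p | exists b, p = (pi b x, f b)].
have [||p [b ->]|y [yD yf _]] := @riesz R _ D (rnorm f).
- split=> [|z p q [a ->] [b ->]]; first by exists 0; rewrite !linear0.
  by exists (z *: a + b); rewrite !linearP.
- exact: rnorm_ge0.
- rewrite -(@ler_pXn2r _ 2)// ?nnegrE ?mulr_ge0 ?rnorm_ge0//.
  apply: le_trans (hphi b) _; rewrite exprMn; apply: ler_wpM2l; first exact: sqr_ge0.
  by rewrite phiE repM rep_inner starK inner_rnorm.
have [u [v [Mu ov xE]]] := orthogonal_decomposition (maximal_part_subspace S pi)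
  (@maximal_part_closed _ _ S _ pi) x.
exists (inner u y).
  exists _, pi, u, v, y; split=> // b; rewrite -xE.
  by have /yD : D (pi b x, f b) by exists b.
apply: le_trans (rnorm_inner _ _) _; rewrite -[leRHS]mul1r; apply: ler_pM => //;
  try exact: rnorm_ge0.
have := rnorm_sqrD u v; rewrite -xE nx innerC ov// rmorph0 mulr0 addr0 expr1n => h.
rewrite -(@ler_pXn2r _ 2)// ?nnegrE ?rnorm_ge0// expr1n h lerDl.
exact: sqr_ge0.
Qed.

End MaximalValue.

(** * Maximal states and maximal vectors *)

Section MaximalStates.
Context {R : realType} {B : cstarAlgType R} (S : set B).
Context (hS : operator_system S) (hgen : cstar_generated S = [set: B]).

(** [A] need not be an algebra or self-adjoint; the elements [c] such that [c] and [star c] both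
    multiply [A] into itself form a C*-subalgebra containing [S], and multiplying 1 gives the
    claim. *)
Lemma generated_induction (A : set B) : A 1 -> csubspace A -> closed A ->
  (forall s a, S s -> A a -> A (s * a)) -> forall b, A b.
Proof.
move=> A1 [A0 Alin] cA SA b.
pose A2 : set B := [set c | forall a, A a -> A (c * a) /\ A (star c * a)].
have [S1 _ Sstar] := hS.
have A2b : A2 b.
  have : cstar_generated S b by rewrite hgen.
  apply; split=> [|s Ss a Aa]; last by split; apply: SA => //; apply: Sstar.
  split.
  - split=> [a Aa|z c d Ac Ad a Aa|c Ac a Aa].
    + by rewrite star1 !mul1r.
    + have [c1 c2] := Ac _ Aa; have [d1 d2] := Ad _ Aa.
      by rewrite starP !mulrDl -!scaleAl; split; apply: Alin.
    + by rewrite starK; case: (Ac _ Aa).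
  - move=> c d Ac Ad a Aa; rewrite starM -!mulrA.
    have [c1 c2] := Ac _ Aa; have [d1 d2] := Ad _ Aa.
    by split; [case: (Ac _ d1)|case: (Ad _ c2)].
  - apply: rcvg_closed => u l Au ul a Aa; split.
      by apply: closed_rcvg (rcvg_mulr a ul) => // n; case: (Au n _ Aa).
    by apply: closed_rcvg (rcvg_mulr a (rcvg_star ul)) => // n; case: (Au n _ Aa).
by have [] := A2b _ A1; rewrite mulr1.
Qed.

Lemma maximal_vector_state (phi : dual B) (sphi : state phi) :
  dilation_maximal S phi -> maximal_part S (gns sphi) (gns_vector sphi).
Proof.
move=> mphi; set pi := gns sphi; set x := gns_vector sphi.
have [x1 phiE] := gns_represents sphi.
move=> K sigma V Vs [iV aV dV].
have nVx : rnorm (V x) = 1 by rewrite /rnorm iV x1.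
pose psi := vector_functional sigma (V x) (V x).
have psiE : psi = phi.
  apply: mphi; split=> //; first exact: vector_functional_state.
  exists (completion (gns_psd sphi)), K, pi, x, sigma, (V x), V, Vs.
  by split=> //; split=> //; rewrite iV x1.
have normE b : rnorm (sigma b (V x)) = rnorm (pi b x).
  apply/eqP; rewrite -(@eqrXn2 _ 2)// ?rnorm_ge0//; apply/eqP/complexI.
  have -> : (rnorm (pi b x) ^+ 2)%:C = phi (star b * b).
    by rewrite phiE -/pi -/x repM rep_inner starK inner_rnorm.
  transitivity (psi (star b * b)); last by rewrite psiE.
  by rewrite /= repM rep_inner starK inner_rnorm.
apply: generated_induction.
- by rewrite !rep1.
- split=> [|z a b aE bE]; first by rewrite !linear0.
  have -> : sigma (z *: a + b) (V x) = z *: sigma a (V x) + sigma b (V x).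
    by rewrite linearP.
  have -> : pi (z *: a + b) x = z *: pi a x + pi b x by rewrite linearP.
  by rewrite aE bE blin_linear.
- apply: rcvg_closed => u l uE ul.
  apply: rcvg_unique (rcvg_rep sigma (V x) ul) _.
  by apply: eq_rcvg (rcvg_blin V (rcvg_rep pi x ul)) => n; rewrite /= uE.
(* [w] lies in the range of [V], since [V^*] does not decrease its norm. *)
- move=> s a Ss aE; set w := sigma (s * a) (V x).
  have VsE : Vs w = pi (s * a) x by rewrite /w repM aE -dV// repM.
  apply/eqP; rewrite -subr_eq0; apply/eqP/rnorm_eq0/eqP; rewrite -sqrf_eq0.
  have nV : rnorm (V (pi (s * a) x)) = rnorm (pi (s * a) x) by rewrite /rnorm iV.
  rewrite rnorm_sqrB nV normE innerC aV VsE inner_rnorm Re_conjc /=.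
  by apply/eqP; ring.
Qed.

(** By uniqueness the value 1 may be computed in the representation of the given dilation, where it
    is |u|^2 for the maximal component [u] of [x]. As |x| = 1, [x] itself is maximal. *)
Lemma maximal_value_maximal (phi : dual B) : state phi -> maximal_value S phi 1 ->
  dilation_maximal S phi.
Proof.
move=> sphi phi1 psi [_ _ [H [K [pi [x [sigma [y [V [Vs]]]]]]]]].
move=> [[x1 phiE] [y1 psiE] [iV Vx] aV dV].
have [u [v [Mu ov xE]]] := orthogonal_decomposition (maximal_part_subspace S pi)
  (@maximal_part_closed _ _ S _ pi) x.
have val : maximal_value S phi (inner u x).
  by exists H, pi, u, v, x; split=> // b; rewrite -xE.
have := maximal_value_uniq phi1 val; rewrite xE innerDr (innerC v u) ov// rmorph0 addr0.
rewrite inner_rnorm => /complexI u1.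
have := rnorm_sqrD u v; rewrite -xE /rnorm x1 -/(rnorm u) -/(rnorm v).
rewrite innerC ov// rmorph0 mulr0 addr0 -u1 expr1n -[LHS]addr0 => /addrI/esym/eqP.
rewrite sqrf_eq0 => /eqP/rnorm_eq0 v0.
have Mx : maximal_part S pi x by rewrite xE v0 addr0.
have [S1 _ _] := hS.
have VsV z : Vs (V z) = z by have := dV 1 S1 z; rewrite !rep1.
have dil : dilation S pi sigma V Vs by [].
apply: blinP => b; rewrite psiE phiE -Vx (Mx _ _ _ _ dil) aV.
by rewrite VsV.
Qed.

End MaximalStates.

Theorem theoremA (R : realType) (B : cstarAlgType R) (S : set B)
    (hS : operator_system S) (hgen : cstar_generated S = [set: B]) :
  exists d : bidual B, bidual_projection d /\
    forall phi : dual B, state phi ->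
      (dilation_maximal S phi <-> normal_ext phi d = 1).
Proof.
(* The zero algebra has no state, as phi 1 = 1 fails. *)
have [B0|one_neq0] := eqVneq (1 : B) 0.
  exists 0; split; first by split; apply: blinP => f; rewrite //= rmorph0.
  by move=> phi [phi1 _]; move/eqP: phi1; rewrite B0 linear0 eq_sym oner_eq0.
have total f := maximal_value_total S one_neq0 f.
have /choice[D hD] (f : dual B) : exists m : R[i]^o,
    maximal_value S f m /\ rnorm m <= 1 * rnorm f.
  by have [m mv mf] := total f; exists m; rewrite mul1r.
have DE f m : maximal_value S f m -> D f = m.
  by move=> fm; apply: maximal_value_uniq fm; case: (hD f).
have lin : linear D.
  by move=> z f g; apply: DE; apply: maximal_value_linear; [case: (hD f)|case: (hD g)].
pose d : bidual B := mkblin lin (rnorm_bound (fun f => (hD f).2)).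
exists d; split; last first.
  move=> phi sphi; split=> [mphi|d1].
    apply: DE; have [x1 phiE] := gns_represents sphi.
    exists _, (gns sphi), (gns_vector sphi), 0, (gns_vector sphi); split.
    - exact: maximal_vector_state.
    - by move=> y _; rewrite inner0l.
    - by move=> b; rewrite addr0.
    - by rewrite inner_norm x1 expr1n.
  apply: (maximal_value_maximal hS sphi).
  by rewrite -d1; case: (hD phi).
split; apply: blinP => f.
  (* The action of [d] turns [f] into the functional of [x1] and [y], whose value is again <x1, y>
     since [x1] is its own maximal part. *)
  have [[H [pi [x1 [x2 [y [M1 o2 fE DfE]]]]]] _] := hD f.
  have actE a : arens_act d f a = inner (pi a x1) y.
    rewrite -[LHS]/(D (dual_act f a)); apply: DE.
    exists H, pi, x1, x2, (pi (star a) y); split=> // [b|]; last by rewrite rep_inner.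
    by rewrite -[LHS]/(f (a * b)) fE repM rep_inner.
  rewrite -[LHS]/(D (arens_act d f)) -[RHS]/(D f) DfE; apply: DE.
  exists H, pi, x1, 0, y; split=> // [z _|b]; first by rewrite inner0l.
  by rewrite addr0 actE.
(* [dual_star f] is the functional of [y] and x1 + x2; with [y1] the maximal part of [y], both sides
   equal <x1, y1>. *)
rewrite -[RHS]/(D f) -[LHS]/((D (dual_star f))^*).
have [[H [pi [x1 [x2 [y [M1 o2 fE DfE]]]]]] _] := hD f.
have [y1 [y2 [My1 oy2 yE]]] := orthogonal_decomposition (maximal_part_subspace S pi)
  (@maximal_part_closed _ _ S _ pi) y.
have -> : D (dual_star f) = inner y1 (x1 + x2).
  apply: DE; exists H, pi, y1, y2, (x1 + x2); split=> // b.
  by rewrite -[LHS]/((f (star b))^*) fE -innerC rep_inner ?starK -?yE.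
rewrite DfE yE -innerC innerDl innerDr o2// addr0.
by rewrite (innerC y2) oy2// rmorph0 addr0.
Qed.
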